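(* Let $\mathcal T$ be a compact subset of a Euclidean space, $(\Omega,\mathbb P)$ a probability space, and $f\in\mathcal N=L^2(\Omega,L^2(\mathcal T))$ complex-valued, with mean $\mu(t)=\mathbb E_\omega f(t,\cdot)$ and covariance function $\mathcal C(s,t)=\mathbb E_\omega[(f(s,\cdot)-\mu(s))\overline{(f(t,\cdot)-\mu(t))}]$. Let $T$ be the integral operator on $L^2(\mathcal T)$ with kernel $\mathcal C$, let $L:L^2(\Omega)\to L^2(\mathcal T)$ be $L(g)(t)=\int_\Omega [f(t,\omega)-\mu(t)]g(\omega)\,d\mathbb P$, and let $R(T)$, $R(L)$ be their ranges. Let $\{\phi_k\}$ be the KL basis, with $T\phi_k=\lambda_k\phi_k$, and let $S_n$, $H_{\mathcal C}$, $\mathcal C_j$, $H_{\mathcal C_j}$, $H_K$ be as defined in the context. Then: (i) $H_{\mathcal C}\subset L^2(\mathcal T)$. (ii) $\mathrm{var}[f(t,\cdot)-S_n(t,\cdot)]=\mathcal C(t,t)-\sum_{k=1}^n\lambda_k|\phi_k(t)|^2$; $\ \|f-\mu-S_n\|_{\mathcal N}^2=\sum_{k=n+1}^\infty\lambda_k$; $\ \|\mathrm{var} f\|_{L^1(\mathcal T)}=\sum_{k=1}^\infty\lambda_k$; and $\|S_n\|_{\mathcal N}^2=\mathbb E\sum_{k=1}^n|\langle f_\omega-\mu,\phi_k\rangle|^2=\sum_{k=1}^n\langle T\phi_k,\phi_k\rangle=\sum_{k=1}^n\lambda_k$. (iii) $H_{\mathcal C}$ is the reproducing kernel Hilbert space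 with reproducing kernel $\mathcal C(s,t)$, and, in particular, $\overline{\mathrm{span}\{\mathcal C(s,\cdot)\}}=H_{\mathcal C}$, where the bar means the closure under the $H_{\mathcal C}$ norm. (iv) The KL basis has the optimality property: for any orthonormal basis $\{\psi_k\}$ of $L^2(\mathcal T)$ and any $n$, $\sum_{k=1}^n\langle T\psi_k,\psi_k\rangle\le\sum_{k=1}^n\langle T\phi_k,\phi_k\rangle$. (v) If only finitely many of the $\lambda_k$ are non-zero, then $f_\omega-\mu\in H_{\mathcal C}$ for a.s. $\omega\in\Omega$. (vi) $R(L)=H_{\mathcal C}$ in the set-theoretic sense, and moreover $H_K=H_{\mathcal C}$. In particular, when taking $L^2(\Omega)$ as $L^2(\partial\mathbf D_1)$, where $\mathbf D_1$ is the unit disc, and $f$ the parameterized Szegő kernel, one has, as isometric spaces, $R(L)=H_K=H_{\mathcal C}=H^2(\mathbf D_1)$, the latter being the classical Hardy space in the disc. (vii) Under the natural inner product of $R(T)$, namely that of $H_{\mathcal C_1}$, the identity mappings $R(T)\to H_{\mathcal C}\to L^2(\mathcal T)$ are bounded imbeddings. $R(T)=H_{\mathcal C}=L^2(\mathcal T)$ if and only if there exist only a finite number of non-zero $\lambda_k$'s. (viii) For $j=0,1,\dots$, the spaces $H_{\mathcal C_j}$ are reproducing kernel Hilbert spaces with, respectively, the reproducing kernels $\mathcal C_j$, and $TH_{\mathcal C_j}=H_{\mathcal C_{j+2}}$.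
   Context: $\mathcal N=L^2(\Omega,L^2(\mathcal T))$ is the Hilbert space of $L^2(\mathcal T)$-valued random variables $f$ with $\|f\|_{\mathcal N}^2=\int_\Omega\int_{\mathcal T}|f(x,\omega)|^2\,dx\,d\mathbb P<\infty$; $f_\omega(t)=f(t,\omega)$; $\langle\cdot,\cdot\rangle$ is the inner product of $L^2(\mathcal T)$; $\mathrm{var}$ is the variance with respect to $\omega$, and $\mathrm{var}f$ is the function $t\mapsto\mathrm{var}[f(t,\cdot)]$. $T:L^2(\mathcal T)\to L^2(\mathcal T)$ is $TF(s)=\int_{\mathcal T}\mathcal C(s,t)F(t)\,dt$. It is a Hilbert–Schmidt, hence compact, operator, with conjugate-symmetric non-negative kernel. It has positive eigenvalues $\lambda_1\ge\lambda_2\ge\cdots>0$ with corresponding orthonormal eigenfunctions $\phi_1,\phi_2,\dots$. If these do not span $L^2(\mathcal T)$, a supplementary orthonormal system, corresponding to the eigenvalue zero, is added to form a complete orthonormal basis, the Karhunen–Loève (KL) basis, still denoted $\{\phi_k\}$, with $T\phi_k=\lambda_k\phi_k$, where $\lambda_k$ may now be zero. One has $\mathcal C(s,t)=\sum_{k=1}^\infty\lambda_k\phi_k(s)\overline{\phi_k(t)}$. The KL decomposition is $f(t,\omega)-\mu(t)=\sum_{k=1}^\infty\sqrt{\lambda_k}\,\phi_k(t)\xi_k(\omega)$ in $\mathcal N$, with $\xi_k(\omega)=\frac1{\sqrt{\lambda_k}}\langle f_\omega-\mu,\phi_k\rangle$ for the non-zero $\lambda_k$; its partial sums are $S_n(t,\omega)=\sum_{k=1}^n\sqrt{\lambda_k}\,\phi_k(t)\xi_k(\omega)$,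 $S_0=0$ (terms with $\lambda_k=0$ are zero). Let $\alpha_k=1$ if $\lambda_k>0$ and $\alpha_k=0$ if $\lambda_k=0$; the role of the $\alpha_k$ is that only the terms with non-zero $\lambda_k$ appear in the sums below. Define $$H_{\mathcal C}=\Big\{F\in L^2(\mathcal T)\ \Big|\ \|F\|_{H_{\mathcal C}}^2=\sum_{k=1}^\infty\alpha_k\frac{|\langle F,\phi_k\rangle|^2}{\lambda_k}<\infty\Big\},\qquad \langle F,G\rangle_{H_{\mathcal C}}=\sum_{k=1}^\infty\alpha_k\frac{\langle F,\phi_k\rangle\overline{\langle G,\phi_k\rangle}}{\lambda_k}.$$ For $j=0,1,\dots$ set $\mathcal C_j(s,t)=\sum_{k=1}^\infty\lambda_k^{j+1}\phi_k(s)\overline{\phi_k(t)}$, so $\mathcal C_0=\mathcal C$, and $$H_{\mathcal C_j}=\Big\{F\in L^2(\mathcal T)\ \Big|\ \|F\|_{H_{\mathcal C_j}}^2=\sum_{k=1}^\infty\alpha_k\frac{|\langle F,\phi_k\rangle|^2}{\lambda_k^{j+1}}<\infty\Big\},$$ with the associated inner product $\langle F,G\rangle_{H_{\mathcal C_j}}=\sum_{k=1}^\infty\alpha_k\frac{\langle F,\phi_k\rangle\overline{\langle G,\phi_k\rangle}}{\lambda_k^{j+1}}$. $H_K$ is the reproducing kernel Hilbert space over $R(L)$ whose inner product is defined via the equivalence classes $L^{-1}(G)$ (set inverse) in $L^2(\Omega)$, that is, the inner product transported by $L$ from the quotient of $L^2(\Omega)$ by the kernel of $L$; its reproducing kernel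 is $\mathcal C$. The Szegő kernels, parameterized by $a\in\mathbf D_1$, are $k_a(z)=\frac1{1-\overline a z}$. $H^2(\mathbf D_1)$ is the space of functions $F(z)=\sum_{k=0}^\infty c_kz^k$ on $\mathbf D_1$ with $\|F\|^2=\sum_{k=0}^\infty|c_k|^2<\infty$.
   Formalization: In H_C, H_{C_j} and the L² of (vii)'s equality, functions differing by ker T are identified (claims fail otherwise); sections are C(·,s), s in a full-measure set; Szegő on open disc: centered kernel gives an isometry with H², conj(k_a) uncentered gives equality. *)

(* Defs.v *)
From HB Require Import structures.
From mathcomp Require Import all_boot all_order all_algebra.
From mathcomp Require Import complex.
From mathcomp Require Import all_classical all_reals all_analysis.

Set Implicit Arguments.
Unset Strict Implicit.
Unset Printing Implicit Defensive.

Import Order.TTheory GRing.Theory Num.Theory.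
Import numFieldNormedType.Exports.

Local Open Scope classical_set_scope.
Local Open Scope ring_scope.

(* R^n is represented by n-tuples, which carry the product sigma-algebra;     *)
(* Lebesgue measure on R^(n+1) is the image of lebesgue_measure \x leb n      *)
(* under cons. *)
Notation Rn R n := (n.-tuple (measurableTypeR R)).

Section lebesgue_Rn.
Context {R : realType}.

Definition cons_Rn n (p : measurableTypeR R * Rn R n) : Rn R n.+1 :=
  [the n.+1.-tuple _ of p.1 :: p.2].

Lemma measurable_cons_Rn n : measurable_fun setT (@cons_Rn n).
Proof. exact: measurable_cons. Qed.

Section step.
Context n (m : {sigma_finite_measure set (Rn R n) -> \bar R}).

Definition leb_step : set (Rn R n.+1) -> \bar R :=
  pushforward (lebesgue_measure \x m)%E (@cons_Rn n).

Let image_measure : {measure set (Rn R n.+1) -> \bar R} :=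
  measure_function_pushforward__canonical__measure_function_Measure
    (lebesgue_measure \x m)%E (@measurable_cons_Rn n).

Let leb_step0 : leb_step set0 = 0%E.
Proof. exact: (measure0 image_measure). Qed.

Let leb_step_ge0 A : (0 <= leb_step A)%E.
Proof. exact: (measure_ge0 image_measure). Qed.

Let leb_step_additive : semi_sigma_additive leb_step.
Proof. exact: (@measure_semi_sigma_additive _ _ _ image_measure). Qed.

HB.instance Definition _ := isMeasure.Build _ _ _ leb_step
  leb_step0 leb_step_ge0 leb_step_additive.

Let uncons (x : Rn R n.+1) : measurableTypeR R * Rn R n :=
  (tnth x ord0, [tuple of behead x]).

Let measurable_uncons : measurable_fun setT uncons.
Proof.
apply/measurable_fun_pairP; split.
  exact: (measurable_tnth (ord0 : 'I_n.+1)).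
exact: measurable_behead.
Qed.

Let uncons_cons p : uncons (cons_Rn p) = p.
Proof.
by case: p => a t; rewrite /uncons /cons_Rn/= tnth0; congr pair; exact: val_inj.
Qed.

Let leb_step_sigma_finite : sigma_finite setT leb_step.
Proof.
have /sigma_finiteP[F [TF ndF Foo]] := sigma_finiteT (@lebesgue_measure R).
have /sigma_finiteP[G [TG ndG Goo]] := sigma_finiteT m.
exists (fun i => uncons @^-1` (F i `*` G i)).
  rewrite -preimage_bigcup (_ : \bigcup_i _ = setT) ?preimage_setT//.
  apply/seteqP; split => // -[x y] _.
  have [i _ Fx] : (\bigcup_i F i) x by rewrite -TF.
  have [j _ Gy] : (\bigcup_i G i) y by rewrite -TG.
  exists (maxn i j) => //; split.
  - by move: x Fx; exact/subsetPset/ndF/leq_maxl.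
  - by move: y Gy; exact/subsetPset/ndG/leq_maxr.
move=> i; have [mF Fi] := Foo i; have [mG Gi] := Goo i; split.
  rewrite -[X in measurable X]setTI.
  by apply: measurable_uncons => //; exact: measurableX.
rewrite /leb_step /pushforward (_ : _ @^-1` _ = F i `*` G i).
  by rewrite product_measure1E// lte_mul_pinfty// ge0_fin_numE.
by rewrite -comp_preimage (_ : _ \o _ = id)//; apply/funext => p; exact: uncons_cons.
Qed.

HB.instance Definition _ := Measure_isSigmaFinite.Build _ _ _ leb_step
  leb_step_sigma_finite.

End step.

Fixpoint leb n : {sigma_finite_measure set (Rn R n) -> \bar R} :=
  if n is n'.+1 then leb_step (leb n') else dirac ([tuple] : Rn R 0).

End lebesgue_Rn.

Section complex_L2.
Context {R : realType}.
Local Notation C := R[i].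

Definition sqn (z : C) : R := Normc.normc z ^+ 2.

Context {d} {X : measurableType d}.
Variables (mu : {measure set X -> \bar R}) (D : set X).
Implicit Types F G : X -> C.

Definition measurableC F :=
  measurable_fun D (fun x => complex.Re (F x)) /\
  measurable_fun D (fun x => complex.Im (F x)).

Definition cintegral F : C :=
  (\int[mu]_(x in D) complex.Re (F x) +i* \int[mu]_(x in D) complex.Im (F x))%C.

(* Elements of L^2(D) are represented by functions; equality in L^2(D) is     *)
(* aeq, and all the subsets of L^2(D) below are stable under aeq among        *)
(* measurable functions.  Only the values on D matter. *)
Definition aeq F G := {ae mu, forall x, D x -> F x = G x}.

Definition L2norm2 F : \bar R := (\int[mu]_(x in D) (sqn (F x))%:E)%E.

Definition L2 : set (X -> C) :=
  [set F | measurableC F /\ (L2norm2 F < +oo)%E].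

Definition L2ip F G : C := cintegral (fun x => F x * (G x)^*%C).

Definition lin_span (S : set (X -> C)) : set (X -> C) :=
  [set F | exists n (c : 'I_n -> C) (u : 'I_n -> X -> C),
     (forall i, S (u i)) /\ F = (fun x => \sum_(i < n) c i * u i x)].

Definition closure_in (H : set (X -> C)) (norm2 : (X -> C) -> \bar R)
    (S : set (X -> C)) : set (X -> C) :=
  [set F | H F /\ forall eps : R, 0 < eps ->
     exists2 G, S G & (norm2 (F \- G)%R < eps%:E)%E].

Definition orthonormal_basis (I : eqType) (e : I -> X -> C) :=
  [/\ forall i, L2 (e i),
      forall i j, L2ip (e i) (e j) = (i == j)%:R &
      closure_in L2 L2norm2 (lin_span (range e)) = L2].

Definition hilbert_space (H : set (X -> C)) (ip : (X -> C) -> (X -> C) -> C) :=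
  [/\ H (fun=> 0) /\
        (forall (a : C) F G, H F -> H G -> H (fun x => a * F x + G x)),
      forall (a : C) F G K, H F -> H G -> H K ->
        ip (fun x => a * F x + G x) K = a * ip F K + ip G K,
      forall F G, H F -> H G -> ip G F = (ip F G)^*%C,
      forall F, H F -> 0 <= ip F F /\ (ip F F = 0 <-> aeq F (fun=> 0)) &
      forall u : nat -> X -> C, (forall n, H (u n)) ->
        (forall eps : R, 0 < eps -> exists N, forall m n, (N <= m)%N ->
           (N <= n)%N -> complex.Re (ip (u m \- u n) (u m \- u n)) < eps) ->
        exists2 F, H F & forall eps : R, 0 < eps -> exists N, forall n,
           (N <= n)%N -> complex.Re (ip (u n \- F) (u n \- F)) < eps].

Definition conull (E : set X) :=
  [/\ measurable E, E `<=` D & mu (D `\` E) = 0%E].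

(* Kernels and elements of H are only defined almost everywhere, hence the    *)
(* conull set E on which everything is pointwise: F |-> ip F (K ^~ s), s in   *)
(* E, is the version of F whose restriction to E belongs to the genuine       *)
(* reproducing kernel Hilbert space with kernel K on E.  The section of K at  *)
(* s is t |-> K t s. *)
Definition rkhs_on (E : set X) (H : set (X -> C))
    (ip : (X -> C) -> (X -> C) -> C) (K : X -> X -> C) :=
  [/\ hilbert_space H ip,
      forall s, E s -> H (K ^~ s),
      forall F, H F -> aeq F (fun s => ip F (K ^~ s)) &
      forall s t, E s -> E t -> ip (K ^~ s) (K ^~ t) = K t s].

(* The convergence of these series is a property of the arguments supplied    *)
(* below (limits of divergent series are unspecified). *)
Definition cseries (u : nat -> C) : C :=
  (limn (series (fun k => complex.Re (u k))) +i*
   limn (series (fun k => complex.Im (u k))))%C.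

(* (phi, lam) is the whole Karhunen-Loeve system of T: phi (inl k) is the     *)
(* sequence listed by nonincreasing eigenvalue lam k; phi (inr j) are the     *)
(* further eigenfunctions of eigenvalue zero, needed when infinitely many     *)
(* lam k are positive and T has a kernel.  They contribute to none of the     *)
(* sums below. *)
Section KL.
Context {J : countType}.
Variables (lam : nat -> R) (phi : nat + J -> X -> C).

Definition eigval (k : nat + J) : R := if k is inl n then lam n else 0.

Definition KL_basis (T : (X -> C) -> X -> C) :=
  [/\ orthonormal_basis phi,
      forall k, 0 <= lam k,
      forall k, lam k.+1 <= lam k &
      forall k, aeq (T (phi k)) (fun x => (eigval k)%:C%C * phi k x)].

Definition alpha (k : nat) : R := if 0 < lam k then 1 else 0.

Definition HCnorm2 (j : nat) F : \bar R :=
  (\sum_(0 <= k <oo)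
     (alpha k * (sqn (L2ip F (phi (inl k))) / lam k ^+ j.+1))%:E)%E.

Definition HCip (j : nat) F G : C :=
  cseries (fun k => (alpha k / lam k ^+ j.+1)%:C%C *
    (L2ip F (phi (inl k)) * (L2ip G (phi (inl k)))^*%C)).

Definition HCfull (j : nat) : set (X -> C) :=
  [set F | L2 F /\ (HCnorm2 j F < +oo)%E].

(* HCnorm2 vanishes on the eigenspace of eigenvalue zero, so it is a norm     *)
(* only once functions differing by an element of that eigenspace are         *)
(* identified.  The quotient of V is represented by the elements of V         *)
(* orthogonal to that eigenspace, i.e. those that expand over the phi k with  *)
(* nonzero eigenvalue; when zero is not an eigenvalue mod_null V is V. *)
Definition mod_null (V : set (X -> C)) : set (X -> C) :=
  V `&` [set F | forall k, eigval k = 0 -> L2ip F (phi k) = 0].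

Definition HC (j : nat) : set (X -> C) := mod_null (HCfull j).

Definition Cker (j : nat) (s t : X) : C :=
  cseries (fun k => (lam k ^+ j.+1)%:C%C *
    (phi (inl k) s * (phi (inl k) t)^*%C)).

End KL.
End complex_L2.

Section random_field.
Context {R : realType} {d} {X : measurableType d}.
Variables (mu : {measure set X -> \bar R}) (D : set X).
Context {dO} {O : measurableType dO}.
Variable P : probability O R.
Local Notation C := R[i].

Definition cvar (Z : O -> C) : \bar R :=
  (\int[P]_w (sqn (Z w - cintegral P setT Z)%R)%:E)%E.

Definition Nnorm2 (g : X -> O -> C) : \bar R :=
  (\int[P]_w \int[mu]_(x in D) (sqn (g x w))%:E)%E.

Definition inN (g : X -> O -> C) :=
  measurableC (D `*` [set: O]) (fun p : X * O => g p.1 p.2) /\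
  (Nnorm2 g < +oo)%E.

Definition mean (f : X -> O -> C) (t : X) : C := cintegral P setT (f t).

Definition centered (f : X -> O -> C) (t : X) (w : O) : C := f t w - mean f t.

(* In the sequel h stands for the centered field f - mean f. *)
Section centered_field.
Variable h : X -> O -> C.

Definition cov (s t : X) : C := cintegral P setT (fun w => h s w * (h t w)^*%C).

Definition Top (F : X -> C) (s : X) : C :=
  cintegral mu D (fun t => cov s t * F t).

Definition Lop (g : O -> C) (t : X) : C :=
  cintegral P setT (fun w => h t w * g w).

Definition image_of (T : (X -> C) -> X -> C) (V : set (X -> C)) :
    set (X -> C) :=
  [set G | L2 mu D G /\ exists2 F, V F & aeq mu D G (T F)].

Definition RT : set (X -> C) := image_of Top (L2 mu D).

Definition RL : set (X -> C) :=
  [set F | L2 mu D F /\ exists2 g, L2 P setT g & aeq mu D F (Lop g)].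

Definition kerL : set (O -> C) :=
  [set g | L2 P setT g /\ aeq mu D (Lop g) (fun=> 0)].

(* The class of L^-1(F) in L^2(O) / ker L, represented by its element         *)
(* orthogonal to ker L. *)
Definition HKlift (F : X -> C) : O -> C :=
  xget (fun=> 0) [set g | [/\ L2 P setT g, aeq mu D (Lop g) F &
    forall g', kerL g' -> L2ip P setT g g' = 0]].

(* H_K is the set RL with this inner product. *)
Definition HKip (F G : X -> C) : C := L2ip P setT (HKlift F) (HKlift G).

Section KL_sums.
Context {J : countType}.
Variables (lam : nat -> R) (phi : nat + J -> X -> C).

Definition xi (k : nat) (w : O) : C :=
  ((Num.sqrt (lam k))^-1)%:C%C * L2ip mu D (h ^~ w) (phi (inl k)).

Definition Ssum (n : nat) (t : X) (w : O) : C :=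
  \sum_(k < n) (Num.sqrt (lam k))%:C%C * phi (inl (k : nat)) t * xi k w.

End KL_sums.
End centered_field.
End random_field.

Section hardy.
Context {R : realType}.
Local Notation C := R[i].

Definition toC (a : Rn R 2) : C := (tnth a ord0 +i* tnth a ord_max)%C.

Definition disc : set (Rn R 2) := [set a | sqn (toC a) < 1].

(* The unit circle with normalized arc length: theta in [0, 2 pi] with the    *)
(* uniform probability stands for e^(i theta). *)
Lemma pi2_gt0 : 0 < (pi *+ 2 : R).
Proof. by rewrite mulrn_wgt0// pi_gt0. Qed.

Definition circle : probability (measurableTypeR R) R := uniform_prob pi2_gt0.

Definition cis (theta : measurableTypeR R) : C := (cos theta +i* sin theta)%C.

Definition szego (a z : C) : C := (1 - a^*%C * z)^-1.

Definition szego_field (a : Rn R 2) (theta : measurableTypeR R) : C :=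
  szego (toC a) (cis theta).

(* c is the sequence of Taylor coefficients of the element F of H^2. *)
Definition hardy_coef (F : C -> C) (c : nat -> C) :=
  (\sum_(0 <= k <oo) (sqn (c k))%:E < +oo)%E /\
  forall z, sqn z < 1 -> F z = cseries (fun k => c k * z ^+ k).

Definition hardy : set (C -> C) := [set F | exists c, hardy_coef F c].

Definition hardy_ip (c d : nat -> C) : C := cseries (fun k => c k * (d k)^*%C).

(* U is an isometry of H^2 onto H_K = RL, and H_K = H_C, for the field h on   *)
(* the unit disc; the elements of RL are considered in L^2(disc). *)
Definition hardy_isometry (h : Rn R 2 -> measurableTypeR R -> C)
    (U : (C -> C) -> Rn R 2 -> C) :=
  [/\ RL (leb 2) disc circle h =
        [set G | L2 (leb 2) disc G /\
           exists2 F, hardy F & aeq (leb 2) disc G (U F)],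
      forall F G c d, hardy_coef F c -> hardy_coef G d ->
        HKip (leb 2) disc circle h (U F) (U G) = hardy_ip c d &
      forall (J : countType) (lam : nat -> R) (phi : nat + J -> Rn R 2 -> C),
        KL_basis (leb 2) disc lam phi (Top (leb 2) disc circle h) ->
        RL (leb 2) disc circle h = HC (leb 2) disc lam phi 0 /\
        forall F G, HC (leb 2) disc lam phi 0 F -> HC (leb 2) disc lam phi 0 G ->
          HKip (leb 2) disc circle h F G = HCip (leb 2) disc lam phi 0 F G].

End hardy.

(* Main.v *)
Require Import Defs.
From HB Require Import structures.
From mathcomp Require Import all_boot all_order all_algebra.
From mathcomp Require Import complex finmap.
From mathcomp Require Import all_classical all_reals all_analysis.
From mathcomp Require Import measurable_realfun.
From mathcomp Require Import ring lra.

(** Write h = f - mu for the centered field and L^* for the adjoint of L.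
    Everything rests on the factorization T = L L^* (Top_Ladj), which is Fubini's
    theorem for the square integrable kernel h, and on the random variables
    eta_k = L^* phi_k, whose values are the conjugates of <h_w, phi_k>.

    Since T phi_k = lam_k phi_k, the eta_k are orthogonal with squared norms
    lam_k (ip_eta). For almost every t the conjugate of h(t, .) has inner
    products lam_k conj(phi_k(t)) with them, and S_n(t, .) is its projection on
    the first n, up to conjugation. This gives the variance of the residual
    (cvar_residual); Parseval's identity for each sample, integrated term by
    term, gives the norms in N (norm_residual, norm_Ssum). The variance of h(t, .)
    dominates the sum of the lam_k |phi_k(t)|^2, and both have the same integral,
    namely the sum of the lam_k: hence they agree for t in a conull set E
    (ae_variance). On E the projections of h(t, .) therefore converge to it, the
    covariance is the pointwise sum of lam_k phi_k(s) conj(phi_k(t))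
    (cov_series), and the section of C_j at s is an L^2 function with
    coefficients lam_k^(j+1) conj(phi_k(s)). The inner product in H_{C_j} of F
    with that section is the expansion of F at s, which makes C_j reproducing
    (rkhs_kernel). A function orthogonal to every section vanishes, so the
    sections are total.

    In terms of coefficients, L maps g to the sum of the <g, eta_k> phi_k. Bessel's
    inequality for the eta_k puts R(L) in H_C, and the sum of the
    <F, phi_k> eta_k / lam_k is the preimage of F in H_C orthogonal to the kernel
    of L, with the norm of F in H_C (RL_eq_HC, HKip_HCip). The operator T
    multiplies coefficients by lam_k, which gives its ranges on the scale of
    spaces (RT_eq_HC, T_HC) and, when infinitely many lam_k are positive, an
    element of L^2 outside H_C (RT_full). Optimality is a rearrangement
    inequality for the weights sum_i |<psi_i, phi_k>|^2 (KL_optimal).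

    The Szego kernel is not square integrable on the product of the disc and the
    circle, since the integral of 1 / (1 - |a|^2) over the disc diverges. But it
    is the sum of the conj(a)^k e^(i k theta), where the exponentials are
    orthonormal on the circle and the powers of a are orthogonal on the disc with
    bounded norms. This is enough for L to have an adjoint and for L^* to satisfy
    T = L L^* (orthogonal_has_adjoint), so that R(L) = H_K = H_C holds as before;
    moreover, for the conjugate of the kernel, L maps sum c_k e^(i k theta) to the
    power series sum c_k a^k, which identifies R(L) with the Hardy space, and
    centering only removes the constant exponential. The orthogonality of the powers comes
    from the rotation invariance of planar Lebesgue measure, a rotation being a
    product of three shears (leb_rot). *)

Set Implicit Arguments.
Unset Strict Implicit.
Unset Printing Implicit Defensive.

Import Order.TTheory GRing.Theory Num.Theory.
Import numFieldNormedType.Exports.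

Local Open Scope classical_set_scope.
Local Open Scope ring_scope.
Local Notation Re := complex.Re.
Local Notation Im := complex.Im.

(** * Complex numbers *)

Section complex_numbers.
Context {R : realType}.
Local Notation C := R[i].
Implicit Types (x y z : C) (u : nat -> C).

Lemma sqnE z : sqn z = Re z ^+ 2 + Im z ^+ 2.
Proof. by case: z => a b; rewrite /sqn /= sqr_sqrtr// addr_ge0// sqr_ge0. Qed.

Lemma sqn_ge0 z : 0 <= sqn z.
Proof. exact: sqr_ge0. Qed.

Lemma sqn0 : sqn (0 : C) = 0.
Proof. by rewrite sqnE /= expr0n addr0. Qed.

Lemma sqn1 : sqn (1 : C) = 1.
Proof. by rewrite sqnE /= expr0n addr0 expr1n. Qed.

Lemma mulJ z : z * z^*%C = (sqn z)%:C%C.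
Proof.
rewrite sqnE; case: z => a b; apply/eqP; rewrite eq_complex /=.
by apply/andP; split; apply/eqP; ring.
Qed.

Lemma sqnM x y : sqn (x * y) = sqn x * sqn y.
Proof. by rewrite !sqnE; case: x => a b; case: y => c d /=; ring. Qed.

Lemma sqnJ z : sqn z^*%C = sqn z.
Proof. by rewrite !sqnE; case: z => a b /=; ring. Qed.

Lemma sqnN z : sqn (- z) = sqn z.
Proof. by rewrite !sqnE; case: z => a b /=; ring. Qed.

Lemma sqnB x y : sqn (x - y) = sqn (y - x).
Proof. by rewrite -sqnN opprB. Qed.

Lemma sqnR (r : R) : sqn r%:C%C = r ^+ 2.
Proof. by rewrite sqnE /= expr0n addr0. Qed.

Lemma sqnX z n : sqn (z ^+ n) = sqn z ^+ n.
Proof. by elim: n => [|n ih]; rewrite ?sqn1// !exprS sqnM ih. Qed.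

Lemma sqn_eq0 z : sqn z = 0 -> z = 0.
Proof.
rewrite sqnE => /eqP; rewrite paddr_eq0 ?sqr_ge0// !sqrf_eq0 => /andP[/eqP a /eqP b].
by apply/eqP; rewrite eq_complex a b /= !eqxx.
Qed.

Lemma sqnV z : sqn z^-1 = (sqn z)^-1.
Proof.
have [->|z0] := eqVneq z 0; first by rewrite invr0 sqn0 invr0.
have sz : sqn z != 0 by apply: contra_neq z0; exact: sqn_eq0.
by apply: (mulfI sz); rewrite -sqnM divff// sqn1 divff.
Qed.

Lemma sqnD_le x y : sqn (x + y) <= 2 * sqn x + 2 * sqn y.
Proof.
rewrite !sqnE; case: x => a b; case: y => c d /=.
rewrite -subr_ge0 (_ : _ - _ = (a - c) ^+ 2 + (b - d) ^+ 2); last by ring.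
by rewrite addr_ge0// sqr_ge0.
Qed.

Lemma Re_sqr_le z : Re z ^+ 2 <= sqn z.
Proof. by rewrite sqnE lerDl sqr_ge0. Qed.

Lemma Im_sqr_le z : Im z ^+ 2 <= sqn z.
Proof. by rewrite sqnE lerDr sqr_ge0. Qed.

Lemma ReD x y : Re (x + y) = Re x + Re y.
Proof. by case: x; case: y. Qed.

Lemma ImD x y : Im (x + y) = Im x + Im y.
Proof. by case: x; case: y. Qed.

Lemma ReN x : Re (- x) = - Re x.
Proof. by case: x. Qed.

Lemma ImN x : Im (- x) = - Im x.
Proof. by case: x. Qed.

Lemma ReB x y : Re (x - y) = Re x - Re y.
Proof. by rewrite ReD ReN. Qed.

Lemma ImB x y : Im (x - y) = Im x - Im y.
Proof. by rewrite ImD ImN. Qed.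

Lemma ReM x y : Re (x * y) = Re x * Re y - Im x * Im y.
Proof. by case: x; case: y. Qed.

Lemma ImM x y : Im (x * y) = Re x * Im y + Im x * Re y.
Proof. by case: x => a b; case: y => c d /=; ring. Qed.

Lemma ReJ x : Re x^*%C = Re x.
Proof. by case: x. Qed.

Lemma ImJ x : Im x^*%C = - Im x.
Proof. by case: x. Qed.

Lemma conjM x y : (x * y)^*%C = x^*%C * y^*%C.
Proof. exact: rmorphM. Qed.

Lemma RCM (r s : R) : (r * s)%:C%C = r%:C%C * s%:C%C :> C.
Proof. exact: rmorphM. Qed.

Lemma ReZ (r : R) z : Re (r%:C%C * z) = r * Re z.
Proof. by rewrite ReM /= mul0r subr0. Qed.

Lemma ImZ (r : R) z : Im (r%:C%C * z) = r * Im z.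
Proof. by rewrite ImM /= mul0r addr0. Qed.

Lemma conj_sum (I : Type) (r : seq I) (P : pred I) (F : I -> C) :
  (\sum_(i <- r | P i) F i)^*%C = \sum_(i <- r | P i) (F i)^*%C.
Proof. exact: rmorph_sum. Qed.

Lemma Re_sum (I : Type) (r : seq I) (P : pred I) (F : I -> C) :
  Re (\sum_(i <- r | P i) F i) = \sum_(i <- r | P i) Re (F i).
Proof. by apply: (big_morph _ ReD). Qed.

Lemma Im_sum (I : Type) (r : seq I) (P : pred I) (F : I -> C) :
  Im (\sum_(i <- r | P i) F i) = \sum_(i <- r | P i) Im (F i).
Proof. by apply: (big_morph _ ImD). Qed.

Lemma C_eq x y : Re x = Re y -> Im x = Im y -> x = y.
Proof. by move=> a b; apply/eqP; rewrite eq_complex a b !eqxx. Qed.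

Lemma norm_Re_le x y : `|Re (x * y)| <= sqn x + sqn y.
Proof.
rewrite !sqnE; case: x => a b; case: y => c d /=; rewrite ler_norml.
have := sqr_ge0 (a - c); have := sqr_ge0 (a + c).
have := sqr_ge0 (b - d); have := sqr_ge0 (b + d).
by move=> ? ? ? ?; apply/andP; split; nra.
Qed.

Lemma norm_Im_le x y : `|Im (x * y)| <= sqn x + sqn y.
Proof.
rewrite !sqnE; case: x => a b; case: y => c d /=; rewrite ler_norml.
have := sqr_ge0 (a - d); have := sqr_ge0 (a + d).
have := sqr_ge0 (b - c); have := sqr_ge0 (b + c).
by move=> ? ? ? ?; apply/andP; split; nra.
Qed.

(** Componentwise, because cseries is the pair of the two real series. *)
Definition ccvg u (l : C) :=
  (fun n => Re (u n)) @ \oo --> Re l /\ (fun n => Im (u n)) @ \oo --> Im l.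

Lemma ccvg_unique u l l' : ccvg u l -> ccvg u l' -> l = l'.
Proof.
by move=> [a b] [a' b']; apply: C_eq;
  [exact: (cvg_unique _ a a') | exact: (cvg_unique _ b b')].
Qed.

Lemma ccvg_ext u v l : (forall n, u n = v n) -> ccvg u l -> ccvg v l.
Proof. by move=> uv; rewrite (_ : u = v)//; apply/funext. Qed.

Lemma ccvgJ u l : ccvg u l -> ccvg (fun n => (u n)^*%C) l^*%C.
Proof.
move=> [a b]; split.
  by rewrite ReJ; under eq_fun do rewrite ReJ.
by rewrite ImJ; under eq_fun do rewrite ImJ; exact: cvgN.
Qed.

Lemma ccvgMl (a : C) u l : ccvg u l -> ccvg (fun n => a * u n) (a * l).
Proof.
move=> [p q]; split.
  rewrite ReM; under eq_fun do rewrite ReM.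
  by apply: cvgB; exact: cvgMr.
rewrite ImM; under eq_fun do rewrite ImM.
by apply: cvgD; exact: cvgMr.
Qed.

Lemma ccvgBl (a : C) u l : ccvg u l -> ccvg (fun n => a - u n) (a - l).
Proof.
move=> [p q]; split.
  by rewrite ReB; under eq_fun do rewrite ReB; apply: cvgB => //; exact: cvg_cst.
by rewrite ImB; under eq_fun do rewrite ImB; apply: cvgB => //; exact: cvg_cst.
Qed.

Lemma ccvg_shift k u l : ccvg u l -> ccvg (fun n => u (n + k)%N) l.
Proof.
by move=> [p q]; split;
  rewrite (cvg_shiftn k (fun n => _ (u n))).
Qed.

Lemma norm_lt_sqr (e x : R) : 0 < e -> x ^+ 2 < e ^+ 2 -> `|x| < e.
Proof. by move=> e0 xe; rewrite ltr_norml; apply/andP; split; nra. Qed.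

Lemma ccvg_sqn u l : (fun n => sqn (u n - l)) @ \oo --> (0 : R) -> ccvg u l.
Proof.
move=> h; have g (e : R) : 0 < e -> \forall n \near \oo, sqn (u n - l) < e ^+ 2.
  move=> e0; move/cvgrPdist_lt: h => /(_ (e ^+ 2)); rewrite exprn_gt0// => /(_ isT).
  apply: filterS => n; rewrite sub0r normrN ger0_norm//; exact: sqn_ge0.
split; apply/cvgrPdist_lt => e e0; near=> n.
- rewrite distrC -ReB; apply: (norm_lt_sqr e0).
  by apply: le_lt_trans (Re_sqr_le _) _; near: n; exact: g.
- rewrite distrC -ImB; apply: (norm_lt_sqr e0).
  by apply: le_lt_trans (Im_sqr_le _) _; near: n; exact: g.
Unshelve. all: by end_near. Qed.

Lemma cvg_sqn u l : ccvg u l -> (fun n => sqn (u n)) @ \oo --> sqn l.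
Proof.
move=> [a b]; rewrite sqnE; under eq_fun do rewrite sqnE !expr2.
by rewrite !expr2; apply: cvgD; exact: cvgM.
Qed.

Lemma cseriesE u l : ccvg (fun n => \sum_(k < n) u k) l -> cseries u = l.
Proof.
move=> [a b]; rewrite /cseries; case: l a b => l m /= a b; congr Complex.
  apply/cvg_lim => //; rewrite (_ : series _ = fun n => Re (\sum_(k < n) u k))//.
  by apply/funext => n; rewrite /series /= big_mkord Re_sum.
apply/cvg_lim => //; rewrite (_ : series _ = fun n => Im (\sum_(k < n) u k))//.
by apply/funext => n; rewrite /series /= big_mkord Im_sum.
Qed.

(** Absolute convergence. The terms of the series below are products x y, for
    which norm_Re_le and norm_Im_le provide the majorant sqn x + sqn y. *)
Lemma ccvg_summable u (p : nat -> R) (M : R) :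
  (forall k, `|Re (u k)| <= p k) -> (forall k, `|Im (u k)| <= p k) ->
  (forall n, \sum_(k < n) p k <= M) ->
  exists l, ccvg (fun n => \sum_(k < n) u k) l.
Proof.
move=> up vp pM.
have p0 k : 0 <= p k by exact: le_trans (up k).
have cp : cvgn (series p).
  apply: nondecreasing_is_cvgn.
    by apply/nondecreasing_seqP => n; rewrite /series/= big_nat_recr//= lerDl.
  by exists M => _ [n _ <-]; rewrite /series /= big_mkord.
have aux (v : nat -> R) : (forall k, `|v k| <= p k) -> cvgn (series v).
  move=> vp2; apply: normed_cvg; apply: (series_le_cvg _ _ _ cp) => n; [exact: normr_ge0|exact: p0|exact: vp2].
exists (Complex (limn (series (fun k => Re (u k)))) (limn (series (fun k => Im (u k))))).
split => /=.
  rewrite (_ : (fun _ => _) = series (fun k => Re (u k))); first exact: (aux _ up).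
  by apply/funext => n; rewrite /series /= big_mkord Re_sum.
rewrite (_ : (fun _ => _) = series (fun k => Im (u k))); first exact: (aux _ vp).
by apply/funext => n; rewrite /series /= big_mkord Im_sum.
Qed.

End complex_numbers.

(** * Hilbert space theory *)

Lemma sum_ordB (V : zmodType) (g : nat -> V) m n : (m <= n)%N ->
  \sum_(k < n) g k - \sum_(k < m) g k =
  \sum_(k < n) (if (m <= k)%N then g k else 0).
Proof.
elim: n => [|n ih]; first by rewrite leqn0 => /eqP ->; rewrite !big_ord0 subrr.
rewrite leq_eqVlt ltnS => /predU1P[->|mn].
  by rewrite subrr big1// => i _; rewrite leqNgt ltn_ord.
by rewrite !big_ord_recr /= -ih// mn addrAC.
Qed.

Lemma ReJM (R : realType) (t : R) (z : R[i]) :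
  Re ((t%:C%C * z)^*%C * z) = t * sqn z.
Proof. by rewrite sqnE; case: z => a b /=; ring. Qed.

Lemma cvg_ext (R : realType) (u v : nat -> R) (l : R) : (forall n, u n = v n) ->
  u @ \oo --> l -> v @ \oo --> l.
Proof. by move=> /funext ->. Qed.

Lemma cvg_sumr (R : realType) (u : nat -> nat -> R) (l : nat -> R) K :
  (forall k, u k @ \oo --> l k) ->
  (fun n => \sum_(k < K) u k n) @ \oo --> \sum_(k < K) l k.
Proof.
move=> ul; elim: K => [|K ih].
  by rewrite big_ord0; under eq_fun do rewrite big_ord0; exact: cvg_cst.
by rewrite big_ord_recr /=; under eq_fun do rewrite big_ord_recr /=; exact: cvgD.
Qed.

Lemma cvg0_squeeze (R : realType) (u v : nat -> R) :
  (forall n, 0 <= u n <= v n) -> v @ \oo --> (0 : R) -> u @ \oo --> (0 : R).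
Proof.
move=> uv; apply: squeeze_cvgr; last exact: cvg_cst.
by near=> n; exact: uv.
Unshelve. all: by end_near. Qed.

Lemma cvg0_lin (R : realType) (a b : R) (u v : nat -> R) :
  u @ \oo --> (0 : R) -> v @ \oo --> (0 : R) ->
  (fun n => a * u n + b * v n) @ \oo --> (0 : R).
Proof.
move=> cu cv; have -> : (0 : R) = a * 0 + b * 0 by rewrite !mulr0 addr0.
by apply: cvgD; exact: cvgMr.
Qed.

Section hilbert_theory.
Context {R : realType} {d} {X : measurableType d}.
Local Notation C := R[i].
Implicit Types (F G K : X -> C) (c : nat -> C) (e : nat -> X -> C).

Definition comb c e n : X -> C := fun x => \sum_(k < n) c k * e k x.

Lemma combS c e n : comb c e n.+1 = fun x => c n * e n x + comb c e n x.
Proof. by apply/funext => x; rewrite /comb big_ord_recr /= addrC. Qed.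

Lemma comb0 c e : comb c e 0 = fun=> 0.
Proof. by apply/funext => x; rewrite /comb big_ord0. Qed.

Variables (mu : {measure set X -> \bar R}) (D : set X).
Variables (H : set (X -> C)) (ip : (X -> C) -> (X -> C) -> C).
Hypothesis HH : hilbert_space mu D H ip.

(** The squared norm. *)
Definition nrm F : R := Re (ip F F).

Lemma hilb0 : H (fun=> 0). Proof. by case: HH => -[]. Qed.

Lemma hilbL (a : C) F G : H F -> H G -> H (fun x => a * F x + G x).
Proof. by case: HH => -[_ h] *; exact: h. Qed.

Lemma ipL (a : C) F G K : H F -> H G -> H K ->
  ip (fun x => a * F x + G x) K = a * ip F K + ip G K.
Proof. by case: HH => _ h *; exact: h. Qed.

Lemma ipJ F G : H F -> H G -> ip G F = (ip F G)^*%C.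
Proof. by case: HH => _ _ h *; exact: h. Qed.

Lemma ip_nrm F : H F -> ip F F = (nrm F)%:C%C.
Proof.
move=> HF; have [ge0 _] : 0 <= ip F F /\ (ip F F = 0 <-> aeq mu D F (fun=> 0)).
  by case: HH => _ _ _ h _; exact: h.
by apply: C_eq => //=; exact: ger0_Im.
Qed.

Lemma nrm_ge0 F : H F -> 0 <= nrm F.
Proof.
move=> HF; have [+ _] : 0 <= ip F F /\ (ip F F = 0 <-> aeq mu D F (fun=> 0)).
  by case: HH => _ _ _ h _; exact: h.
by rewrite ip_nrm// ler0c.
Qed.

Lemma nrm_eq0 F : H F -> nrm F = 0 <-> aeq mu D F (fun=> 0).
Proof.
move=> HF; have [_ h] : 0 <= ip F F /\ (ip F F = 0 <-> aeq mu D F (fun=> 0)).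
  by case: HH => _ _ _ h _; exact: h.
rewrite -h ip_nrm//; split => [->//|[]//].
Qed.

Lemma hilbZ (a : C) F : H F -> H (fun x => a * F x).
Proof.
move=> HF; have := hilbL a HF hilb0.
by congr H; apply/funext => x; rewrite addr0.
Qed.

Lemma hilbB F G : H F -> H G -> H (F \- G).
Proof.
move=> HF HG; have := hilbL (-1) HG HF.
by congr H; apply/funext => x; rewrite /= mulN1r addrC.
Qed.

Lemma hilb_comb c e n : (forall k, H (e k)) -> H (comb c e n).
Proof.
by move=> He; elim: n => [|n ih]; rewrite ?comb0 ?combS; [exact: hilb0|exact: hilbL].
Qed.

Lemma ip0l K : H K -> ip (fun=> 0) K = 0.
Proof.
move=> HK; have := ipL (-1) HK HK HK.
rewrite (_ : (fun x => -1 * K x + K x) = fun=> 0) => [->|]; first by ring.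
by apply/funext => x; ring.
Qed.

Lemma ip0r K : H K -> ip K (fun=> 0) = 0.
Proof. by move=> HK; rewrite ipJ ?ip0l ?conjc0//; exact: hilb0. Qed.

Lemma ipZl (a : C) F K : H F -> H K -> ip (fun x => a * F x) K = a * ip F K.
Proof.
move=> HF HK; rewrite -[RHS]addr0 -(ip0l HK) -ipL//; last exact: hilb0.
by congr ip; apply/funext => x; rewrite addr0.
Qed.

Lemma ipR (a : C) F G K : H F -> H G -> H K ->
  ip K (fun x => a * F x + G x) = a^*%C * ip K F + ip K G.
Proof.
move=> HF HG HK; rewrite ipJ//; last exact: hilbL.
by rewrite ipL// rmorphD rmorphM /= (ipJ HK HF) (ipJ HK HG) !conjcK.
Qed.

Lemma ipZr (a : C) F K : H F -> H K -> ip K (fun x => a * F x) = a^*%C * ip K F.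
Proof.
move=> HF HK; rewrite ipJ ?ipZl//; last exact: hilbZ.
by rewrite rmorphM /= (ipJ HK HF) conjcK.
Qed.

Lemma ipBl F G K : H F -> H G -> H K -> ip (F \- G) K = ip F K - ip G K.
Proof.
move=> HF HG HK; have := ipL (-1) HG HF HK; rewrite mulN1r addrC => <-.
by congr ip; apply/funext => x /=; rewrite mulN1r addrC.
Qed.

Lemma ipBr F G K : H F -> H G -> H K -> ip K (F \- G) = ip K F - ip K G.
Proof.
move=> HF HG HK; rewrite ipJ ?ipBl//; last exact: hilbB.
by rewrite rmorphB /= (ipJ HK HF) (ipJ HK HG) !conjcK.
Qed.

Lemma ip_comb_l c e n G : (forall k, H (e k)) -> H G ->
  ip (comb c e n) G = \sum_(k < n) c k * ip (e k) G.
Proof.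
move=> He HG; elim: n => [|n ih]; first by rewrite comb0 ip0l// big_ord0.
rewrite combS ipL//; last exact: hilb_comb.
by rewrite ih big_ord_recr /= addrC.
Qed.

Lemma ip_comb_r c e n G : (forall k, H (e k)) -> H G ->
  ip G (comb c e n) = \sum_(k < n) (c k)^*%C * ip G (e k).
Proof.
move=> He HG; elim: n => [|n ih]; first by rewrite comb0 ip0r// big_ord0.
rewrite combS ipR//; last exact: hilb_comb.
by rewrite ih big_ord_recr /= addrC.
Qed.

Lemma nrmZ (a : C) F : H F -> nrm (fun x => a * F x) = sqn a * nrm F.
Proof.
move=> HF; rewrite /nrm ipZr//; last exact: hilbZ.
rewrite ipZl// mulrA [_ * a]mulrC mulJ ip_nrm//.
by rewrite /= mul0r subr0.
Qed.

Lemma nrmBE F G : H F -> H G ->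
  nrm (F \- G) = nrm F + nrm G - 2 * Re (ip F G).
Proof.
move=> HF HG; rewrite /nrm ipBl//; last exact: hilbB.
rewrite !ipBr// (ipJ HF HG) !ReB ReJ; ring.
Qed.

Lemma nrmB_le F G : H F -> H G -> nrm (F \- G) <= 2 * nrm F + 2 * nrm G.
Proof.
move=> HF HG; have HN := hilbZ (-1) HG.
have := nrm_ge0 (hilbB HF HN); rewrite !nrmBE// nrmZ// ipZr//.
by rewrite sqnN sqn1 mul1r rmorphN rmorph1 mulN1r ReN; lra.
Qed.

Lemma nrm_sym F G : H F -> H G -> nrm (F \- G) = nrm (G \- F).
Proof.
by move=> HF HG; rewrite !nrmBE// (ipJ HF HG) ReJ; ring.
Qed.

Lemma nrm_triangle F G K : H F -> H G -> H K ->
  nrm (F \- K) <= 2 * nrm (F \- G) + 2 * nrm (K \- G).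
Proof.
move=> HF HG HK; apply: le_trans (nrmB_le (hilbB HF HG) (hilbB HK HG)).
rewrite le_eqVlt; apply/orP; left; apply/eqP; congr nrm.
by apply/funext => x /=; ring.
Qed.

Lemma cauchy_schwarz F G : H F -> H G -> sqn (ip F G) <= nrm F * nrm G.
Proof.
move=> HF HG.
(* the squared norm of F - t <F, G> G *)
have key (t : R) : 0 <= nrm F + t ^+ 2 * sqn (ip F G) * nrm G - 2 * t * sqn (ip F G).
  have HZ := hilbZ (t%:C%C * ip F G) HG.
  have := nrm_ge0 (hilbB HF HZ); rewrite nrmBE// nrmZ// ipZr//.
  by rewrite sqnM sqnR ReJM -mulrA; lra.
have [G0|G0] := eqVneq (nrm G) 0.
  rewrite G0 mulr0; move: key; rewrite G0 => key.
  rewrite leNgt; apply/negP => s0.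
  have := key ((nrm F + 1) / sqn (ip F G)).
  rewrite mulr0 addr0 -mulrA divfK ?gt_eqF//.
  by have := nrm_ge0 HF; lra.
have gt0 : 0 < nrm G by rewrite lt_def G0 nrm_ge0.
rewrite -ler_pdivrMr//; have := key (nrm G)^-1.
rewrite (_ : _ ^+ 2 * _ * _ = sqn (ip F G) / nrm G); last by field.
by rewrite -mulrA [_^-1 * _]mulrC; lra.
Qed.

Lemma ip_ae0 F G : H F -> H G -> nrm F = 0 -> ip F G = 0.
Proof.
move=> HF HG F0; apply: sqn_eq0; apply/eqP; rewrite eq_le sqn_ge0 andbT.
by rewrite (le_trans (cauchy_schwarz HF HG))// F0 mul0r.
Qed.

Definition hcvg (u : nat -> X -> C) F := (fun n => nrm (F \- u n)) @ \oo --> (0 : R).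

Lemma hcvg_ip u F G : (forall n, H (u n)) -> H F -> H G -> hcvg u F ->
  ccvg (fun n => ip (u n) G) (ip F G).
Proof.
move=> Hu HF HG cF; apply: ccvg_sqn.
apply: (@squeeze_cvgr _ _ _ _ (fun=> 0) (fun n => nrm (F \- u n) * nrm G)).
- near=> n; rewrite sqn_ge0/= sqnB -ipBl//.
  by apply: cauchy_schwarz => //; exact: hilbB.
- exact: cvg_cst.
- by rewrite -(mul0r (nrm G)); apply: cvgMl.
Unshelve. all: by end_near. Qed.

Lemma hcvg_nrm u F : (forall n, H (u n)) -> H F -> hcvg u F ->
  (fun n => nrm (u n)) @ \oo --> nrm F.
Proof.
move=> Hu HF cF.
have [a _] := hcvg_ip Hu HF HF cF.
have -> : (fun n => nrm (u n)) = (fun n => nrm (F \- u n) - nrm F + 2 * Re (ip (u n) F)).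
  by apply/funext => n; rewrite nrmBE// (ipJ (Hu n) HF) ReJ; ring.
have h2 : (fun n => 2 * Re (ip (u n) F)) @ \oo --> 2 * Re (ip F F) by exact: cvgMr.
have := cvgD (cvgB cF (cvg_cst (nrm F))) h2.
rewrite (_ : 0 - nrm F + 2 * _ = nrm F); last by rewrite /nrm; ring.
by move=> h; apply: h.
Qed.

Section orthogonal_family.
Variable e : nat -> X -> C.
Hypothesis He : forall k, H (e k).
Hypothesis oe : forall i j, i != j -> ip (e i) (e j) = 0.

Lemma ip_comb_e c n k : ip (comb c e n) (e k) =
  if (k < n)%N then c k * (nrm (e k))%:C%C else 0.
Proof.
rewrite ip_comb_l//; case: ltnP => kn.
  rewrite (bigD1 (Ordinal kn)) //= ip_nrm// big1 ?addr0// => i ik.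
  by rewrite oe ?mulr0//; apply: contra_neq ik => ik; exact: val_inj.
by rewrite big1// => i _; rewrite oe ?mulr0//; rewrite neq_ltn (leq_trans _ kn).
Qed.

Lemma nrm_comb c n : nrm (comb c e n) = \sum_(k < n) sqn (c k) * nrm (e k).
Proof.
rewrite /nrm ip_comb_r//; last exact: hilb_comb.
rewrite Re_sum; apply: eq_bigr => k _.
by rewrite ip_comb_e ltn_ord mulrA [_ * c k]mulrC mulJ /= mul0r subr0.
Qed.

Lemma nrm_sub_comb c n F : H F ->
  nrm (F \- comb c e n) = nrm F +
   \sum_(k < n) (sqn (c k) * nrm (e k) - 2 * Re ((c k)^*%C * ip F (e k))).
Proof.
move=> HF; rewrite nrmBE//; last exact: hilb_comb.
rewrite nrm_comb ip_comb_r// Re_sum -addrA sumrB; congr (_ + (_ - _)).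
by rewrite mulr_sumr.
Qed.

(** Bessel's inequality for a family that need not be normalized: the free
    weights t_k are 1 for an orthonormal family, and the inverse of the squared
    norm for the scaled families met later. *)
Lemma bessel (t : nat -> R) n F : H F ->
  \sum_(k < n) sqn (ip F (e k)) * (2 * t k - t k ^+ 2 * nrm (e k)) <= nrm F.
Proof.
move=> HF.
have := nrm_ge0 (hilbB HF (hilb_comb (fun k => (t k)%:C%C * ip F (e k)) n He)).
rewrite nrm_sub_comb// => h; rewrite -subr_ge0 -sumrN; move: h.
rewrite (eq_bigr (fun k : 'I_n => - (sqn (ip F (e k)) * (2 * t k - t k ^+ 2 * nrm (e k)))))//.
by move=> k _; rewrite sqnM sqnR ReJM; ring.
Qed.

Lemma ip_hcvg_comb c F : H F -> hcvg (comb c e) F ->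
  forall k, ip F (e k) = c k * (nrm (e k))%:C%C.
Proof.
move=> HF cF k; apply: ccvg_unique (hcvg_ip _ HF (He k) cF) _.
  by move=> n; exact: hilb_comb.
have near_eq (f : C -> R) : (fun n => f (ip (comb c e n) (e k))) @ \oo -->
    f (c k * (nrm (e k))%:C%C).
  apply: cvg_near_cst; near=> n; rewrite ip_comb_e ifT//; near: n.
  exact: nbhs_infty_gt.
by split; exact: near_eq.
Unshelve. all: by end_near. Qed.

Lemma ip_hcvg c F G : H F -> H G -> hcvg (comb c e) F ->
  ccvg (fun n => \sum_(k < n) c k * ip (e k) G) (ip F G).
Proof.
move=> HF HG cF; apply: ccvg_ext (hcvg_ip _ HF HG cF); last first.
  by move=> n; exact: hilb_comb.
by move=> n; rewrite ip_comb_l.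
Qed.

Lemma combB c m n : (m <= n)%N ->
  comb c e n \- comb c e m = comb (fun k => if (m <= k)%N then c k else 0) e n.
Proof.
move=> mn; apply/funext => x /=; rewrite /comb (sum_ordB (fun k => c k * e k x))//.
by apply: eq_bigr => k _; case: ifP => // _; rewrite mul0r.
Qed.

(** The partial sums form a Cauchy sequence by the orthogonality of e. *)
Lemma riesz_fischer c (M : R) :
  (forall n, \sum_(k < n) sqn (c k) * nrm (e k) <= M) ->
  exists2 F, H F & hcvg (comb c e) F.
Proof.
move=> cM.
pose s n := \sum_(k < n) sqn (c k) * nrm (e k).
have s0 k : 0 <= sqn (c k) * nrm (e k) by rewrite mulr_ge0 ?sqn_ge0 ?nrm_ge0.
have nds : nondecreasing_seq s.
  by apply/nondecreasing_seqP => n; rewrite /s big_ord_recr /= lerDl.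
have cs : cvgn s.
  by apply: nondecreasing_is_cvgn => //; exists M => _ [n _ <-]; exact: cM.
have Hc n : H (comb c e n) by exact: hilb_comb.
have dE m n : (m <= n)%N -> nrm (comb c e n \- comb c e m) = s n - s m.
  move=> mn; rewrite combB// nrm_comb /s.
  rewrite (sum_ordB (fun k => sqn (c k) * nrm (e k)))//.
  by apply: eq_bigr => k _; case: ifP => // _; rewrite sqn0 mul0r.
have cau (eps : R) : 0 < eps -> exists N, forall n, (N <= n)%N -> limn s - s n < eps.
  move=> e0; have /cvgrPdist_lt/(_ _ e0)[N _ h] := cs.
  by exists N => n Nn; apply: le_lt_trans (h _ Nn); rewrite ler_norm.
have sl n : s n <= limn s by exact: nondecreasing_cvgn_le.
have := HH; case=> _ _ _ _ compl.
have [eps e0|F HF cF] := compl _ Hc.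
  have [N h] := cau _ e0; exists N => m n Nm Nn.
  have [mn|/ltnW nm] := leqP m n.
    rewrite -/(nrm _) nrm_sym// dE//; apply: le_lt_trans (h _ Nm).
    by rewrite lerB.
  rewrite -/(nrm _) dE//; apply: le_lt_trans (h _ Nn).
  by rewrite lerB.
exists F => //; apply/cvgrPdist_lt => eps e0.
have [N h] := cF _ e0; exists N => // n /= Nn.
rewrite sub0r normrN ger0_norm ?nrm_ge0//; last exact: hilbB.
by rewrite nrm_sym//; exact: h.
Qed.

End orthogonal_family.

Lemma lin_span_ind (S Q : set (X -> C)) : Q (fun=> 0) ->
  (forall (a : C) s G, S s -> lin_span S G -> Q G -> Q (fun x => a * s x + G x)) ->
  lin_span S `<=` Q.
Proof.
move=> Q0 QS _ [n [c [u [Su ->]]]].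
elim: n c u Su => [|n ih] c u Su.
  have -> : (fun x => \sum_(i < 0) c i * u i x) = fun=> 0; last exact: Q0.
  by apply/funext => x; rewrite big_ord0.
have -> : (fun x => \sum_(i < n.+1) c i * u i x) = (fun x => c ord0 * u ord0 x +
    \sum_(i < n) c (lift ord0 i) * u (lift ord0 i) x).
  by apply/funext => x; rewrite big_ord_recl.
have Su' i : S (u (lift ord0 i)) by exact: Su.
apply: QS; first exact: Su.
  by exists n, (fun i => c (lift ord0 i)), (fun i => u (lift ord0 i)).
exact: (ih (fun i => c (lift ord0 i)) (fun i => u (lift ord0 i)) Su').
Qed.

Lemma lin_spanH (S : set (X -> C)) : S `<=` H -> lin_span S `<=` H.
Proof.
by move=> SH; apply: lin_span_ind => [|a s G Ss _ HG]; [exact: hilb0|apply: hilbL => //; exact: SH].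
Qed.

Lemma orth_span (S : set (X -> C)) F : S `<=` H -> H F ->
  (forall s, S s -> ip F s = 0) -> forall G, lin_span S G -> ip F G = 0.
Proof.
move=> SH HF FS; apply: lin_span_ind => [|a s G Ss /(lin_spanH SH) HG FG].
  exact: ip0r.
by rewrite ipR//; [rewrite FS// FG mulr0 addr0|exact: SH].
Qed.

(** A minimizing sequence g for the distance from F to the span of S is Cauchy
    by the parallelogram law, and F minus its limit is orthogonal to S since g
    cannot be improved in any direction of S. *)
Lemma total_dense (S : set (X -> C)) : S `<=` H ->
  (forall F, H F -> (forall s, S s -> ip F s = 0) -> nrm F = 0) ->
  forall F (eps : R), H F -> 0 < eps ->
    exists2 G, lin_span S G & H G /\ nrm (F \- G) < eps.
Proof.
move=> SH tot F eps HF e0.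
have span0 : lin_span S (fun=> 0).
  exists 0%N, (fun=> 0), (fun=> fun=> 0); split; first by case.
  by apply/funext => x; rewrite big_ord0.
have spanD (a : C) G s : lin_span S G -> S s -> lin_span S (fun x => a * s x + G x).
  move=> [n [c [u [Su ->]]]] Ss.
  exists n.+1, (fun i => oapp c a (unlift ord0 i)), (fun i => oapp u s (unlift ord0 i)).
  split; first by move=> i; case: unlift => [j|] /=.
  apply/funext => x; rewrite big_ord_recl unlift_none /=; congr (_ + _).
  by apply: eq_bigr => i _; rewrite liftK.
have spanH := lin_spanH SH.
have spanh (a : C) G G' : lin_span S G -> lin_span S G' ->
    lin_span S (fun x => a * G x + G' x).
  move=> SG SG'; move: G SG; apply: lin_span_ind => [|b s G Ss _ ih].
    by rewrite (_ : (fun x => _) = G')//; apply/funext => x; rewrite mulr0 add0r.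
  have := spanD (a * b) _ _ ih Ss; congr (lin_span S).
  by apply/funext => x; rewrite mulrDr addrA mulrA.
pose A := [set nrm (F \- G) | G in lin_span S].
have A0 : A !=set0 by exists (nrm (F \- (fun=> 0))); exists (fun=> 0).
have lbA : lbound A 0 by move=> _ [G SG <-]; apply: nrm_ge0; apply: hilbB => //; exact: spanH.
have hA : has_inf A by split => //; exists 0.
have infle G : lin_span S G -> inf A <= nrm (F \- G).
  by move=> SG; apply: ge_inf; [exists 0|exists G].
have ex (n : nat) : exists G, lin_span S G /\ nrm (F \- G) < inf A + n.+1%:R^-1.
  have n0 : 0 < (n.+1%:R^-1 : R) by rewrite invr_gt0.
  have [_ [G SG <-] h] := inf_adherent n0 hA.
  by exists G.
have [g hg] := choice ex.
have Hg n : H (g n) by apply: spanH; exact: (hg n).1.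
have HFg n : H (F \- g n) by exact: hilbB.
have small (e : R) : 0 < e -> exists N, forall n, (N <= n)%N -> n.+1%:R^-1 < e :> R.
  move=> e1; have /cvgrPdist_lt/(_ _ e1)[N _ h] := @cvg_harmonic R.
  by exists N => n Nn; move: (h _ Nn); rewrite /= /harmonic sub0r normrN ger0_norm ?invr_ge0.
(* the midpoint of g m and g n is in the span, hence at distance at least inf A *)
have mid (m n : nat) : nrm (g m \- g n) <= 2 * m.+1%:R^-1 + 2 * n.+1%:R^-1.
  have Sh := spanh 2^-1 _ _ (hg m).1 (spanh 2^-1 _ _ (hg n).1 span0).
  have := infle _ Sh.
  have Hsum : H ((F \- g m) \- (fun x => - 1 * (F \- g n) x)).
    by apply: hilbB => //; apply: hilbZ.
  rewrite (_ : F \- _ = (fun x => 2^-1 * ((F \- g m) \- (fun x => - 1 * (F \- g n) x)) x)); last first.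
    by apply/funext => x /=; field.
  rewrite nrmZ// nrmBE//; last exact: hilbZ.
  rewrite (_ : g m \- g n = (F \- g n) \- (F \- g m)); last by apply/funext => x /=; ring.
  rewrite (nrmBE (HFg n) (HFg m)) nrmZ// ipZr// (ipJ (HFg m) (HFg n)).
  rewrite rmorphN rmorph1 mulN1r ReN ReJ sqnN sqn1 sqnV.
  rewrite (_ : sqn 2 = 4); last by rewrite sqnE /=; ring.
  move: (hg m).2 (hg n).2; move: (nrm (F \- g m)) (nrm (F \- g n)) (Re _) => p q r.
  by move: (inf A) (m.+1%:R^-1) (n.+1%:R^-1) => i a b; lra.
have := HH; case=> _ _ _ _ compl.
have [e1 e10|F' HF' cF'] := compl _ Hg.
  have [N h] := small (e1 / 4) (divr_gt0 e10 (ltr0n _ 4)).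
  exists N => m n Nm Nn; rewrite -/(nrm _); apply: le_lt_trans (mid m n) _.
  move: (h _ Nm) (h _ Nn); move: (m.+1%:R^-1) (n.+1%:R^-1) => a b; lra.
have FF' : nrm (F \- F') = 0.
  apply: tot; first exact: hilbB.
  move=> s Ss; have Hs := SH _ Ss.
  have cFF : hcvg (fun n => F \- g n) (F \- F').
    apply/cvgrPdist_lt => e1 e10; have [N h] := cF' _ e10.
    exists N => // n /= Nn.
    rewrite sub0r normrN ger0_norm ?nrm_ge0//; last by apply: hilbB; exact: hilbB.
    rewrite (_ : _ \- _ = g n \- F'); last by apply/funext => x /=; ring.
    exact: h.
  apply: ccvg_unique (hcvg_ip HFg (hilbB HF HF') Hs cFF) _.
  apply: ccvg_sqn; apply: (@cvg0_squeeze _ _ (fun n => (1 + nrm s) * n.+1%:R^-1)).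
    move=> n; rewrite sqn_ge0 subr0 /=.
    have := (hg n).2; move: (n.+1%:R^-1) => v h2.
    pose t := (1 + nrm s)^-1; pose a := ip (F \- g n) s.
    have t0 : 0 < 1 + nrm s by rewrite ltr_wpDr ?nrm_ge0.
    (* the step t is close to the optimal 1 / nrm s, but defined when nrm s = 0 *)
    have := infle _ (spanD (t%:C%C * a) _ _ (hg n).1 Ss).
    rewrite (_ : F \- _ = (F \- g n) \- (fun x => t%:C%C * a * s x)); last first.
      by apply/funext => x /=; ring.
    rewrite nrmBE//; last exact: hilbZ.
    rewrite nrmZ// ipZr// -/a ReJM sqnM sqnR => h1.
    have h3 : sqn a * (2 * t - t ^+ 2 * nrm s) <= v by lra.
    have h4 : t <= 2 * t - t ^+ 2 * nrm s.
      have ts : t * nrm s <= 1.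
        by rewrite /t mulrC ler_pdivrMr// mul1r; lra.
      have tp : 0 < t by rewrite invr_gt0.
      by nra.
    have h5 : sqn a * t <= v.
      by apply: le_trans h3; rewrite ler_wpM2l ?sqn_ge0.
    by rewrite -ler_pdivrMl// mulrC.
  by rewrite -(mulr0 (1 + nrm s)); apply: cvgMr; exact: cvg_harmonic.
have [N h] := cF' (eps / 2) (divr_gt0 e0 (ltr0n _ 2)).
exists (g N); first exact: (hg N).1.
split => //; apply: le_lt_trans (nrm_triangle HF HF' (Hg N)) _.
rewrite FF' mulr0 add0r -ltr_pdivlMl// mulrC.
by apply: h.
Qed.

End hilbert_theory.

(** * The Hilbert space L^2 *)

Section nonnegative_series.
Context {R : realType}.
Implicit Types u : nat -> R.

Lemma sumEFin_ord u n : (\sum_(0 <= k < n) (u k)%:E)%E = (\sum_(k < n) u k)%:E.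
Proof. by rewrite big_mkord sumEFin. Qed.

Lemma nneseries_bound u (M : R) : (forall n, \sum_(k < n) u k <= M) ->
  (forall k, 0 <= u k) -> (\sum_(0 <= k <oo) (u k)%:E <= M%:E)%E.
Proof.
move=> uM u0; apply: lime_le.
  by apply: is_cvg_nneseries => k _ _; rewrite lee_fin.
by apply: nearW => n; rewrite sumEFin_ord lee_fin.
Qed.

Lemma nneseries_ge_sum u n : (forall k, 0 <= u k) ->
  ((\sum_(k < n) u k)%:E <= \sum_(0 <= k <oo) (u k)%:E)%E.
Proof.
by move=> u0; rewrite -sumEFin_ord; apply: nneseries_lim_ge => k _ _; rewrite lee_fin.
Qed.

Lemma nneseries_lty u : (forall k, 0 <= u k) ->
  (\sum_(0 <= k <oo) (u k)%:E < +oo)%E -> exists M, forall n, \sum_(k < n) u k <= M.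
Proof.
move=> u0 h; exists (fine (\sum_(0 <= k <oo) (u k)%:E)%E) => n.
rewrite -lee_fin fineK; first exact: nneseries_ge_sum.
by rewrite ge0_fin_numE//; apply: nneseries_ge0 => k _ _; rewrite lee_fin.
Qed.

Lemma nneseries_cvg u (l : R) : (fun n => \sum_(k < n) u k) @ \oo --> l ->
  (\sum_(0 <= k <oo) (u k)%:E)%E = l%:E.
Proof.
move=> h; apply/cvg_lim => //.
rewrite (_ : (fun _ => _) = EFin \o (fun n => \sum_(k < n) u k)).
  by apply: cvg_EFin => //; exact: nearW.
by apply/funext => n; rewrite sumEFin_ord.
Qed.

Lemma cvg_nneseries u (l : R) : (forall k, 0 <= u k) ->
  (\sum_(0 <= k <oo) (u k)%:E)%E = l%:E -> (fun n => \sum_(k < n) u k) @ \oo --> l.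
Proof.
move=> u0 ul; have /fine_cvg : (fun n => (\sum_(k < n) u k)%:E) @ \oo --> l%:E.
  rewrite -ul; under eq_fun do rewrite -sumEFin_ord.
  by apply: is_cvg_nneseries => k _ _; rewrite lee_fin.
exact.
Qed.

Lemma geometric_le (r : R) n : 0 <= r -> r < 1 -> \sum_(k < n) r ^+ k <= (1 - r)^-1.
Proof.
move=> r0 r1; have r1' : 0 < 1 - r by rewrite subr_gt0.
rewrite -[leRHS]mul1r ler_pdivlMr// mulrC -opprB mulNr -subrX1 opprB.
by rewrite lerBlDr lerDl exprn_ge0.
Qed.

End nonnegative_series.

Section L2_space.
Context {R : realType} {d} {X : measurableType d}.
Local Notation C := R[i].
Variables (mu : {measure set X -> \bar R}) (D : set X).
Hypothesis mD : measurable D.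
Implicit Types (F G : X -> C).
Local Notation mC := (Defs.measurableC D).

Lemma mC_cst (a : C) : mC (fun=> a).
Proof. by split; exact: measurable_cst. Qed.

Lemma mC_lin (a : C) F G : mC F -> mC G -> mC (fun x => a * F x + G x).
Proof.
move=> [F1 F2] [G1 G2]; split.
  under eq_fun do rewrite ReD ReM.
  by apply: measurable_funD => //; apply: measurable_funB; apply: measurable_funM => //; exact: measurable_cst.
under eq_fun do rewrite ImD ImM.
by apply: measurable_funD => //; apply: measurable_funD; apply: measurable_funM => //; exact: measurable_cst.
Qed.

Lemma mC_B F G : mC F -> mC G -> mC (F \- G).
Proof.
move=> mF mG; have := mC_lin (-1) mG mF; congr (Defs.measurableC D).
by apply/funext => x /=; rewrite mulN1r addrC.
Qed.

Lemma mC_M F G : mC F -> mC G -> mC (fun x => F x * G x).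
Proof.
move=> [F1 F2] [G1 G2]; split.
  by under eq_fun do rewrite ReM; apply: measurable_funB; exact: measurable_funM.
by under eq_fun do rewrite ImM; apply: measurable_funD; exact: measurable_funM.
Qed.

Lemma mC_J F : mC F -> mC (fun x => (F x)^*%C).
Proof.
move=> [F1 F2]; split; first by under eq_fun do rewrite ReJ.
by under eq_fun do rewrite ImJ; exact: measurable_funN.
Qed.

Lemma mC_comb (c : nat -> C) e n : (forall k, mC (e k)) -> mC (comb c e n).
Proof.
by move=> me; elim: n => [|n ih]; rewrite ?comb0 ?combS; [exact: mC_cst|exact: mC_lin].
Qed.

Lemma mC_cvg (u : nat -> X -> C) F : (forall n, mC (u n)) ->
  (forall x, D x -> ccvg (fun n => u n x) (F x)) -> mC F.
Proof.
move=> mu_ uF; split.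
  apply: (@measurable_fun_cvg _ _ _ D (fun n x => Re (u n x))) => [n|x Dx].
    exact: (mu_ n).1.
  exact: (uF x Dx).1.
apply: (@measurable_fun_cvg _ _ _ D (fun n x => Im (u n x))) => [n|x Dx].
  exact: (mu_ n).2.
exact: (uF x Dx).2.
Qed.

Lemma measurable_sqn F : mC F -> measurable_fun D (fun x => sqn (F x)).
Proof.
move=> [F1 F2]; under eq_fun do rewrite sqnE.
by apply: measurable_funD; exact: measurable_funX.
Qed.

Lemma emeasurable_sqn F : mC F -> measurable_fun D (fun x => (sqn (F x))%:E).
Proof. by move=> mF; apply/measurable_EFinP; exact: measurable_sqn. Qed.

Definition integrableC F := mu.-integrable D (fun x => (Re (F x))%:E) /\
  mu.-integrable D (fun x => (Im (F x))%:E).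

Lemma integrableC_dom F (g : X -> R) : mC F ->
  mu.-integrable D (EFin \o g) ->
  (forall x, D x -> `|Re (F x)| <= g x /\ `|Im (F x)| <= g x) -> integrableC F.
Proof.
move=> [F1 F2] ig h; split; apply: (le_integrable mD _ _ ig).
- exact/measurable_EFinP.
- move=> x Dx; rewrite /= lee_fin; apply: le_trans (h x Dx).1 _; exact: ler_norm.
- exact/measurable_EFinP.
- move=> x Dx; rewrite /= lee_fin; apply: le_trans (h x Dx).2 _; exact: ler_norm.
Qed.

(** The product is dominated by sqn F + sqn G. *)
Lemma integrableC_M F G : L2 mu D F -> L2 mu D G -> integrableC (fun x => F x * G x).
Proof.
move=> [mF F2] [mG G2].
apply: (@integrableC_dom _ (fun x => sqn (F x) + sqn (G x))).
- exact: mC_M.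
- apply/integrableP; split.
    by apply/measurable_EFinP; apply: measurable_funD; exact: measurable_sqn.
  under eq_integral do rewrite gee0_abs /= ?lee_fin ?addr_ge0 ?sqn_ge0// EFinD.
  rewrite ge0_integralD//; first exact: lte_add_pinfty.
  + by move=> x _; rewrite lee_fin sqn_ge0.
  + exact: emeasurable_sqn.
  + by move=> x _; rewrite lee_fin sqn_ge0.
  + exact: emeasurable_sqn.
- by move=> x _; rewrite norm_Re_le norm_Im_le.
Qed.

Lemma L2J F : L2 mu D F -> L2 mu D (fun x => (F x)^*%C).
Proof.
move=> [mF F2]; split; first exact: mC_J.
by rewrite /L2norm2; under eq_integral do rewrite sqnJ.
Qed.

Lemma integrableC_ip F G : L2 mu D F -> L2 mu D G ->
  integrableC (fun x => F x * (G x)^*%C).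
Proof. by move=> LF LG; apply: integrableC_M => //; exact: L2J. Qed.

Lemma integrable_linear (a b c : R) f g h :
  mu.-integrable D (fun x => (f x)%:E) -> mu.-integrable D (fun x => (g x)%:E) ->
  mu.-integrable D (fun x => (h x)%:E) ->
  (\int[mu]_(x in D) (a * f x + b * g x + c * h x) =
   a * \int[mu]_(x in D) f x + b * \int[mu]_(x in D) g x + c * \int[mu]_(x in D) h x)%R.
Proof.
move=> iF iG ih.
have iZ (k : R) (v : X -> R) : mu.-integrable D (fun x => (v x)%:E) ->
    mu.-integrable D (EFin \o (fun x => k * v x)).
  by move=> iv; have := integrableZl mD k iv.
rewrite RintegralD//; last 2 first.
- by have := integrableD mD (iZ a _ iF) (iZ b _ iG).
- exact: iZ.
by rewrite RintegralD ?RintegralZl//; exact: iZ.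
Qed.

Lemma cintegralL (a : C) F G : integrableC F -> integrableC G ->
  cintegral mu D (fun x => a * F x + G x) = a * cintegral mu D F + cintegral mu D G.
Proof.
move=> [F1 F2] [G1 G2]; apply: C_eq.
  rewrite ReD ReM /=.
  under eq_Rintegral do rewrite ReD ReM -(mul1r (Re (G _))) -mulNr.
  by rewrite integrable_linear// mul1r mulNr.
rewrite ImD ImM /=.
under eq_Rintegral do rewrite ImD ImM -(mul1r (Im (G _))).
by rewrite integrable_linear// mul1r.
Qed.

Lemma cintegral0 : cintegral mu D (fun=> 0) = 0.
Proof. by apply: C_eq; rewrite /= /Rintegral integral0. Qed.

Lemma cintegralZ (a : C) F : integrableC F ->
  cintegral mu D (fun x => a * F x) = a * cintegral mu D F.
Proof.
move=> iF; have i0 : integrableC (fun=> 0) by split; exact: integrable0.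
have := cintegralL a iF i0; rewrite cintegral0 addr0 => <-.
by congr cintegral; apply/funext => x; rewrite addr0.
Qed.

(** No integrability is needed: exchanging the two parts of f negates the
    difference of their integrals even when one of them is infinite and the
    real-valued integral takes its default value 0. *)
Lemma RintegralN (f : X -> R) : (\int[mu]_(x in D) (- f x) = - \int[mu]_(x in D) f x)%R.
Proof.
rewrite /Rintegral integralE [in RHS]integralE.
rewrite (_ : ((fun x => (- f x)%:E)^\+)%E = ((fun x => (f x)%:E)^\-)%E); last first.
  by apply/funext => x; rewrite funeposE funenegE EFinN.
rewrite (_ : ((fun x => (- f x)%:E)^\-)%E = ((fun x => (f x)%:E)^\+)%E); last first.
  by apply/funext => x; rewrite funeposE funenegE EFinN oppeK.
have : (0 <= \int[mu]_(x in D) ((fun x => (f x)%:E)^\+)%E x)%E by exact: integral_ge0.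
have : (0 <= \int[mu]_(x in D) ((fun x => (f x)%:E)^\-)%E x)%E by exact: integral_ge0.
move: (\int[mu]_(x in D) _)%E (\int[mu]_(x in D) _)%E => [a| |] [b| |] //= _ _.
  by rewrite opprB.
all: by rewrite oppr0.
Qed.

Lemma cintegralJ F : cintegral mu D (fun x => (F x)^*%C) = (cintegral mu D F)^*%C.
Proof.
apply: C_eq; rewrite ?ReJ ?ImJ /=.
  by under eq_Rintegral do rewrite ReJ.
by under eq_Rintegral do rewrite ImJ; exact: RintegralN.
Qed.

Lemma cintegral_ae F G : mC F -> mC G -> aeq mu D F G ->
  cintegral mu D F = cintegral mu D G.
Proof.
move=> [F1 F2] [G1 G2] FG; apply: C_eq; rewrite /= /Rintegral; congr fine.
  apply: ae_eq_integral => //; [exact/measurable_EFinP|exact/measurable_EFinP|].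
  by apply: filterS FG => x FG Dx; rewrite FG.
apply: ae_eq_integral => //; [exact/measurable_EFinP|exact/measurable_EFinP|].
by apply: filterS FG => x FG Dx; rewrite FG.
Qed.

Lemma L2norm2_ge0 F : (0 <= L2norm2 mu D F)%E.
Proof. by apply: integral_ge0 => x _; rewrite lee_fin sqn_ge0. Qed.

Lemma L2ip_nrm F : L2ip mu D F F = (Re (L2ip mu D F F))%:C%C.
Proof.
rewrite /L2ip; apply: C_eq => //=.
under eq_Rintegral do rewrite mulJ /=.
by rewrite /Rintegral integral0.
Qed.

Lemma Re_L2ip F : Re (L2ip mu D F F) = fine (L2norm2 mu D F).
Proof.
rewrite /L2ip /= /Rintegral /L2norm2; congr fine.
by apply: eq_integral => x _; rewrite mulJ.
Qed.

Lemma L2norm2_nrm F : L2 mu D F -> L2norm2 mu D F = (nrm (L2ip mu D) F)%:E.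
Proof. by move=> [mF F2]; rewrite /nrm Re_L2ip fineK// ge0_fin_numE// L2norm2_ge0. Qed.

Lemma L2_0 : L2 mu D (fun=> 0).
Proof.
split; first exact: mC_cst.
by rewrite /L2norm2; under eq_integral do rewrite sqn0; rewrite integral0 ltry.
Qed.

Lemma L2norm2_lin (a : C) F G : mC F -> mC G ->
  (L2norm2 mu D (fun x => (a * F x + G x)%R) <=
   (2 * sqn a)%:E * L2norm2 mu D F + 2%:E * L2norm2 mu D G)%E.
Proof.
move=> mF mG; rewrite /L2norm2.
have s0 (K : X -> C) x : D x -> (0 <= (sqn (K x))%:E)%E by rewrite lee_fin sqn_ge0.
have a0 : 0 <= 2 * sqn a by rewrite mulr_ge0 ?sqn_ge0.
rewrite -!ge0_integralZl_EFin//; [|exact: s0|exact: emeasurable_sqn|exact: s0|exact: emeasurable_sqn].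
have mZ (k : R) (K : X -> C) : mC K -> measurable_fun D (fun x => (k%:E * (sqn (K x))%:E)%E).
  move=> mK; apply/measurable_EFinP; apply: measurable_funM; first exact: measurable_cst.
  exact: measurable_sqn.
rewrite -ge0_integralD//; last 4 first.
- by move=> x Dx; rewrite mule_ge0 ?lee_fin ?sqn_ge0.
- exact: mZ.
- by move=> x Dx; rewrite mule_ge0 ?lee_fin ?sqn_ge0.
- exact: mZ.
apply: ge0_le_integral => //.
- exact: s0.
- by apply: emeasurable_sqn; exact: mC_lin.
- by apply: emeasurable_funD; exact: mZ.
- by move=> x _; rewrite -!EFinM -EFinD lee_fin -mulrA -sqnM sqnD_le.
Qed.

Lemma L2_lin (a : C) F G : L2 mu D F -> L2 mu D G -> L2 mu D (fun x => a * F x + G x).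
Proof.
move=> [mF F2] [mG G2]; split; first exact: mC_lin.
apply: le_lt_trans (L2norm2_lin a mF mG) _.
by rewrite lte_add_pinfty// lte_mul_pinfty// lee_fin mulr_ge0// sqn_ge0.
Qed.

Lemma L2norm2_ae F G : mC F -> mC G -> aeq mu D F G -> L2norm2 mu D F = L2norm2 mu D G.
Proof.
move=> mF mG FG; apply: ae_eq_integral => //; [exact: emeasurable_sqn|exact: emeasurable_sqn|].
by apply: filterS FG => x FG Dx; rewrite FG.
Qed.

Lemma L2_ae F G : mC G -> aeq mu D F G -> L2 mu D F -> L2 mu D G.
Proof. by move=> mG FG [mF F2]; split => //; rewrite -(L2norm2_ae mF). Qed.

Lemma L2ip_ae F F' G : mC F -> mC F' -> mC G -> aeq mu D F F' ->
  L2ip mu D F G = L2ip mu D F' G.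
Proof.
move=> mF mF' mG FF'; apply: cintegral_ae; [by apply: mC_M => //; exact: mC_J..|].
by apply: filterS FF' => x h Dx; rewrite h.
Qed.

Lemma L2norm2_eq0 F : mC F -> L2norm2 mu D F = 0%E <-> aeq mu D F (fun=> 0).
Proof.
move=> mF; rewrite /L2norm2.
have := ae_eq_integral_abs mu mD (emeasurable_sqn mF).
under eq_integral do rewrite gee0_abs ?lee_fin ?sqn_ge0//.
move=> ->; split; apply: filterS => x h Dx.
  by apply: sqn_eq0; have := h Dx; case.
by rewrite h//= sqn0.
Qed.

Lemma fatou_L2 (u : nat -> X -> C) F (M : \bar R) : (forall n, mC (u n)) -> mC F ->
  {ae mu, forall x, D x -> ccvg (fun n => u n x) (F x)} ->
  (forall n, (L2norm2 mu D (u n) <= M)%E) -> (L2norm2 mu D F <= M)%E.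
Proof.
move=> mu_ mF uF uM.
have F0 := @fatou _ _ _ mu D mD (fun n x => (sqn (u n x))%:E)
  (fun n => emeasurable_sqn (mu_ n)) (fun n x _ => sqn_ge0 (u n x)).
apply: (@le_trans _ _ (limn_einf (fun n => \int[mu]_(x in D) (sqn (u n x))%:E)%E)).
  apply: le_trans F0; apply: ae_ge0_le_integral => //.
  - by move=> x _; rewrite lee_fin sqn_ge0.
  - exact: emeasurable_sqn.
  - move=> x _; rewrite limn_einf_lim; apply: lime_ge; first exact: is_cvg_einfs.
    by apply: nearW => n; apply: le_ereal_inf_tmp => _ [k _ <-]; rewrite lee_fin sqn_ge0.
  - apply: (emeasurable_fun_cvg (fun n x => einfs (fun k => (sqn (u k x))%:E) n)).
      by apply: measurable_fun_einfs => n; exact: emeasurable_sqn.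
    by move=> x _; rewrite limn_einf_lim; exact: is_cvg_einfs.
  - apply: filterS uF => x h Dx; have := h Dx => /cvg_sqn s.
    have /cvg_limn_einf_sup[-> _] : (fun n => (sqn (u n x))%:E) @ \oo --> (sqn (F x))%:E.
      by apply: cvg_EFin => //; exact: nearW.
    by [].
rewrite limn_einf_lim; apply: lime_le; first exact: is_cvg_einfs.
apply: nearW => n; apply: le_trans (uM n); apply: ereal_inf_lbound.
by exists n => /=.
Qed.

Lemma ae_conull (Q : X -> Prop) : {ae mu, forall x, D x -> Q x} ->
  exists2 E, conull mu D E & forall x, E x -> Q x.
Proof.
move=> [N [mN N0 QN]]; exists (D `\` N); last first.
  move=> x [Dx Nx]; apply: contrapT => nQ; apply: Nx; apply: QN => /=.
  by move=> h; exact/nQ/h.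
split; [exact: measurableD|by move=> x []|].
rewrite setDD; apply: (subset_measure0 _ mN _ N0); first exact: measurableI.
by move=> x [].
Qed.

Lemma conull_ae E (Q : X -> Prop) : conull mu D E -> (forall x, E x -> Q x) ->
  {ae mu, forall x, D x -> Q x}.
Proof.
move=> [mE ED E0] h; exists (D `\` E); split => //; first exact: measurableD.
move=> x /= nQ; split.
  by apply: contrapT => nD; apply: nQ => /nD.
by move=> Ex; apply: nQ => _; exact: h.
Qed.

(** G' is G cut off outside E: G itself is arbitrary there and need not be
    measurable. *)
Lemma conull_limit E (u : nat -> X -> C) G : conull mu D E -> (forall n, mC (u n)) ->
  (forall x, E x -> ccvg (fun n => u n x) (G x)) ->
  exists G', [/\ mC G', forall x, E x -> G' x = G x &
    {ae mu, forall x, D x -> ccvg (fun n => u n x) (G' x)}].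
Proof.
move=> nE mu_ uG; have [mE ED _] := nE.
pose i x : C := (\1_E x)%:C%C.
have mi : mC i.
  split; first exact: measurable_indic.
  exact: measurable_cst.
pose G' x := if x \in E then G x else 0.
have G'E x : E x -> G' x = G x by move=> Ex; rewrite /G' mem_set.
exists G'; split => //.
- apply: (mC_cvg (fun n => mC_M mi (mu_ n))) => x Dx.
  rewrite /G' /i indicE; case: ifPn => xE /=.
    by apply: ccvg_ext (uG x (set_mem xE)) => n; rewrite mul1r.
  have -> : (fun n : nat => 0%:C%C * u n x) = fun=> 0.
    by apply/funext => n; rewrite mul0r.
  by split; exact: cvg_cst.
- by apply: (conull_ae nE) => x Ex; rewrite G'E//; exact: uG.
Qed.

(** The classical proof. Along the subsequence n i the squared norms of the
    increments are at most 8^-i, so that the sum of the functions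
    2^i |increment|^2 is integrable, hence finite almost everywhere; since
    |x| <= 2^-i + 2^i x^2, the increments are then summable and the subsequence
    converges pointwise. Fatou's lemma turns the Cauchy condition into
    convergence to that limit. *)
Lemma L2_complete (u : nat -> X -> C) : (forall n, L2 mu D (u n)) ->
  (forall eps : R, 0 < eps -> exists N, forall m n, (N <= m)%N -> (N <= n)%N ->
     (L2norm2 mu D (u m \- u n)%R < eps%:E)%E) ->
  exists2 F, L2 mu D F & forall eps : R, 0 < eps -> exists N, forall n, (N <= n)%N ->
     (L2norm2 mu D (u n \- F)%R < eps%:E)%E.
Proof.
move=> Lu cau.
have mu_ n : mC (u n) by exact: (Lu n).1.
have e8 i : 0 < (8^-1 ^+ i : R) by rewrite exprn_gt0.
have [N hN] := choice (fun i : nat => cau (8^-1 ^+ i) (e8 i)).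
(* sums of successors, so that n is strictly increasing as well as above N *)
pose n i := (\sum_(j < i.+1) (N j).+1)%N.
have Nn i : (N i <= n i)%N by rewrite /n big_ord_recr /= (leq_trans (leqnSn _))// leq_addl.
have nS i : (n i <= n i.+1)%N by rewrite /n [leqRHS]big_ord_recr /= leq_addr.
pose v i := u (n i).
pose dv i := v i.+1 \- v i.
have mdv i : mC (dv i) by exact: mC_B (mu_ _) (mu_ _).
have dv8 i : (L2norm2 mu D (dv i) <= (8^-1 ^+ i)%:E)%E.
  by apply/ltW/hN => //; exact: leq_trans (Nn i) (nS i).
pose p i x : R := 2 ^+ i * sqn (dv i x).
have p0 i x : 0 <= p i x by rewrite mulr_ge0 ?sqn_ge0 ?exprn_ge0.
have mp i : measurable_fun D (fun x => (p i x)%:E).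
  apply/measurable_EFinP; apply: measurable_funM; first exact: measurable_cst.
  exact: measurable_sqn.
have ip i : (\int[mu]_(x in D) (p i x)%:E <= (4^-1 ^+ i)%:E)%E.
  rewrite /p; under eq_integral do rewrite EFinM.
  rewrite ge0_integralZl_EFin ?exprn_ge0//; last 2 first.
  - by move=> x _; rewrite lee_fin sqn_ge0.
  - exact: emeasurable_sqn.
  apply: (@le_trans _ _ ((2 ^+ i)%:E * (8^-1 ^+ i)%:E)%E).
    by apply: lee_wpmul2l; [rewrite lee_fin exprn_ge0|exact: dv8].
  by rewrite -EFinM lee_fin -exprMn (_ : 2 * 8^-1 = 4^-1 :> R)//; field.
pose g x := (\sum_(0 <= i <oo) (p i x)%:E)%E.
have mg : measurable_fun D g.
  by apply: ge0_emeasurable_sum => // i x _ _; rewrite lee_fin.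
have g0 x : (0 <= g x)%E by apply: nneseries_ge0 => i _ _; rewrite lee_fin.
have ig : mu.-integrable D g.
  apply/integrableP; split => //.
  under eq_integral do rewrite gee0_abs//.
  rewrite integral_nneseries//; last by move=> i x _; rewrite lee_fin.
  apply: (@le_lt_trans _ _ (\sum_(0 <= i <oo) (4^-1 ^+ i : R)%:E)%E).
    by apply: lee_nneseries => i _ // _; apply: integral_ge0 => x _; rewrite lee_fin.
  apply: le_lt_trans (@nneseries_bound _ _ 2 _ _) _; last exact: ltry.
  + move=> k; apply: le_trans (geometric_le k _ _) _; rewrite ?invr_ge0//; last first.
      by rewrite -[leRHS]invrK lef_pV2 ?posrE; lra.
    by rewrite invf_lt1//; lra.
  + by move=> k; rewrite exprn_ge0.
have [E nE gE] := ae_conull (integrable_ae mD ig).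
have lim x : E x -> exists l, ccvg (fun i => v i x) l.
  move=> Ex; have gf := gE x Ex.
  have [M hM] : exists M, forall k, \sum_(i < k) p i x <= M.
    apply: (nneseries_lty (fun i => p0 i x)).
    by rewrite -ge0_fin_numE; [exact: gf|exact: g0].
  pose q i : R := 2^-1 ^+ i + p i x.
  have sq (z : C) (r : R) i : r ^+ 2 <= sqn z -> `|r| <= 2^-1 ^+ i + 2 ^+ i * sqn z.
    move=> rz; have a0 : 0 < (2 : R) ^+ i by rewrite exprn_gt0.
    rewrite exprVn; move: (2 ^+ i) a0 => a a0; apply: (@le_trans _ _ (a^-1 + a * r ^+ 2)).
      have : 0 <= a^-1 * (a * `|r| - 1) ^+ 2 by rewrite mulr_ge0 ?sqr_ge0 ?invr_ge0 ?ltW.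
      rewrite -[r ^+ 2]real_normK ?num_real//; move: (normr_ge0 r); move: `|r| => s s0.
      rewrite (_ : a^-1 * _ = a * s ^+ 2 - 2 * s + a^-1); last by field; rewrite gt_eqF.
      by lra.
    by rewrite lerD2l ler_pM2l.
  have sumq k : \sum_(i < k) q i <= 2 + M.
    rewrite big_split /=; apply: lerD; last exact: hM.
    apply: le_trans (geometric_le k _ _) _; rewrite ?invr_ge0//; last first.
      by rewrite -[leRHS]invrK lef_pV2 ?posrE; lra.
    by rewrite invf_lt1//; lra.
  have [l hl] := @ccvg_summable R (fun i => dv i x) q (2 + M)
    (fun i => sq _ _ i (Re_sqr_le _)) (fun i => sq _ _ i (Im_sqr_le _)) sumq.
  exists (v 0%N x + l); have tel k : \sum_(i < k) dv i x = v k x - v 0%N x.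
    elim: k => [|k ih]; first by rewrite big_ord0 subrr.
    by rewrite big_ord_recr /= ih /dv /=; ring.
  case: hl => a b; split.
    rewrite ReD (_ : (fun _ => _) = fun k => Re (v 0%N x) + Re (\sum_(i < k) dv i x)).
      by apply: cvgD => //; exact: cvg_cst.
    by apply/funext => k; rewrite tel ReB; ring.
  rewrite ImD (_ : (fun _ => _) = fun k => Im (v 0%N x) + Im (\sum_(i < k) dv i x)).
    by apply: cvgD => //; exact: cvg_cst.
  by apply/funext => k; rewrite tel ImB; ring.
have [G hG] : exists G, forall x, E x -> ccvg (fun i => v i x) (G x).
  have : forall x, exists l, E x -> ccvg (fun i => v i x) l.
    move=> x; have [Ex|nE'] := pselect (E x); last by exists 0.
    by have [l hl] := lim x Ex; exists l.
  by move=> /choice[G hG]; exists G.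
have [F [mF _ aF]] := conull_limit nE (fun i => mu_ (n i)) hG.
have ngt i : (i <= n i)%N.
  elim: i => // i ih; rewrite /n big_ord_recr /= -/(n i).
  by rewrite -addn1 leq_add.
have key (eps : R) : 0 < eps -> exists K, forall k, (K <= k)%N ->
    (L2norm2 mu D (u k \- F)%R < eps%:E)%E.
  move=> e0; have e2 : 0 < eps / 2 by rewrite divr_gt0.
  have [K hK] := cau _ e2.
  exists K => k Kk; apply: (@le_lt_trans _ _ (eps / 2)%:E); last first.
    by rewrite lte_fin; lra.
  apply: (@fatou_L2 (fun j => u k \- v (j + K)%N)).
  - by move=> j; exact: mC_B (mu_ _) (mu_ _).
  - exact: mC_B (mu_ _) mF.
  - by apply: filterS aF => x h Dx; apply: ccvgBl; apply: (@ccvg_shift _ K (v^~ x)); exact: h.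
  - move=> j; apply/ltW/hK => //; apply: leq_trans (ngt _); exact: leq_addl.
exists F => //.
have [K hK] := key 1 ltr01.
have LK : L2 mu D (u K \- F).
  by split; [exact: mC_B (mu_ _) mF|apply: lt_trans (hK _ (leqnn K)) (ltry _)].
have := L2_lin (-1) LK (Lu K); congr (L2 mu D).
by apply/funext => x /=; ring.
Qed.

Lemma hilbert_L2 : hilbert_space mu D (L2 mu D) (L2ip mu D).
Proof.
split.
- by split; [exact: L2_0|exact: L2_lin].
- move=> a F G K LF LG LK; rewrite /L2ip -cintegralL; [|exact: integrableC_ip..].
  by congr cintegral; apply/funext => x; ring.
- move=> F G LF LG; rewrite /L2ip -cintegralJ; congr cintegral.
  by apply/funext => x; rewrite rmorphM /= conjcK mulrC.
- move=> F LF; rewrite L2ip_nrm -/(nrm (L2ip mu D) F); split.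
    by rewrite ler0c /nrm Re_L2ip fine_ge0// L2norm2_ge0.
  rewrite -L2norm2_eq0; last exact: LF.1.
  by rewrite L2norm2_nrm//; split => [[->]//|[->]].
- move=> u Lu cau; have Hsub F G : L2 mu D F -> L2 mu D G -> L2 mu D (F \- G).
    move=> LF LG; have := L2_lin (-1) LG LF; congr (L2 mu D).
    by apply/funext => x /=; ring.
  have [eps e0|F LF h] := L2_complete Lu.
    have [N h] := cau _ e0; exists N => m n Nm Nn.
    by rewrite L2norm2_nrm ?lte_fin; [exact: h|exact: Hsub].
  exists F => // eps e0; have [N hN] := h _ e0; exists N => n Nn.
  by rewrite -lte_fin; rewrite -[X in X%:E]/(nrm _ _) -L2norm2_nrm; [exact: hN|exact: Hsub].
Qed.

(** Fatou's lemma applied to F - u n, whose norms tend to zero. *)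
Lemma hcvg_pointwise E (u : nat -> X -> C) F G : conull mu D E ->
  (forall n, L2 mu D (u n)) -> L2 mu D F -> hcvg (L2ip mu D) u F ->
  (forall x, E x -> ccvg (fun n => u n x) (G x)) -> aeq mu D F G.
Proof.
move=> nE Lu LF cF uG.
have [G' [mG' G'E aG]] := conull_limit nE (fun n => (Lu n).1) uG.
suff FG' : aeq mu D F G'.
  have GG' : {ae mu, forall x, D x -> G' x = G x} by apply: (conull_ae nE).
  by apply: filterS2 FG' GG' => x h1 h2 Dx; rewrite h1// h2.
have mFG : mC (F \- G') by apply: mC_B => //; exact: LF.1.
have Hsub F1 G1 : L2 mu D F1 -> L2 mu D G1 -> L2 mu D (F1 \- G1).
  exact: (hilbB hilbert_L2).
suff /L2norm2_eq0 : L2norm2 mu D (F \- G') = 0%E.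
  move=> /(_ mFG); apply: filterS => x h Dx; have := h Dx => /= /eqP.
  by rewrite subr_eq0 => /eqP.
apply/eqP; rewrite eq_le L2norm2_ge0 andbT; apply/lee_addgt0Pr => e e0.
rewrite add0e; move/cvgrPdist_lt: cF => /(_ _ e0)[N _ hN].
apply: (@fatou_L2 (fun j => F \- u (j + N)%N)) => //.
- by move=> n; exact: (Hsub _ _ LF (Lu _)).1.
- by apply: filterS aG => x h Dx; apply: ccvgBl; apply: (@ccvg_shift _ N (u^~ x)); exact: h.
- move=> n; rewrite L2norm2_nrm; last exact: Hsub.
  rewrite lee_fin; have := hN _ (leq_addl n N); rewrite /= sub0r normrN => /ltW.
  by apply: le_trans; exact: ler_norm.
Qed.

End L2_space.

(** * The Karhunen-Loeve basis and the spaces H_C *)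

Section ccvg_extra.
Context {R : realType}.
Local Notation C := R[i].

Lemma ccvgD (u v : nat -> C) l m : ccvg u l -> ccvg v m -> ccvg (fun n => u n + v n) (l + m).
Proof.
move=> [a b] [c d]; split.
  by rewrite ReD; under eq_fun do rewrite ReD; exact: cvgD.
by rewrite ImD; under eq_fun do rewrite ImD; exact: cvgD.
Qed.

Lemma ccvg_real (u : nat -> R) (l : R) : u @ \oo --> l -> ccvg (fun n => (u n)%:C%C) l%:C%C.
Proof. by move=> h; split => //=; exact: cvg_cst. Qed.

Lemma sum_le_lim (u : nat -> R) (l : R) n : (forall k, 0 <= u k) ->
  (fun n => \sum_(k < n) u k) @ \oo --> l -> \sum_(k < n) u k <= l.
Proof.
move=> u0 h; have nd : nondecreasing_seq (fun n => \sum_(k < n) u k).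
  by apply/nondecreasing_seqP => m; rewrite big_ord_recr /= lerDl.
by rewrite -(cvg_lim _ h)//; apply: nondecreasing_cvgn_le => //; apply/cvg_ex; exists l.
Qed.

Lemma lim_le_bound (u : nat -> R) (l M : R) : (forall n, u n <= M) -> u @ \oo --> l -> l <= M.
Proof.
move=> uM h; rewrite -(cvg_lim _ h)//; apply: limr_le; first by apply/cvg_ex; exists l.
exact: nearW.
Qed.

End ccvg_extra.

Section rkhs.
Context {R : realType} {d} {X : measurableType d}.
Local Notation C := R[i].
Variables (mu : {measure set X -> \bar R}) (D : set X).

(** An element orthogonal to every kernel section vanishes almost everywhere by
    the reproducing property, so the sections span a dense subspace. *)
Lemma rkhs_dense E (H : set (X -> C)) (ip : (X -> C) -> (X -> C) -> C) K F (eps : R) :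
  measurable D -> conull mu D E -> rkhs_on mu D E H ip K -> H F -> 0 < eps ->
  exists2 G, lin_span [set K ^~ s | s in E] G & H G /\ nrm ip (F \- G) < eps.
Proof.
move=> mD nE [HH HK rep _] HF e0; apply: (total_dense HH) => //.
  by move=> _ [s Es <-]; exact: HK.
move=> G HG oG; apply/(nrm_eq0 HH HG).
have o0 : {ae mu, forall s, D s -> ip G (K ^~ s) = 0}.
  by apply: (conull_ae mD nE) => s Es; apply: oG; exists s.
by apply: filterS2 (rep G HG) o0 => s h1 h2 Ds; rewrite h1// h2.
Qed.

End rkhs.

Section KL.
Context {R : realType} {d} {X : measurableType d}.
Local Notation C := R[i].
Variables (mu : {measure set X -> \bar R}) (D : set X).
Hypothesis mD : measurable D.
Context {J : countType}.
Variables (lam : nat -> R) (phi : nat + J -> X -> C).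
Hypothesis phi_onb : orthonormal_basis mu D phi.
Hypothesis lam_ge0 : forall k, 0 <= lam k.
Hypothesis lam_dec : forall k, lam k.+1 <= lam k.
Implicit Types F G : X -> C.

Local Notation ip := (L2ip mu D).
Local Notation e := (fun k : nat => phi (inl k)).
Local Notation coef F k := (ip F (phi (inl (k : nat)))).
Local Notation coefs F := (fun k : nat => ip F (phi (inl k))).
Let HH := hilbert_L2 mu mD.

(** The condition that mod_null imposes. *)
Definition null_orth F := forall i, eigval lam i = 0 -> ip F (phi i) = 0.

Let Lphi i : L2 mu D (phi i). Proof. by case: phi_onb. Qed.

Lemma phi_orth i j : i != j -> ip (phi i) (phi j) = 0.
Proof. by case: phi_onb => _ h _ ij; rewrite h (negbTE ij). Qed.

Lemma nrm_phi i : nrm ip (phi i) = 1.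
Proof. by rewrite /nrm; case: phi_onb => _ h _; rewrite h eqxx. Qed.

Let oe (i j : nat) : i != j -> ip (e i) (e j) = 0.
Proof. by move=> ij; apply: phi_orth. Qed.

Let Le (k : nat) : L2 mu D (e k). Proof. exact: Lphi. Qed.

(** For G in the span, the squared distance from F to G is nrm F + nrm G, so F
    is in the closure of the span only if nrm F = 0. *)
Lemma basis_total F : L2 mu D F -> (forall i, ip F (phi i) = 0) -> nrm ip F = 0.
Proof.
move=> LF F0; have [_ _ clo] := phi_onb.
have SL : range phi `<=` L2 mu D by move=> _ [i _ <-]; exact: Lphi.
have n0 := nrm_ge0 HH LF.
apply/eqP; rewrite eq_le n0 andbT leNgt; apply/negP => n1.
have : closure_in (L2 mu D) (L2norm2 mu D) (lin_span (range phi)) F by rewrite clo.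
move=> [_ /(_ _ n1) [G SG]].
have LG := lin_spanH HH SL SG.
rewrite L2norm2_nrm//; last exact: hilbB HH _ _ LF LG.
rewrite lte_fin (nrmBE HH)// (orth_span HH SL LF _ SG) /=; last by move=> _ [i _ <-].
by have := nrm_ge0 HH LG; lra.
Qed.

(** The functions phi (inr j) are orthogonal to all partial sums, hence to their
    limit. *)
Lemma synthesis (c : nat -> C) (M : R) : (forall n, \sum_(k < n) sqn (c k) <= M) -> exists G,
  [/\ L2 mu D G, hcvg ip (comb c e) G, forall k : nat, coef G k = c k &
      forall j : J, ip G (phi (inr j)) = 0].
Proof.
move=> cM; have [n|G LG cG] := riesz_fischer HH Le oe (c := c) (M := M).
  by under eq_bigr do rewrite nrm_phi mulr1.
exists G; split => // [k|j]; first by rewrite (ip_hcvg_comb HH Le oe LG cG) nrm_phi mulr1.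
apply: (ccvg_unique (ip_hcvg HH Le LG (Lphi (inr j)) cG)).
rewrite (_ : (fun n => _) = fun=> 0); first by split; exact: cvg_cst.
by apply/funext => n; apply: big1 => k _; rewrite phi_orth ?mulr0.
Qed.

Lemma bessel_phi F n : L2 mu D F -> \sum_(k < n) sqn (coef F k) <= nrm ip F.
Proof.
move=> LF; have := bessel HH Le oe (fun=> 1) n LF.
apply: le_trans; apply: ler_sum => k _; rewrite nrm_phi.
by rewrite (_ : 2 * 1 - 1 ^+ 2 * 1 = 1) ?mulr1//; ring.
Qed.

Lemma expansion F : L2 mu D F -> (forall j : J, ip F (phi (inr j)) = 0) ->
  hcvg ip (comb (coefs F) e) F.
Proof.
move=> LF FJ.
have Lc n : L2 mu D (comb (coefs F) e n) by exact: hilb_comb HH _ _ _ Le.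
have [G [LG cG Gk Gj]] := @synthesis (coefs F) _ (fun n => bessel_phi n LF).
have FG : nrm ip (F \- G) = 0.
  apply: basis_total => [|[k|j]]; first exact: hilbB HH _ _ LF LG.
    by rewrite (ipBl HH)// Gk subrr.
  by rewrite (ipBl HH)// FJ Gj subrr.
apply: cvg0_squeeze (cvg0_lin 2 2 cG (cvg_cst 0)) => n.
rewrite (nrm_ge0 HH (hilbB HH LF (Lc n))).
rewrite (le_trans (nrm_triangle HH LF LG (Lc n)))// FG.
by rewrite (nrm_sym HH (Lc n) LG) mulr0 add0r addr0.
Qed.

Lemma parseval F : L2 mu D F -> (forall j : J, ip F (phi (inr j)) = 0) ->
  (fun n => \sum_(k < n) sqn (coef F k)) @ \oo --> nrm ip F.
Proof.
move=> LF FJ; have := hcvg_nrm HH (fun n => hilb_comb HH _ n (fun k => Lphi (inl k))) LF (expansion LF FJ).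
apply: cvg_ext => n.
rewrite (nrm_comb HH (fun k => Lphi (inl k)) oe); apply: eq_bigr => k _.
by rewrite nrm_phi mulr1.
Qed.

Lemma null_orthJ F : null_orth F -> forall j : J, ip F (phi (inr j)) = 0.
Proof. by move=> h j; exact: h. Qed.

Lemma null_orth_eq0 F : L2 mu D F -> null_orth F -> (forall k, 0 < lam k -> coef F k = 0) ->
  nrm ip F = 0.
Proof.
move=> LF oF h; apply: basis_total => // -[k|j]; last exact: oF.
have [k0|k0] := eqVneq (lam k) 0; first exact: oF.
by apply: h; rewrite lt_def k0 lam_ge0.
Qed.

Lemma lam_le0 k : lam k <= lam 0%N.
Proof. by elim: k => // k ih; exact: le_trans (lam_dec k) ih. Qed.

Lemma lam_le m n : (m <= n)%N -> lam n <= lam m.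
Proof.
move=> /subnK <-; elim: (n - m)%N => // k ih; rewrite addSn.
exact: le_trans (lam_dec _) ih.
Qed.

Section weighted.
Variable j : nat.

(** The weights of the squared norm of H_{C_j}. *)
Definition wt k : R := alpha lam k / lam k ^+ j.+1.

Lemma wt_ge0 k : 0 <= wt k.
Proof. by rewrite /wt /alpha; case: ifP => _; rewrite ?mul0r// mul1r invr_ge0 exprn_ge0. Qed.

Lemma wtM k : wt k * lam k ^+ j.+1 = alpha lam k.
Proof.
rewrite /wt /alpha; case: ifPn => [k0|_]; last by rewrite !mul0r.
by rewrite mul1r mulVf// expf_neq0// gt_eqF.
Qed.

Lemma alphaM F k : null_orth F -> (alpha lam k)%:C%C * coef F k = coef F k.
Proof.
move=> oF; rewrite /alpha; case: ifPn => [k0|]; first by rewrite mul1r.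
by rewrite -leNgt => k0; rewrite oF ?mulr0//=; apply/eqP; rewrite eq_le k0 lam_ge0.
Qed.

Lemma HCnorm2E F : HCnorm2 mu D lam phi j F =
  (\sum_(0 <= k <oo) (wt k * sqn (coef F k))%:E)%E.
Proof.
rewrite /HCnorm2; apply: eq_eseriesr => k _; congr EFin.
by rewrite /wt mulrA mulrAC.
Qed.

Let term0 F k : 0 <= wt k * sqn (coef F k).
Proof. by rewrite mulr_ge0 ?wt_ge0 ?sqn_ge0. Qed.

Local Notation HC := (HC mu D lam phi j).
Local Notation HCip := (HCip mu D lam phi j).

Lemma HCP F : HC F <-> [/\ L2 mu D F, null_orth F &
  exists M, forall n, \sum_(k < n) wt k * sqn (coef F k) <= M].
Proof.
split.
  move=> [[LF h] oF]; split => //; rewrite HCnorm2E in h.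
  exact: nneseries_lty h.
move=> [LF oF [M hM]]; split => //; split => //; rewrite HCnorm2E.
exact: le_lt_trans (nneseries_bound hM (term0 F)) (ltry _).
Qed.

Lemma HCip_cvg F G : HC F -> HC G ->
  ccvg (fun n => \sum_(k < n) (wt k)%:C%C * (coef F k * (coef G k)^*%C)) (HCip F G).
Proof.
move=> /HCP[_ _ [M hM]] /HCP[_ _ [N hN]].
have [] := @ccvg_summable R (fun k => (wt k)%:C%C * (coef F k * (coef G k)^*%C))
  (fun k => wt k * sqn (coef F k) + wt k * sqn (coef G k)) (M + N).
- move=> k; rewrite ReZ normrM ger0_norm ?wt_ge0// -mulrDr.
  by apply: ler_wpM2l; [exact: wt_ge0|rewrite -[sqn (coef G k)]sqnJ norm_Re_le].
- move=> k; rewrite ImZ normrM ger0_norm ?wt_ge0// -mulrDr.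
  by apply: ler_wpM2l; [exact: wt_ge0|rewrite -[sqn (coef G k)]sqnJ norm_Im_le].
- by move=> n; rewrite big_split lerD.
by move=> l hl; rewrite /Defs.HCip (cseriesE hl).
Qed.

Lemma HC_cvg F : HC F ->
  (fun n => \sum_(k < n) wt k * sqn (coef F k)) @ \oo --> nrm HCip F.
Proof.
move=> HF; have [a _] := HCip_cvg HF HF; move: a; rewrite /nrm.
apply: cvg_ext => n.
by rewrite Re_sum; apply: eq_bigr => k _; rewrite mulJ /= mul0r subr0.
Qed.

Lemma HCnorm2_nrm F : HC F -> HCnorm2 mu D lam phi j F = (nrm HCip F)%:E.
Proof. by move=> HF; rewrite HCnorm2E; apply: nneseries_cvg; exact: HC_cvg. Qed.

Lemma HCip_nrm F : HC F -> HCip F F = (nrm HCip F)%:C%C.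
Proof.
move=> HF; apply: (ccvg_unique (HCip_cvg HF HF)).
apply: ccvg_ext (ccvg_real (HC_cvg HF)) => n.
rewrite rmorph_sum /=; apply: eq_bigr => k _.
by rewrite mulJ rmorphM.
Qed.

Lemma HC_term_le F k : HC F -> wt k * sqn (coef F k) <= nrm HCip F.
Proof.
move=> HF; apply: le_trans (sum_le_lim k.+1 (term0 F) (HC_cvg HF)).
by rewrite big_ord_recr /= lerDr sumr_ge0.
Qed.

Lemma null_orth_lin (a : C) F G : L2 mu D F -> L2 mu D G -> null_orth F -> null_orth G ->
  null_orth (fun x => a * F x + G x).
Proof.
by move=> LF LG oF oG i i0; rewrite (ipL HH)// oF// oG// mulr0 addr0.
Qed.

Lemma coef_lin (a : C) F G k : L2 mu D F -> L2 mu D G ->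
  coef (fun x => a * F x + G x) k = a * coef F k + coef G k.
Proof. by move=> LF LG; rewrite (ipL HH). Qed.

Lemma HC_lin (a : C) F G : HC F -> HC G -> HC (fun x => a * F x + G x).
Proof.
move=> /HCP[LF oF [M hM]] /HCP[LG oG [N hN]]; apply/HCP; split.
- exact: hilbL HH _ _ _ LF LG.
- exact: null_orth_lin.
- exists (2 * sqn a * M + 2 * N) => n.
  apply: (@le_trans _ _ (\sum_(k < n) (2 * sqn a * (wt k * sqn (coef F k)) + 2 * (wt k * sqn (coef G k))))).
    apply: ler_sum => k _; rewrite coef_lin//.
    have := sqnD_le (a * coef F k) (coef G k); rewrite sqnM => h.
    have := ler_wpM2l (wt_ge0 k) h.
    by rewrite (_ : wt k * (_ + _) = 2 * sqn a * (wt k * sqn (coef F k)) + 2 * (wt k * sqn (coef G k)))//; ring.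
  rewrite big_split /= -!mulr_sumr; apply: lerD; apply: ler_wpM2l => //; [|exact: hM|exact: hN].
  by rewrite mulr_ge0 ?sqn_ge0.
Qed.

Lemma nrm_le_HC F : HC F -> nrm ip F <= lam 0%N ^+ j.+1 * nrm HCip F.
Proof.
move=> HF; have /HCP[LF oF _] := HF.
apply: lim_le_bound (parseval LF (null_orthJ oF)) => n.
have l0 : 0 <= lam 0%N ^+ j.+1 by rewrite exprn_ge0.
apply: le_trans (ler_wpM2l l0 (sum_le_lim n (term0 F) (HC_cvg HF))).
rewrite mulr_sumr; apply: ler_sum => k _.
have [k0|k0] := eqVneq (lam k) 0.
  by rewrite oF// sqn0 !mulr0.
have kp : 0 < lam k by rewrite lt_def k0 lam_ge0.
rewrite mulrA -[leLHS]mul1r ler_wpM2r ?sqn_ge0//.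
rewrite /wt /alpha kp mul1r ler_pdivlMr ?exprn_gt0// mul1r.
by rewrite lerXn2r ?nnegrE ?lam_le0.
Qed.

Lemma HC_L2 F : HC F -> L2 mu D F. Proof. by case=> -[]. Qed.

Lemma HC_null F : HC F -> null_orth F. Proof. by case. Qed.

Lemma HC_0 : HC (fun=> 0).
Proof.
apply/HCP; split; first exact: L2_0.
  by move=> i _; rewrite (ip0l HH).
by exists 0 => n; rewrite big1// => k _; rewrite (ip0l HH)// sqn0 mulr0.
Qed.

Lemma HC_B F G : HC F -> HC G -> HC (F \- G).
Proof.
move=> HF HG; have := HC_lin (-1) HG HF; congr (Defs.HC _ _ _ _ _).
by apply/funext => x /=; ring.
Qed.

(** Completeness of H_{C_j} comes from that of L^2: a Cauchy sequence of H_{C_j}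
    converges in L^2, so its coefficients converge, and the partial sums of the
    weighted norm pass to the limit. *)
Lemma hilbert_HC : hilbert_space mu D HC HCip.
Proof.
split.
- by split; [exact: HC_0|exact: HC_lin].
- move=> a F G K HF HG HK.
  apply: (ccvg_unique (HCip_cvg (HC_lin a HF HG) HK)).
  apply: ccvg_ext (ccvgD (ccvgMl a (HCip_cvg HF HK)) (HCip_cvg HG HK)) => n.
  rewrite mulr_sumr -big_split; apply: eq_bigr => k _ /=.
  by rewrite coef_lin//; [ring|exact: HC_L2|exact: HC_L2].
- move=> F G HF HG; apply: (ccvg_unique (HCip_cvg HG HF)).
  apply: ccvg_ext (ccvgJ (HCip_cvg HF HG)) => n.
  rewrite conj_sum; apply: eq_bigr => k _.
  by rewrite !conjM conjc_real conjcK; congr (_ * _); exact: mulrC.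
- move=> F HF; rewrite HCip_nrm//; split.
    rewrite ler0c; apply: le_trans (HC_term_le 0 HF); exact: term0.
  have LF := HC_L2 HF.
  rewrite -(nrm_eq0 HH)//; split => [[F0]|F0].
    apply: null_orth_eq0 => //; first exact: HC_null.
    move=> k k0; apply: sqn_eq0; apply/eqP; rewrite eq_le sqn_ge0 andbT.
    have := HC_term_le k HF; rewrite F0.
    by rewrite pmulr_rle0// /wt /alpha k0 mul1r invr_gt0 exprn_gt0.
  congr real_complex_def; apply: (cvg_unique _ (HC_cvg HF)) => //.
  rewrite (_ : (fun n => _) = fun=> 0); first exact: cvg_cst.
  apply/funext => n; apply: big1 => k _.
  by rewrite (ip_ae0 HH LF (Lphi _) F0) sqn0 mulr0.
- move=> u Hu cau; have Lu n := HC_L2 (Hu n).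
  have := HH; case=> _ _ _ _ compl.
  have l0 : 0 <= lam 0%N ^+ j.+1 by rewrite exprn_ge0.
  have [eps e0|F LF cF] := compl _ Lu.
    have e1 : 0 < eps / (1 + lam 0%N ^+ j.+1) by rewrite divr_gt0// ltr_wpDr.
    have [N hN] := cau _ e1; exists N => m n Nm Nn.
    have := hN m n Nm Nn; rewrite ltr_pdivlMr; last by rewrite ltr_wpDr.
    apply: le_lt_trans; apply: le_trans (nrm_le_HC (HC_B (Hu m) (Hu n))) _.
    rewrite mulrC ler_wpM2l//; last by rewrite lerDr.
    by apply: le_trans (HC_term_le 0 (HC_B (Hu m) (Hu n))); exact: term0.
  have hF : hcvg ip u F.
    apply/cvgrPdist_lt => eps e0; have [N h] := cF _ e0.
    exists N => // n /= Nn; rewrite sub0r normrN ger0_norm; last exact: (nrm_ge0 HH (hilbB HH LF (Lu _))).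
    by rewrite (nrm_sym HH LF (Lu n)); exact: h.
  have cip i : ccvg (fun n => ip (u n) (phi i)) (ip F (phi i)) by exact: (hcvg_ip HH Lu LF).
  have oF : null_orth F.
    move=> i i0; apply: (ccvg_unique (cip i)).
    rewrite (_ : (fun n => _) = fun=> 0); first by split; exact: cvg_cst.
    by apply/funext => n; rewrite (HC_null (Hu n)).
  have key (eps : R) : 0 < eps -> exists N, forall n, (N <= n)%N ->
      forall K, \sum_(k < K) wt k * sqn (coef (u n \- F) k) <= eps.
    move=> e0; have [N hN] := cau _ e0; exists N => n Nn K.
    have c : (fun m => \sum_(k < K) wt k * sqn (coef (u n) k - coef (u (m + N)%N) k)) @ \oo -->
        \sum_(k < K) wt k * sqn (coef (u n \- F) k).
      apply: (@cvg_sumr _ (fun k m => wt k * sqn (coef (u n) k - coef (u (m + N)%N) k))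
        (fun k => wt k * sqn (coef (u n \- F) k))) => k; apply: cvgMr; rewrite (ipBl HH)//.
      by apply: cvg_sqn; apply: ccvgBl; apply: (@ccvg_shift _ N (fun m => coef (u m) k)).
    apply: lim_le_bound c => m.
    have Hnm := HC_B (Hu n) (Hu (m + N)%N).
    have := hN n (m + N)%N Nn (leq_addl _ _); rewrite -/(nrm _ _) => /ltW.
    apply: le_trans; have := sum_le_lim K (term0 _) (HC_cvg Hnm).
    by apply: le_trans; apply: ler_sum => k _; rewrite (ipBl HH).
  have HuF n : (exists M, forall K, \sum_(k < K) wt k * sqn (coef (u n \- F) k) <= M) -> HC (u n \- F).
    move=> h; apply/HCP; split => //; first exact: (hilbB HH (Lu n) LF).
    by move=> i i0; rewrite (ipBl HH)// (HC_null (Hu n))// oF// subrr.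
  have HF : HC F.
    have [N hN] := key 1 ltr01.
    have := HC_B (Hu N) (HuF N (ex_intro _ 1 (hN N (leqnn N)))); congr (Defs.HC _ _ _ _ _).
    by apply/funext => x /=; ring.
  exists F => // eps e0.
  have [N hN] := key (eps / 2) (divr_gt0 e0 (ltr0n _ 2)); exists N => n Nn.
  apply: (@le_lt_trans _ _ (eps / 2)); last by lra.
  exact: lim_le_bound (hN n Nn) (HC_cvg (HC_B (Hu n) HF)).
Qed.

(** Both the covariance and the kernels C_j are reproducing for the same reason:
    the kernel section at s has coefficients lam_k^(j+1) conj (phi_k s), so that the
    inner product of F with it is the Karhunen-Loeve series of F at s. By
    Cauchy-Schwarz that series converges absolutely on E, and its sum must be
    the L^2 limit F. *)
Lemma rkhs_kernel E (K : X -> X -> C) : conull mu D E ->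
  (forall s, E s -> L2 mu D (K ^~ s)) ->
  (forall s, E s -> null_orth (K ^~ s)) ->
  (forall s k, E s -> coef (K ^~ s) k = (lam k ^+ j.+1)%:C%C * (phi (inl k) s)^*%C) ->
  (forall s, E s -> exists M, forall n, \sum_(k < n) lam k ^+ j.+1 * sqn (phi (inl (k : nat)) s) <= M) ->
  (forall s t, E s -> E t ->
     ccvg (fun n => \sum_(k < n) (lam k ^+ j.+1)%:C%C * (phi (inl (k : nat)) t * (phi (inl (k : nat)) s)^*%C)) (K t s)) ->
  rkhs_on mu D E HC HCip K.
Proof.
move=> nE LK oK cK bK KE.
have HK s : E s -> HC (K ^~ s).
  move=> Es; apply/HCP; split; [exact: LK|exact: oK|].
  have [M hM] := bK s Es; exists M => n; apply: le_trans (hM n).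
  apply: ler_sum => k _; rewrite cK// sqnM sqnR sqnJ mulrA.
  rewrite ler_wpM2r ?sqn_ge0// expr2 mulrA wtM /alpha.
  by case: ifP => _; rewrite ?mul1r// mul0r exprn_ge0.
have ipK F s : HC F -> E s ->
    ccvg (fun n => \sum_(k < n) coef F k * phi (inl (k : nat)) s) (HCip F (K ^~ s)).
  move=> HF Es; apply: ccvg_ext (HCip_cvg HF (HK _ Es)) => n; apply: eq_bigr => k _.
  rewrite cK// conjM conjc_real conjcK -[in RHS](alphaM k (HC_null HF)) -wtM.
  have gen (a b c p : C) : a * (c * (b * p)) = a * b * c * p by ring.
  by rewrite RCM; exact: gen.
split.
- exact: hilbert_HC.
- exact: HK.
- move=> F HF; have LF := HC_L2 HF.
  apply: (hcvg_pointwise mD nE _ LF (expansion LF (null_orthJ (HC_null HF)))).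
    by move=> n; exact: hilb_comb HH _ _ _ (fun k => Lphi (inl k)).
  by move=> s Es; exact: ipK.
- move=> s t Es Et; apply: (ccvg_unique (ipK _ _ (HK s Es) Et)).
  apply: ccvg_ext (KE s t Es Et) => n; apply: eq_bigr => k _.
  by rewrite cK//; ring.
Qed.

End weighted.

Lemma HC_mono i j F : (i <= j)%N -> HC mu D lam phi j F -> HC mu D lam phi i F.
Proof.
move=> ij /HCP[LF oF [M hM]]; apply/HCP; split => //.
exists (lam 0%N ^+ (j - i) * M) => n.
apply: (@le_trans _ _ (lam 0%N ^+ (j - i) * \sum_(k < n) wt j k * sqn (coef F k))); last first.
  by rewrite ler_wpM2l// exprn_ge0.
rewrite mulr_sumr; apply: ler_sum => k _; rewrite mulrA ler_wpM2r ?sqn_ge0//.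
rewrite /wt /alpha; case: ifPn => [k0|_]; last by rewrite !mul0r mulr0.
rewrite !mul1r -(subnK ij) addnK -addnS exprD invfM mulrA ler_peMl ?invr_ge0 ?exprn_ge0//.
by rewrite ler_pdivlMr ?exprn_gt0// mul1r lerXn2r ?nnegrE ?lam_le0.
Qed.

Lemma HCnorm2_0_le1 F : HC mu D lam phi 1 F ->
  (HCnorm2 mu D lam phi 0 F <= (lam 0%N)%:E * HCnorm2 mu D lam phi 1 F)%E.
Proof.
move=> H1; have H0 := HC_mono (leq0n 1) H1.
rewrite !HCnorm2_nrm// -EFinM lee_fin.
apply: lim_le_bound (HC_cvg H0) => n.
apply: le_trans (ler_wpM2l (lam_ge0 0) (sum_le_lim n (fun k => mulr_ge0 (wt_ge0 1 k) (sqn_ge0 (coef F k))) (HC_cvg H1))).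
rewrite mulr_sumr; apply: ler_sum => k _; rewrite mulrA ler_wpM2r ?sqn_ge0//.
rewrite /wt /alpha; case: ifPn => [k0|_]; last by rewrite !mul0r mulr0.
by rewrite !mul1r expr1 expr2 invfM mulrA ler_peMl ?invr_ge0// ler_pdivlMr// mul1r lam_le0.
Qed.

End KL.

(** * The operator L, its adjoint, and the space H_K *)

Section adjoint.
Context {R : realType} {d} {X : measurableType d}.
Variables (mu : {measure set X -> \bar R}) (D : set X).
Context {dO} {O : measurableType dO}.
Variable P : probability O R.
Variable h : X -> O -> R[i].
Local Notation C := R[i].

(** T = L L^*, where eta is the value L^* F of the adjoint. Stated pointwise in F
    so that it also covers fields, such as the Szego kernel, that are not square
    integrable on the product space. *)
Definition has_adjoint :=
  [/\ {ae mu, forall t, D t -> L2 P setT (h t)},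
      forall g, L2 P setT g -> L2 mu D (Lop P h g) &
      forall F, L2 mu D F -> exists2 eta, L2 P setT eta &
        (forall g, L2 P setT g -> L2ip mu D (Lop P h g) F = L2ip P setT g eta) /\
        aeq mu D (Top mu D P h F) (Lop P h eta)].

Hypothesis mD : measurable D.
Hypothesis adj : has_adjoint.

Local Notation T := (Top mu D P h).
Local Notation L := (Lop P h).
Local Notation ip := (L2ip mu D).
Local Notation ipP := (L2ip P setT).
Let HH := hilbert_L2 mu mD.
Let HP : hilbert_space P setT (L2 P setT) ipP := hilbert_L2 P measurableT.

Lemma LopB g g' : L2 P setT g -> L2 P setT g' ->
  aeq mu D (L (g \- g')) (fun t => L g t - L g' t).
Proof.
move=> Lg Lg'; have [Lh _ _] := adj.
apply: filterS Lh => t + Dt => /(_ Dt) Lt.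
rewrite /Lop (_ : (fun w => h t w * (g \- g') w) = (fun w => -1 * (h t w * g' w) + h t w * g w)).
  by rewrite cintegralL//; [ring|exact: integrableC_M|exact: integrableC_M].
by apply/funext => w /=; ring.
Qed.

(** The element of L^-1(F) orthogonal to the kernel of L is unique up to a null
    function, so the choice made by HKlift does not matter. *)
Lemma HKip_lift F G gF gG :
  [/\ L2 P setT gF, aeq mu D (L gF) F &
    forall g', kerL mu D P h g' -> ipP gF g' = 0] ->
  [/\ L2 P setT gG, aeq mu D (L gG) G &
    forall g', kerL mu D P h g' -> ipP gG g' = 0] ->
  HKip mu D P h F G = ipP gF gG.
Proof.
have uniq K gK : [/\ L2 P setT gK, aeq mu D (L gK) K &
      forall g', kerL mu D P h g' -> ipP gK g' = 0] ->
    L2 P setT (HKlift mu D P h K) /\ nrm ipP (HKlift mu D P h K \- gK) = 0.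
  move=> [Lg gKK og].
  have [L1 LK o1] := xgetPex (fun=> 0) (ex_intro _ gK (And3 Lg gKK og) :
    exists g, [set g | [/\ L2 P setT g, aeq mu D (L g) K &
      forall g', kerL mu D P h g' -> ipP g g' = 0]] g).
  split => //; have Ls : L2 P setT (HKlift mu D P h K \- gK) by exact: (hilbB HP).
  have kd : kerL mu D P h (HKlift mu D P h K \- gK).
    split => //; have := LopB L1 Lg.
    apply: filterS3 LK gKK => t h1 h2 h3 Dt.
    by rewrite h3// h1// h2// subrr.
  by rewrite /nrm (ipBl HP)// o1// og// subrr.
move=> aF aG; have [LF nF] := uniq _ _ aF; have [LG nG] := uniq _ _ aG.
have [LgF _ _] := aF; have [LgG _ _] := aG.
have := ip_ae0 HP (hilbB HP LF LgF) LG nF.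
have := ip_ae0 HP (hilbB HP LG LgG) LgF nG.
rewrite !(ipBl HP)// => /eqP; rewrite subr_eq0 => /eqP h1 /eqP.
rewrite subr_eq0 => /eqP h2.
by rewrite /HKip h2 (ipJ HP LG LgF) h1 -(ipJ HP LgG LgF).
Qed.

Section KL.
Context {J : countType}.
Variables (lam : nat -> R) (phi : nat + J -> X -> C).
Hypothesis KL : KL_basis mu D lam phi T.

Let phi_onb : orthonormal_basis mu D phi. Proof. by case: KL. Qed.
Let lam_ge0 k : 0 <= lam k. Proof. by case: KL. Qed.
Let lam_dec k : lam k.+1 <= lam k. Proof. by case: KL. Qed.
Let Lphi i : L2 mu D (phi i). Proof. by case: phi_onb. Qed.

Local Notation coef F k := (ip F (phi (inl (k : nat)))).
Local Notation ev := (eigval lam).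

(** The functions eta_i = L^* phi_i are orthogonal, with squared norms the
    eigenvalues; for a square integrable field the normalized eta_k are the
    conjugates of the xi_k. *)
Lemma adjoint_basis : exists eta : nat + J -> O -> C,
  [/\ forall i, L2 P setT (eta i),
      forall i g, L2 P setT g -> ip (L g) (phi i) = ipP g (eta i),
      forall i, aeq mu D (T (phi i)) (L (eta i)) &
      forall i j, ipP (eta i) (eta j) = (ev i *+ (i == j))%:C%C].
Proof.
have [_ Lg ad] := adj.
have /choice[eta heta] : forall i, exists eta, L2 P setT eta /\
    ((forall g, L2 P setT g -> ip (L g) (phi i) = ipP g eta) /\ aeq mu D (T (phi i)) (L eta)).
  by move=> i; have [eta h1 h2] := ad _ (Lphi i); exists eta.
exists eta; split.
- by move=> i; exact: (heta i).1.
- by move=> i; exact: (heta i).2.1.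
- by move=> i; exact: (heta i).2.2.
move=> i j; rewrite -(heta j).2.1; last exact: (heta i).1.
have [_ _ _ Tphi] := KL.
rewrite (@L2ip_ae _ _ _ _ _ mD _ (fun x => (ev i)%:C%C * phi i x)).
- rewrite (ipZl HH)//.
  case: phi_onb => _ -> _; case: eqP => _; first by rewrite mulr1 mulr1n.
  by rewrite mulr0 mulr0n.
- by apply: (Lg _ _).1; exact: (heta i).1.
- exact: (hilbZ HH _ (Lphi i)).1.
- exact: (Lphi j).1.
- by apply: filterS2 (heta i).2.2 (Tphi i) => t h1 h2 Dt; rewrite -h1// h2.
Qed.

(** T is self-adjoint because it is L L^*. *)
Lemma T_coef F G i : L2 mu D F -> L2 mu D G -> aeq mu D G (T F) ->
  ip G (phi i) = (ev i)%:C%C * ip F (phi i).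
Proof.
move=> LF LG GT; have [_ Lg ad] := adj.
have [eta Leta [heta TL]] := ad F LF.
have [xi [Lxi hxi TLxi _]] := adjoint_basis.
have [_ _ _ Tphi] := KL.
rewrite (@L2ip_ae _ _ _ _ _ mD G (L eta)).
- rewrite hxi// (ipJ HP (Lxi i) Leta) -heta//.
  rewrite (@L2ip_ae _ _ _ _ _ mD _ (fun x => (ev i)%:C%C * phi i x)).
  + by rewrite (ipZl HH)// conjM conjc_real -(ipJ HH (Lphi i) LF).
  + by apply: (Lg _ _).1; exact: Lxi.
  + exact: (hilbZ HH _ (Lphi i)).1.
  + exact: LF.1.
  + by apply: filterS2 (TLxi i) (Tphi i) => t h1 h2 Dt; rewrite -h1// h2.
- exact: LG.1.
- exact: (Lg _ Leta).1.
- exact: (Lphi i).1.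
- by apply: filterS2 GT TL => t h1 h2 Dt; rewrite h1// h2.
Qed.

Lemma T_null F G : L2 mu D F -> L2 mu D G -> aeq mu D G (T F) -> null_orth mu D lam phi G.
Proof. by move=> LF LG GT i i0; rewrite (T_coef i LF LG GT) i0 mul0r. Qed.

Lemma coef_eq_aeq F G : L2 mu D F -> L2 mu D G -> (forall i, ip F (phi i) = ip G (phi i)) ->
  aeq mu D F G.
Proof.
move=> LF LG FG.
have : nrm ip (F \- G) = 0.
  apply: (basis_total mD phi_onb) => [|i]; first exact: (hilbB HH).
  by rewrite (ipBl HH)// FG subrr.
move/(nrm_eq0 HH (hilbB HH LF LG)); apply: filterS => x h1 Dx.
by apply/eqP; rewrite -subr_eq0; apply/eqP; exact: h1.
Qed.

Lemma wt_alpha j k : wt lam j k * alpha lam k = wt lam j k.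
Proof. by rewrite /wt /alpha; case: ifP; rewrite ?mulr1// !mul0r. Qed.

Lemma wt0X2 j k : wt lam j k * wt lam 0 k ^+ 2 = wt lam (j + 2) k.
Proof.
rewrite /wt /alpha; case: ifPn => [k0|_]; last by rewrite !mul0r.
by rewrite !mul1r expr1 exprVn -invfM -exprD addSn.
Qed.

Lemma wtX2 j k : wt lam (j + 2) k * lam k ^+ 2 = wt lam j k.
Proof.
rewrite /wt /alpha; case: ifPn => [k0|_]; last by rewrite !mul0r.
have l0 : lam k ^+ 2 != 0 by rewrite expf_neq0// gt_eqF.
by rewrite !mul1r -addSn exprD invfM mulfVK.
Qed.

(** The coefficient of L g along phi_i is the inner product of g with eta_i, so
    that the bound is Bessel's inequality for the family eta with the weights
    alpha_k / lam_k. *)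
Lemma RL_HC F : RL mu D P h F -> HC mu D lam phi 0 F.
Proof.
move=> [LF [g Lg Fg]]; have [_ LL _] := adj.
have [eta [Leta heta _ oeta]] := adjoint_basis.
have coefE i : ip F (phi i) = ipP g (eta i).
  rewrite -heta//; apply: (L2ip_ae mD) => //; [exact: LF.1|exact: (LL _ Lg).1|exact: (Lphi i).1].
apply/(HCP mu D phi lam_ge0); split => //.
  move=> i i0; rewrite coefE (ipJ HP (Leta i) Lg) (ip_ae0 HP (Leta i) Lg) ?conjc0//.
  by rewrite /nrm oeta eqxx mulr1n.
exists (nrm ipP g) => n.
have oe (i j : nat) : i != j -> ipP (eta (inl i)) (eta (inl j)) = 0.
  by move=> ij; rewrite oeta (_ : (inl i == inl j :> nat + J) = false) ?mulr0n//; apply/negbTE.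
have := bessel HP (fun k => Leta (inl k)) oe (wt lam 0) n Lg.
apply: le_trans; apply: ler_sum => k _; rewrite coefE /nrm oeta eqxx mulr1n /=.
rewrite expr2 -mulrA (_ : wt lam 0 k * lam k = alpha lam k); last by rewrite -(wtM lam 0) expr1.
rewrite wt_alpha mulrC; apply: ler_wpM2l; first exact: sqn_ge0.
by lra.
Qed.

(** The preimage of F is the Riesz-Fischer sum of the coefficients of F divided by
    lam_k, over the functions eta_k; its inner products with preimages of other
    functions are the series of H_C. *)
Lemma HC_lift F : HC mu D lam phi 0 F -> exists2 g,
  [/\ L2 P setT g, aeq mu D (L g) F &
    forall g', kerL mu D P h g' -> ipP g g' = 0] &
  forall G g', L2 mu D G -> L2 P setT g' -> aeq mu D (L g') G ->
    ccvg (fun n => \sum_(k < n) (wt lam 0 k)%:C%C * (coef F k * (coef G k)^*%C)) (ipP g g').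
Proof.
move=> HF; have /(HCP mu D phi lam_ge0)[LF oF [M hM]] := HF; have [_ LL _] := adj.
have [eta [Leta heta _ oeta]] := adjoint_basis.
have oe (i j : nat) : i != j -> ipP (eta (inl i)) (eta (inl j)) = 0.
  by move=> ij; rewrite oeta (_ : (inl i == inl j :> nat + J) = false) ?mulr0n//; apply/negbTE.
have neta i : nrm ipP (eta i) = ev i by rewrite /nrm oeta eqxx mulr1n.
pose c k := (wt lam 0 k)%:C%C * coef F k.
have wl k : wt lam 0 k * lam k = alpha lam k by rewrite -(wtM lam 0) expr1.
have [n|g Lg cg] := riesz_fischer HP (fun k => Leta (inl k)) oe (c := c) (M := M).
  apply: le_trans (hM n); rewrite le_eqVlt; apply/orP; left; apply/eqP.
  apply: eq_bigr => k _; rewrite neta /c sqnM sqnR /=.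
  by rewrite -[in RHS](wt_alpha 0 k) -wl; ring.
have ipc k : ipP g (eta (inl k)) = coef F k.
  rewrite (ip_hcvg_comb HP (fun k => Leta (inl k)) oe Lg cg) neta /c /=.
  by rewrite mulrAC -RCM wl (alphaM lam_ge0 _ oF).
have cvgG G g' : L2 mu D G -> L2 P setT g' -> aeq mu D (L g') G ->
    ccvg (fun n => \sum_(k < n) (wt lam 0 k)%:C%C * (coef F k * (coef G k)^*%C)) (ipP g g').
  move=> LG Lg' g'G; apply: ccvg_ext (ip_hcvg HP (fun k => Leta (inl k)) Lg Lg' cg) => n.
  apply: eq_bigr => k _; rewrite /c mulrA; congr (_ * _).
  rewrite (ipJ HP Lg' (Leta _)) -heta//; congr (_^*%C).
  by apply: (L2ip_ae mD) => //; [exact: (LL _ Lg').1|exact: LG.1|exact: (Lphi _).1].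
exists g => //; split => //.
  apply: coef_eq_aeq => //; first exact: LL.
  move=> [k|j]; rewrite heta//.
  rewrite (oF (inr j))// (ipJ HP (Leta _) Lg) (ip_ae0 HP (Leta _) Lg) ?conjc0//.
move=> g' [Lg' g'0]; apply: (ccvg_unique (cvgG _ _ (hilb0 HH) Lg' g'0)).
rewrite (_ : (fun n => _) = fun=> 0); first by split; exact: cvg_cst.
by apply/funext => n; apply: big1 => k _; rewrite (ip0l HH)// conjc0 !mulr0.
Qed.

Lemma RL_eq_HC : RL mu D P h = HC mu D lam phi 0.
Proof.
apply/seteqP; split => F; first exact: RL_HC.
move=> HF; have [g [Lg gF _] _] := HC_lift HF.
split; first exact: HC_L2 HF.
by exists g => //; apply: filterS gF => x h1 Dx; rewrite h1.
Qed.

Lemma HKip_HCip F G : HC mu D lam phi 0 F -> HC mu D lam phi 0 G ->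
  HKip mu D P h F G = HCip mu D lam phi 0 F G.
Proof.
move=> HF HG; have [gF aF cF] := HC_lift HF; have [gG aG _] := HC_lift HG.
rewrite (HKip_lift aF aG).
case: aG => LgG gGG _.
apply: (ccvg_unique (cF G gG _ LgG gGG)); first exact: HC_L2 HG.
exact: (HCip_cvg lam_ge0 HF HG).
Qed.

(** T is inverted on H_{C_1} by dividing the coefficients by the eigenvalues. *)
Lemma T_inv F : HC mu D lam phi 1 F -> exists G,
  [/\ L2 mu D G, null_orth mu D lam phi G, aeq mu D F (T G) &
    forall k, coef G k = (wt lam 0 k)%:C%C * coef F k].
Proof.
move=> HF; have /(HCP mu D phi lam_ge0)[LF oF [M hM]] := HF; have [_ LL ad] := adj.
have [n|G [LG _ Gk Gj]] := synthesis mD phi_onb (c := fun k => (wt lam 0 k)%:C%C * coef F k) (M := M).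
  apply: le_trans (hM n); rewrite le_eqVlt; apply/orP; left; apply/eqP.
  apply: eq_bigr => k _; rewrite sqnM sqnR; congr (_ * _).
  rewrite /wt /alpha; case: ifP => _; last by rewrite !mul0r expr0n.
  by rewrite !mul1r expr1 exprVn.
have oG : null_orth mu D lam phi G.
  by move=> [k|j] i0; rewrite ?Gj// Gk (oF (inl k))// mulr0.
exists G; split => //.
have [eta Leta [_ TL]] := ad G LG.
have LT : aeq mu D (L eta) (T G) by apply: filterS TL => x h1 Dx; rewrite h1.
suff FL : aeq mu D F (L eta) by apply: filterS2 FL LT => x h1 h2 Dx; rewrite h1// h2.
apply: coef_eq_aeq => //; first exact: LL.
move=> i; rewrite (T_coef i LG (LL _ Leta) LT); case: i => [k|j] /=.
  by rewrite Gk mulrA -RCM mulrC -(expr1 (lam k)) [_ * wt _ _ _]mulrC (wtM lam 0) mulrC (alphaM lam_ge0 _ oF).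
by rewrite mul0r oF.
Qed.

Lemma RT_eq_HC : RT mu D P h = HC mu D lam phi 1.
Proof.
apply/seteqP; split => G.
  move=> [LG [F LF GT]]; apply/(HCP mu D phi lam_ge0); split => //.
    exact: T_null LF LG GT.
  exists (nrm ip F) => n.
  apply: le_trans (bessel_phi mD phi_onb n LF); apply: ler_sum => k _.
  rewrite (T_coef (inl (k : nat)) LF LG GT) sqnM sqnR mulrA (wtM lam 1) /alpha.
  by case: ifP => _; rewrite ?mul1r// mul0r sqn_ge0.
move=> HG; have [F [LF _ GT _]] := T_inv HG.
by split; [exact: HC_L2 HG|exists F].
Qed.

Lemma T_HC j : image_of mu D T (HC mu D lam phi j) = HC mu D lam phi (j + 2).
Proof.
apply/seteqP; split => G.
  move=> [LG [F HF GT]]; have /(HCP mu D phi lam_ge0)[LF oF [M hM]] := HF.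
  apply/(HCP mu D phi lam_ge0); split => //; first exact: T_null LF LG GT.
  exists M => n; apply: le_trans (hM n); apply: ler_sum => k _.
  by rewrite (T_coef (inl (k : nat)) LF LG GT) sqnM sqnR mulrA wtX2.
move=> HG; have j1 : (1 <= j + 2)%N by rewrite addnS.
have [F [LF oF GT cF]] := T_inv (HC_mono lam_ge0 lam_dec j1 HG).
have /(HCP mu D phi lam_ge0)[LG oG [M hM]] := HG.
split => //; exists F => //; apply/(HCP mu D phi lam_ge0); split => //.
exists M => n; apply: le_trans (hM n); apply: ler_sum => k _.
by rewrite cF sqnM sqnR mulrA wt0X2.
Qed.

End KL.
End adjoint.

(** * Fubini's theorem for complex functions on subdomains *)

Section fubini_restricted.
Context {R : realType} {d1 d2} {T1 : measurableType d1} {T2 : measurableType d2}.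
Local Notation C := R[i].
Variables (m1 : {sigma_finite_measure set T1 -> \bar R}).
Variables (m2 : {sigma_finite_measure set T2 -> \bar R}).
Variables (D1 : set T1) (D2 : set T2).
Hypotheses (mD1 : measurable D1) (mD2 : measurable D2).

Let mD12 : measurable (D1 `*` D2). Proof. exact: measurableX. Qed.

Lemma patch_prod (U : pointedType) (k : T1 -> T2 -> U) x y :
  ((fun p : T1 * T2 => k p.1 p.2) \_ (D1 `*` D2)) (x, y) =
  if x \in D1 then (k x \_ D2) y else point.
Proof.
rewrite /patch; have [xD|xD] := boolP (x \in D1); have [yD|yD] := boolP (y \in D2).
- by rewrite ifT// inE; split => /=; exact: set_mem.
- by rewrite ifF//; apply/negbTE; apply: contra yD; rewrite !inE => -[].
- by rewrite ifF//; apply/negbTE; apply: contra xD; rewrite !inE => -[].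
- by rewrite ifF//; apply/negbTE; apply: contra xD; rewrite !inE => -[].
Qed.

Lemma measurable_section d (U : measurableType d) (k : T1 -> T2 -> U) x : D1 x ->
  measurable_fun (D1 `*` D2) (fun p => k p.1 p.2) -> measurable_fun D2 (k x).
Proof.
move=> Dx mk; apply: (measurable_comp (F := D1 `*` D2) (f := fun p => k p.1 p.2) (g := pair x)) => //.
  by move=> _ [y Dy <-].
exact: measurable_funTS.
Qed.

Let mpatch (k : T1 -> T2 -> \bar R) : measurable_fun (D1 `*` D2) (fun p => k p.1 p.2) ->
  measurable_fun setT ((fun p => k p.1 p.2) \_ (D1 `*` D2)).
Proof. by move/(measurable_restrictT _ mD12). Qed.

Let patchE (k : T1 -> T2 -> \bar R) x : D1 x ->
  (\int[m2]_y ((fun p => k p.1 p.2) \_ (D1 `*` D2)) (x, y) = \int[m2]_(y in D2) k x y)%E.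
Proof.
move=> Dx; rewrite [RHS]integral_mkcond; apply: eq_integral => y _.
by rewrite patch_prod mem_set.
Qed.

Lemma measurable_integral_param (k : T1 -> T2 -> \bar R) :
  measurable_fun (D1 `*` D2) (fun p => k p.1 p.2) ->
  measurable_fun D1 (fun x => \int[m2]_(y in D2) k x y)%E.
Proof.
move=> /mpatch mk; set kk := (X in measurable_fun _ X) in mk.
have mF : measurable_fun setT (fun x => \int[m2]_y kk (x, y))%E.
  rewrite (_ : (fun x => _) = (fun x => \int[m2]_y (kk^\+)%E (x, y) - \int[m2]_y (kk^\-)%E (x, y))%E).
    apply: emeasurable_funB.
      by apply: measurable_fun_fubini_tonelli_F => //; exact: measurable_funepos.
    by apply: measurable_fun_fubini_tonelli_F => //; exact: measurable_funeneg.
  apply/funext => x; rewrite [LHS]integralE; congr (_ - _)%E.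
    by apply: eq_integral => y _; rewrite !funeposE.
  by apply: eq_integral => y _; rewrite !funenegE.
apply: (@eq_measurable_fun _ _ _ _ D1 (fun x => \int[m2]_y kk (x, y))%E).
  by move=> x /set_mem Dx; rewrite /kk patchE.
exact: measurable_funTS.
Qed.

Lemma measurable_Rintegral_param (k : T1 -> T2 -> R) :
  measurable_fun (D1 `*` D2) (fun p => k p.1 p.2) ->
  measurable_fun D1 (fun x => \int[m2]_(y in D2) k x y)%R.
Proof.
move=> mk; rewrite /Rintegral.
apply: (measurableT_comp (@fine_measurable R setT measurableT)).
by apply: (measurable_integral_param (k := fun x y => (k x y)%:E)); exact/measurable_EFinP.
Qed.

Lemma mC_param (k : T1 -> T2 -> C) :
  Defs.measurableC (D1 `*` D2) (fun p => k p.1 p.2) ->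
  Defs.measurableC D1 (fun x => cintegral m2 D2 (k x)).
Proof.
move=> [k1 k2]; split.
  exact: (measurable_Rintegral_param (k := fun x y => Re (k x y))).
exact: (measurable_Rintegral_param (k := fun x y => Im (k x y))).
Qed.

Lemma mC_section (k : T1 -> T2 -> C) x : D1 x ->
  Defs.measurableC (D1 `*` D2) (fun p => k p.1 p.2) -> Defs.measurableC D2 (k x).
Proof.
move=> Dx [k1 k2]; split.
  exact: (measurable_section (k := fun x y => Re (k x y)) Dx).
exact: (measurable_section (k := fun x y => Im (k x y)) Dx).
Qed.

End fubini_restricted.

Section fubini_swap.
Context {R : realType} {d1 d2} {T1 : measurableType d1} {T2 : measurableType d2}.
Local Notation C := R[i].
Variables (m1 : {sigma_finite_measure set T1 -> \bar R}).
Variables (m2 : {sigma_finite_measure set T2 -> \bar R}).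
Variables (D1 : set T1) (D2 : set T2).
Hypotheses (mD1 : measurable D1) (mD2 : measurable D2).

Lemma measurable_swap_dom d (U : measurableType d) (k : T1 -> T2 -> U) :
  measurable_fun (D1 `*` D2) (fun p => k p.1 p.2) ->
  measurable_fun (D2 `*` D1) (fun p => k p.2 p.1).
Proof.
move=> mk; apply: (measurable_comp (F := D1 `*` D2) (f := fun p => k p.1 p.2) (g := fun p : T2 * T1 => (p.2, p.1))) => //.
- exact: measurableX.
- by move=> _ [[y x] [/= Dy Dx] <-].
- by apply: measurable_funTS; apply/measurable_fun_pairP; split; [exact: measurable_snd|exact: measurable_fst].
Qed.

Lemma mC_swap (k : T1 -> T2 -> C) :
  Defs.measurableC (D1 `*` D2) (fun p => k p.1 p.2) ->
  Defs.measurableC (D2 `*` D1) (fun p => k p.2 p.1).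
Proof.
move=> [k1 k2]; split.
  exact: (measurable_swap_dom (k := fun x y => Re (k x y))).
exact: (measurable_swap_dom (k := fun x y => Im (k x y))).
Qed.

Lemma tonelli_dom (k : T1 -> T2 -> \bar R) :
  measurable_fun (D1 `*` D2) (fun p => k p.1 p.2) ->
  (forall x y, D1 x -> D2 y -> (0 <= k x y)%E) ->
  (\int[m1]_(x in D1) \int[m2]_(y in D2) k x y =
   \int[m2]_(y in D2) \int[m1]_(x in D1) k x y)%E.
Proof.
move=> mk k0.
pose kk := (fun p : T1 * T2 => k p.1 p.2) \_ (D1 `*` D2).
have := @fubini_tonelli _ _ _ _ _ m1 m2 kk.
have mkk : measurable_fun setT kk by apply/(measurable_restrictT _ (measurableX mD1 mD2)).
have kk0 p : (0 <= kk p)%E.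
  by rewrite /kk /patch; case: ifPn => // /set_mem[]; exact: k0.
move=> /(_ mkk kk0) E; transitivity (\int[m1]_x \int[m2]_y kk (x, y))%E.
  rewrite [LHS]integral_mkcond; apply: eq_integral => x _.
  rewrite [LHS]/patch; case: ifPn => xD.
    rewrite [LHS]integral_mkcond; apply: eq_integral => y _.
    by rewrite /kk patch_prod xD.
  by apply/esym/integral0_eq => y _; rewrite /kk patch_prod (negbTE xD).
rewrite E.
rewrite [RHS]integral_mkcond; apply: eq_integral => y _.
rewrite [RHS]/patch; case: ifPn => yD.
  rewrite [RHS]integral_mkcond; apply: eq_integral => x _.
  by rewrite /kk patch_prod /patch yD.
apply: integral0_eq => x _; rewrite /kk patch_prod /patch (negbTE yD).
by case: ifP.
Qed.

End fubini_swap.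

Section fubini_complex.
Context {R : realType} {d1 d2} {T1 : measurableType d1} {T2 : measurableType d2}.
Local Notation C := R[i].

Lemma ae_fineK d (T : measurableType d) (m : {measure set T -> \bar R}) (F : T -> \bar R) :
  measurable_fun setT F -> {ae m, forall x, F x \is a fin_num} ->
  (\int[m]_x (fine (F x))%:E = \int[m]_x F x)%E.
Proof.
move=> mF Ff; apply: ae_eq_integral => //.
  by apply/measurable_EFinP; apply: (measurableT_comp (@fine_measurable R setT measurableT)).
by apply: filterS Ff => x fx _; rewrite fineK.
Qed.

Variables (m1 : {sigma_finite_measure set T1 -> \bar R}).
Variables (m2 : {sigma_finite_measure set T2 -> \bar R}).
Variables (D1 : set T1) (D2 : set T2).
Hypotheses (mD1 : measurable D1) (mD2 : measurable D2).

Lemma Rfubini (k : T1 * T2 -> R) : (m1 \x m2)%E.-integrable setT (EFin \o k) ->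
  (\int[m1]_x (\int[m2]_y k (x, y)) = \int[m2]_y (\int[m1]_x k (x, y)))%R.
Proof.
move=> ik; rewrite /Rintegral; congr fine.
rewrite (@ae_fineK _ _ m1 (fun x => \int[m2]_y (k (x, y))%:E)%E).
- rewrite (@ae_fineK _ _ m2 (fun y => \int[m1]_x (k (x, y))%:E)%E).
  + exact: (Fubini ik).
  + exact: (measurable_fubini_G ik).
  + by apply: filterS (ae_integrable2 ik) => y iy; exact: integrable_fin_num.
- exact: (measurable_fubini_F ik).
- by apply: filterS (ae_integrable1 ik) => x ix; exact: integrable_fin_num.
Qed.

Lemma Rfubini_dom (k : T1 -> T2 -> R) (g : T1 -> T2 -> \bar R) :
  measurable_fun (D1 `*` D2) (fun p => k p.1 p.2) ->
  measurable_fun (D1 `*` D2) (fun p => g p.1 p.2) ->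
  (forall x y, D1 x -> D2 y -> (`|k x y|%:E <= g x y)%E) ->
  (\int[m1]_(x in D1) \int[m2]_(y in D2) g x y < +oo)%E ->
  (\int[m1]_(x in D1) (\int[m2]_(y in D2) k x y) =
   \int[m2]_(y in D2) (\int[m1]_(x in D1) k x y))%R.
Proof.
move=> mk mg kg ig.
pose kk := (fun p : T1 * T2 => k p.1 p.2) \_ (D1 `*` D2).
have mkk : measurable_fun setT kk by apply/(measurable_restrictT _ (measurableX mD1 mD2)).
have ikk : (m1 \x m2)%E.-integrable setT (EFin \o kk).
  apply/integrable12ltyP; first exact/measurable_EFinP.
  apply: le_lt_trans ig; rewrite [leRHS]integral_mkcond.
  apply: ge0_le_integral => //.
  - by move=> x _; apply: integral_ge0.
  - apply: (measurable_fun_fubini_tonelli_F (fun p => `|(kk p)%:E|%E)) => //.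
    by apply: measurableT_comp => //; exact/measurable_EFinP.
  - apply/(measurable_restrictT _ mD1).
    exact: (measurable_integral_param m2 mD1 mD2 (k := g)).
  move=> x _; rewrite [leRHS]/patch; case: ifPn => xD; last first.
    rewrite integral0_eq// => y _.
    by rewrite /= /kk patch_prod (negbTE xD) normr0.
  rewrite [leRHS]integral_mkcond; have Dx := set_mem xD.
  apply: ge0_le_integral => //.
  - apply: measurableT_comp => //; apply/measurable_EFinP.
    exact: (measurableT_comp mkk (pair1_measurable x)).
  - by apply/(measurable_restrictT _ mD2); exact: measurable_section mg.
  move=> y _; rewrite /= /kk patch_prod xD /patch; case: ifPn => yD.
    by apply: kg => //; exact: set_mem.
  by rewrite normr0.
have E := Rfubini ikk.
transitivity (\int[m1]_x (\int[m2]_y kk (x, y)))%R.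
  rewrite [LHS]Rintegral_mkcond; apply: eq_Rintegral => x _.
  rewrite [LHS]/patch; case: ifPn => xD.
    rewrite [LHS]Rintegral_mkcond; apply: eq_Rintegral => y _.
    by rewrite /kk patch_prod xD.
  rewrite /Rintegral integral0_eq// => y _.
  by rewrite /kk patch_prod (negbTE xD).
rewrite E [RHS]Rintegral_mkcond; apply: eq_Rintegral => y _.
rewrite [RHS]/patch; case: ifPn => yD.
  rewrite [RHS]Rintegral_mkcond; apply: eq_Rintegral => x _.
  by rewrite /kk patch_prod /patch yD.
rewrite /Rintegral integral0_eq// => x _; rewrite /kk patch_prod /patch (negbTE yD).
by case: ifP.
Qed.

Lemma cfubini (k : T1 -> T2 -> C) (g : T1 -> T2 -> \bar R) :
  Defs.measurableC (D1 `*` D2) (fun p => k p.1 p.2) ->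
  measurable_fun (D1 `*` D2) (fun p => g p.1 p.2) ->
  (forall x y, D1 x -> D2 y -> (`|Re (k x y)|%:E <= g x y)%E /\ (`|Im (k x y)|%:E <= g x y)%E) ->
  (\int[m1]_(x in D1) \int[m2]_(y in D2) g x y < +oo)%E ->
  cintegral m1 D1 (fun x => cintegral m2 D2 (k x)) =
  cintegral m2 D2 (fun y => cintegral m1 D1 (k ^~ y)).
Proof.
move=> [k1 k2] mg kg ig; apply: C_eq => /=.
  by apply: (Rfubini_dom (k := fun x y => Re (k x y)) k1 mg) => // x y Dx Dy; exact: (kg x y Dx Dy).1.
by apply: (Rfubini_dom (k := fun x y => Im (k x y)) k2 mg) => // x y Dx Dy; exact: (kg x y Dx Dy).2.
Qed.

End fubini_complex.

(** * Random fields of finite second moment *)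

Section hilbert_schmidt.
Context {R : realType} {d1 d2} {T1 : measurableType d1} {T2 : measurableType d2}.
Local Notation C := R[i].
Variables (m1 : {sigma_finite_measure set T1 -> \bar R}).
Variables (m2 : {sigma_finite_measure set T2 -> \bar R}).
Variables (D1 : set T1) (D2 : set T2).
Hypotheses (mD1 : measurable D1) (mD2 : measurable D2).

Lemma measurable_fst_dom d (U : measurableType d) (f : T1 -> U) : measurable_fun D1 f ->
  measurable_fun (D1 `*` D2) (fun p => f p.1).
Proof.
move=> mf; apply: (measurable_comp (F := D1) (f := f) (g := fst)) => //.
- by move=> _ [[x y] [/= Dx Dy] <-].
- by apply: measurable_funTS; exact: measurable_fst.
Qed.

Lemma measurable_snd_dom d (U : measurableType d) (f : T2 -> U) : measurable_fun D2 f ->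
  measurable_fun (D1 `*` D2) (fun p => f p.2).
Proof.
move=> mf; apply: (measurable_comp (F := D2) (f := f) (g := snd)) => //.
- by move=> _ [[x y] [/= Dx Dy] <-].
- by apply: measurable_funTS; exact: measurable_snd.
Qed.

Lemma mC_fst (f : T1 -> C) : Defs.measurableC D1 f ->
  Defs.measurableC (D1 `*` D2) (fun p => f p.1).
Proof.
by move=> [f1 f2]; split; [exact: (measurable_fst_dom f1)|exact: (measurable_fst_dom f2)].
Qed.

Lemma mC_snd (f : T2 -> C) : Defs.measurableC D2 f ->
  Defs.measurableC (D1 `*` D2) (fun p => f p.2).
Proof.
by move=> [f1 f2]; split; [exact: (measurable_snd_dom f1)|exact: (measurable_snd_dom f2)].
Qed.

Variable K : T1 -> T2 -> C.
Hypothesis mK : Defs.measurableC (D1 `*` D2) (fun p => K p.1 p.2).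
Hypothesis K2 : (\int[m1]_(x in D1) \int[m2]_(y in D2) (sqn (K x y))%:E < +oo)%E.

Lemma esqn_prod : measurable_fun (D1 `*` D2) (fun p => (sqn (K p.1 p.2))%:E).
Proof. exact: (emeasurable_sqn mK). Qed.

Lemma measurable_normK : measurable_fun D1 (fun x => \int[m2]_(y in D2) (sqn (K x y))%:E)%E.
Proof.
exact: (measurable_integral_param m2 mD1 mD2 (k := fun x y => (sqn (K x y))%:E) esqn_prod).
Qed.

Lemma section_L2 : {ae m1, forall x, D1 x -> L2 m2 D2 (K x)}.
Proof.
have iK : m1.-integrable D1 (fun x => \int[m2]_(y in D2) (sqn (K x y))%:E)%E.
  apply/integrableP; split; first exact: measurable_normK.
  rewrite (eq_integral (fun x => \int[m2]_(y in D2) (sqn (K x y))%:E)%E) => [|x _].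
    exact: K2.
  by rewrite gee0_abs//; apply: integral_ge0 => y _; rewrite lee_fin sqn_ge0.
apply: filterS (integrable_ae mD1 iK) => x h Dx; split.
  exact: (mC_section mD1 mD2 Dx mK).
by rewrite -ge0_fin_numE; [exact: h|exact: L2norm2_ge0].
Qed.

(** Hilbert-Schmidt operators are bounded: Cauchy-Schwarz in the inner integral. *)
Lemma kernel_L2 g : L2 m2 D2 g ->
  L2 m1 D1 (fun x => cintegral m2 D2 (fun y => K x y * g y)).
Proof.
move=> Lg; have H2 := hilbert_L2 m2 mD2.
have mi : Defs.measurableC D1 (fun x => cintegral m2 D2 (fun y => K x y * g y)).
  apply: (mC_param m2 mD1 mD2 (k := fun x y => K x y * g y)).
  by apply: (mC_M mK); exact: mC_snd Lg.1.
split => //.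
apply: (@le_lt_trans _ _ (\int[m1]_(x in D1) ((nrm (L2ip m2 D2) g)%:E *
    \int[m2]_(y in D2) (sqn (K x y))%:E))%E).
  apply: ae_ge0_le_integral => //.
  - by move=> x _; rewrite lee_fin sqn_ge0.
  - exact: emeasurable_sqn.
  - move=> x _; apply: mule_ge0; first by rewrite lee_fin (nrm_ge0 H2).
    by apply: integral_ge0 => y _; rewrite lee_fin sqn_ge0.
  - by apply: measurable_funeM; exact: measurable_normK.
  apply: filterS section_L2 => x h Dx; have Kx := h Dx.
  rewrite -/(L2norm2 m2 D2 (K x)) L2norm2_nrm// -EFinM lee_fin mulrC.
  have := cauchy_schwarz H2 Kx (L2J Lg).
  rewrite (_ : L2ip _ _ _ _ = cintegral m2 D2 (fun y => K x y * g y)).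
    move=> /le_trans; apply; rewrite le_eqVlt; apply/orP; left; apply/eqP; congr (_ * _).
    by rewrite /nrm !Re_L2ip /L2norm2; under eq_integral do rewrite sqnJ.
  by rewrite /L2ip; congr cintegral; apply/funext => y; rewrite conjcK.
rewrite ge0_integralZl_EFin//.
- by rewrite lte_mul_pinfty// lee_fin (nrm_ge0 H2).
- by move=> x _; apply: integral_ge0 => y _; rewrite lee_fin sqn_ge0.
- exact: measurable_normK.
- exact: nrm_ge0 H2 _ Lg.
Qed.

End hilbert_schmidt.

Section field.
Context {R : realType} {d} {X : measurableType d}.
Variables (mu : {sigma_finite_measure set X -> \bar R}) (D : set X).
Context {dO} {O : measurableType dO}.
Variable P : probability O R.
Variable h : X -> O -> R[i].
Local Notation C := R[i].
Hypothesis mD : measurable D.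
Hypothesis hN : inN mu D P h.

Local Notation T := (Top mu D P h).
Local Notation L := (Lop P h).
Local Notation ip := (L2ip mu D).
Local Notation ipP := (L2ip P setT).
Let HH := hilbert_L2 mu mD.
Let HP : hilbert_space P setT (L2 P setT) ipP := hilbert_L2 P measurableT.

Let mh : Defs.measurableC (D `*` setT) (fun p : X * O => h p.1 p.2).
Proof. by case: hN. Qed.

Lemma Nnorm2_swap : Nnorm2 mu D P h = (\int[mu]_(t in D) \int[P]_w (sqn (h t w))%:E)%E.
Proof.
rewrite /Nnorm2; symmetry.
apply: (tonelli_dom mu P mD measurableT (k := fun x w => (sqn (h x w))%:E)).
  exact: (emeasurable_sqn mh).
by move=> x w _ _; rewrite lee_fin sqn_ge0.
Qed.

Let h2D : (\int[mu]_(t in D) \int[P]_w (sqn (h t w))%:E < +oo)%E.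
Proof. by rewrite -Nnorm2_swap; case: hN. Qed.

Let mhJ : Defs.measurableC (setT `*` D) (fun p : O * X => (h p.2 p.1)^*%C).
Proof. by apply: mC_J; exact: (mC_swap mD measurableT mh). Qed.

Let hJ2 : (\int[P]_w \int[mu]_(x in D) (sqn (h x w)^*%C)%:E < +oo)%E.
Proof. by under eq_integral do under eq_integral do rewrite sqnJ; case: hN. Qed.

Lemma field_L2P : {ae mu, forall t, D t -> L2 P setT (h t)}.
Proof. exact: (section_L2 mD measurableT mh h2D). Qed.

Lemma field_L2D : {ae P, forall w, L2 mu D (h ^~ w)}.
Proof.
have := section_L2 measurableT mD mhJ hJ2; apply: filterS => w /(_ I) hw.
by have := L2J hw; congr (L2 mu D); apply/funext => t; rewrite conjcK.
Qed.

Definition Ladj (F : X -> C) (w : O) : C := cintegral mu D (fun t => (h t w)^*%C * F t).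

Lemma LadjE F w : Ladj F w = (ip (h ^~ w) F)^*%C.
Proof.
rewrite /Ladj /L2ip -cintegralJ; congr cintegral; apply/funext => t.
by rewrite conjM conjcK.
Qed.

Lemma Ladj_L2 F : L2 mu D F -> L2 P setT (Ladj F).
Proof. exact: (kernel_L2 measurableT mD (K := fun w t => (h t w)^*%C) mhJ hJ2). Qed.

Lemma Lop_L2 g : L2 P setT g -> L2 mu D (L g).
Proof. exact: (kernel_L2 mD measurableT (K := h) mh h2D). Qed.

(** Fubini's theorem; the integrand is dominated by |h|^2 + |g|^2 |F|^2. *)
Lemma Lop_adj F g : L2 mu D F -> L2 P setT g -> ip (L g) F = ipP g (Ladj F).
Proof.
move=> LF Lg.
pose k t w : C := h t w * (g w * (F t)^*%C).
have mk : Defs.measurableC (D `*` setT) (fun p : X * O => k p.1 p.2).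
  apply: (mC_M mh); apply: mC_M; first exact: mC_snd Lg.1.
  by apply: mC_J; exact: mC_fst LF.1.
have eF : ip (L g) F = cintegral mu D (fun t => cintegral P setT (k t)).
  apply: (cintegral_ae mD).
  - by apply: mC_M; [exact: (Lop_L2 Lg).1|exact: mC_J LF.1].
  - exact: (mC_param P mD measurableT mk).
  - apply: filterS field_L2P => t + Dt => /(_ Dt) ht.
    rewrite /Lop mulrC -(cintegralZ measurableT _ (integrableC_M measurableT ht Lg)).
    by congr cintegral; apply/funext => w; rewrite /k; ring.
have eG : ipP g (Ladj F) = cintegral P setT (fun w => cintegral mu D (k ^~ w)).
  apply: (cintegral_ae measurableT).
  - by apply: mC_M; [exact: Lg.1|exact: mC_J (Ladj_L2 LF).1].
  - exact: (mC_param mu measurableT mD (k := fun w t => k t w) (mC_swap mD measurableT mk)).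
  - apply: filterS field_L2D => w hw _.
    rewrite LadjE conjcK /L2ip -(cintegralZ mD _ (integrableC_ip mD hw LF)).
    by congr cintegral; apply/funext => t; rewrite /k; ring.
rewrite eF eG.
apply: (cfubini mD measurableT (g := fun t w => ((sqn (h t w))%:E + (sqn (g w) * sqn (F t))%:E)%E) mk).
- apply: emeasurable_funD; first exact: (emeasurable_sqn mh).
  apply/measurable_EFinP; apply: measurable_funM.
    by apply: (measurable_snd_dom _ (f := fun w => sqn (g w))) => //; exact: measurable_sqn Lg.1.
  by apply: (measurable_fst_dom _ (f := fun t => sqn (F t))) => //; exact: measurable_sqn LF.1.
- move=> t w _ _; rewrite -EFinD !lee_fin /k -[sqn (F t)]sqnJ -sqnM.
  by rewrite norm_Re_le norm_Im_le.
have s0 (z : C) : (0 <= (sqn z)%:E)%E by rewrite lee_fin sqn_ge0.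
have mg2 t : D t -> measurable_fun setT (fun w => (sqn (h t w))%:E).
  by move=> Dt; apply: emeasurable_sqn; exact: (mC_section mD measurableT Dt mh).
have -> : (\int[mu]_(t in D) \int[P]_w ((sqn (h t w))%:E + (sqn (g w) * sqn (F t))%:E) =
   \int[mu]_(t in D) (\int[P]_w (sqn (h t w))%:E + (nrm ipP g)%:E * (sqn (F t))%:E))%E.
  apply: eq_integral => t /set_mem Dt.
  rewrite ge0_integralD//; last 3 first.
  - exact: mg2.
  - by move=> w _; rewrite lee_fin mulr_ge0 ?sqn_ge0.
  - apply/measurable_EFinP; apply: measurable_funM; last exact: measurable_cst.
    exact: measurable_sqn Lg.1.
  congr (_ + _)%E; under eq_integral do rewrite mulrC EFinM.
  rewrite ge0_integralZl_EFin ?sqn_ge0//; last exact: emeasurable_sqn Lg.1.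
  by rewrite -/(L2norm2 P setT g) L2norm2_nrm// muleC.
rewrite ge0_integralD//; last 4 first.
- by move=> t _; apply: integral_ge0.
- exact: (measurable_normK P mD measurableT mh).
- by move=> t _; rewrite mule_ge0// lee_fin (nrm_ge0 HP).
- by apply: measurable_funeM; exact: emeasurable_sqn LF.1.
rewrite lte_add_pinfty// ge0_integralZl_EFin//; last 2 first.
- exact: emeasurable_sqn LF.1.
- exact: (nrm_ge0 HP).
by rewrite lte_mul_pinfty ?lee_fin ?(nrm_ge0 HP)//; case: LF.
Qed.

Lemma covJ s t : cov P h s t = (cov P h t s)^*%C.
Proof.
rewrite /cov -cintegralJ; congr cintegral; apply/funext => w.
by rewrite conjM conjcK mulrC.
Qed.

Lemma Lop_conj s t : L (fun w => (h s w)^*%C) t = cov P h t s.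
Proof. by []. Qed.

(** T = L L^*, at every point where the field is square integrable. *)
Lemma Top_Ladj F s : L2 mu D F -> L2 P setT (h s) -> T F s = L (Ladj F) s.
Proof.
move=> LF hs; have := Lop_adj LF (L2J hs).
rewrite -[LHS]conjcK -[RHS]conjcK => /(congr1 (fun z => z^*%C)); rewrite !conjcK.
rewrite /L2ip -!cintegralJ => e.
rewrite /Top /Lop; transitivity (cintegral mu D (fun x => (L (fun w => (h s w)^*%C) x * (F x)^*%C)^*%C)).
  congr cintegral; apply/funext => t.
  by rewrite conjM conjcK Lop_conj -covJ.
rewrite e; congr cintegral; apply/funext => w.
by rewrite conjM !conjcK.
Qed.

Lemma field_has_adjoint : has_adjoint mu D P h.
Proof.
split; first exact: field_L2P.
  exact: Lop_L2.
move=> F LF; exists (Ladj F); first exact: Ladj_L2.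
split; first by move=> g Lg; exact: Lop_adj.
by apply: filterS field_L2P => t ht Dt; apply: Top_Ladj => //; exact: ht.
Qed.

Lemma mC_cov : Defs.measurableC (D `*` D) (fun p : X * X => cov P h p.1 p.2).
Proof.
apply: (mC_param P (measurableX mD mD) measurableT (k := fun (p : X * X) w => h p.1 w * (h p.2 w)^*%C)).
have mc (pr : X * X -> X) : measurable_fun setT pr -> (forall p, (D `*` D) p -> D (pr p)) ->
    Defs.measurableC ((D `*` D) `*` setT) (fun q : (X * X) * O => h (pr q.1) q.2).
  move=> mpr Dpr; have mq : measurable_fun ((D `*` D) `*` [set: O])
      (fun q : (X * X) * O => (pr q.1, q.2)).
    apply: measurable_funTS; apply/measurable_fun_pairP; split.
      exact: (measurableT_comp mpr measurable_fst).
    exact: measurable_snd.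
  have sub : (fun q : (X * X) * O => (pr q.1, q.2)) @` ((D `*` D) `*` [set: O]) `<=` D `*` [set: O].
    by move=> _ [q [Dq _] <-]; split => //=; exact: Dpr.
  have mDT : measurable (D `*` [set: O]) by exact: measurableX.
  case: mh => m1 m2; split.
    exact: (measurable_comp mDT sub m1 mq).
  exact: (measurable_comp mDT sub m2 mq).
apply: mC_M.
  by apply: (mc fst) => [|p []//]; exact: measurable_fst.
by apply: mC_J; apply: (mc snd) => [|p []//]; exact: measurable_snd.
Qed.

Lemma mC_Top F : L2 mu D F -> Defs.measurableC D (T F).
Proof.
move=> LF; apply: (mC_param mu mD mD (k := fun s t => cov P h s t * F t)).
by apply: (mC_M mC_cov); exact: mC_snd LF.1.
Qed.

Lemma Top_L2 F : L2 mu D F -> L2 mu D (T F).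
Proof.
move=> LF; apply: (L2_ae mD (mC_Top LF) _ (Lop_L2 (Ladj_L2 LF))).
by apply: filterS field_L2P => t ht Dt; rewrite Top_Ladj//; exact: ht.
Qed.

End field.

(** * The Karhunen-Loeve decomposition *)

Section ae_lemmas.
Context {R : realType} {d} {X : measurableType d}.
Variable mu : {measure set X -> \bar R}.

Lemma ae_countable (I : countType) (Q : I -> X -> Prop) :
  (forall i, {ae mu, forall x, Q i x}) -> {ae mu, forall x, forall i, Q i x}.
Proof.
move=> h.
have : {ae mu, forall x, forall n : nat, if @choice.unpickle I n is Some i then Q i x else True}.
  apply: ae_foralln => n; case: (@choice.unpickle I n) => [i|]; first exact: h.
  exact: aeW.
by apply: filterS => x hx i; have := hx (choice.pickle i); rewrite choice.pickleK.
Qed.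

(** The difference is nonnegative with integral zero. *)
Lemma ae_eq_of_integral_eq (D : set X) (f g : X -> \bar R) : measurable D ->
  mu.-integrable D f -> mu.-integrable D g ->
  {ae mu, forall x, D x -> (g x <= f x)%E} ->
  (\int[mu]_(x in D) f x = \int[mu]_(x in D) g x)%E ->
  {ae mu, forall x, D x -> f x = g x}.
Proof.
move=> mD fi gi gf fg; have mf := measurable_int mu fi; have mg := measurable_int mu gi.
have mfg : measurable_fun D (fun x => f x - g x)%E by exact: emeasurable_funB.
have ff := integrable_ae mD fi; have gf' := integrable_ae mD gi.
have : (\int[mu]_(x in D) `|f x - g x| = 0)%E.
  transitivity (\int[mu]_(x in D) (f x - g x))%E.
    apply: ae_eq_integral => //; first exact: measurableT_comp.
    apply: filterS3 gf ff gf' => x h1 h2 h3 Dx.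
    by rewrite gee0_abs// sube_ge0 ?h1// h3 ?orbT.
  rewrite integralB// fg subee//; exact: integrable_fin_num.
move/(ae_eq_integral_abs mu mD mfg); apply: filterS3 ff gf' => x h1 h2 h3 Dx.
have := h3 Dx; move: (h1 Dx) (h2 Dx) => /fineK <- /fineK <-.
by rewrite -EFinB => -[/eqP]; rewrite subr_eq0 => /eqP ->.
Qed.

End ae_lemmas.

Section centering.
Context {R : realType} {d} {X : measurableType d}.
Variables (mu : {sigma_finite_measure set X -> \bar R}) (D : set X).
Context {dO} {O : measurableType dO}.
Variable P : probability O R.
Variable f : X -> O -> R[i].
Local Notation C := R[i].
Hypothesis mD : measurable D.
Hypothesis fN : inN mu D P f.
Local Notation ipP := (L2ip P setT).
Let HP : hilbert_space P setT (L2 P setT) ipP := hilbert_L2 P measurableT.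

Lemma integral_prob_cst (r : R) : (\int[P]_(w in setT) r%:E = r%:E)%E.
Proof. by rewrite integral_cst//= probability_setT mule1. Qed.

Lemma L2_cst (c : C) : L2 P setT (fun=> c).
Proof.
split; first exact: mC_cst.
by rewrite /L2norm2 integral_prob_cst ltry.
Qed.

Lemma L2ip1 g : ipP g (fun=> 1) = cintegral P setT g.
Proof. by rewrite /L2ip; congr cintegral; apply/funext => w; rewrite conjc1 mulr1. Qed.

Lemma nrm1 : nrm ipP (fun=> 1) = 1.
Proof.
rewrite /nrm Re_L2ip /L2norm2; under eq_integral do rewrite sqn1.
by rewrite integral_prob_cst.
Qed.

Lemma centeredE t : centered P f t = f t \- (fun=> mean P f t * 1).
Proof. by apply/funext => w; rewrite /centered /= mulr1. Qed.

Lemma L2_centered t : L2 P setT (f t) -> L2 P setT (centered P f t).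
Proof. by move=> ft; rewrite centeredE; apply: (hilbB HP) => //; exact: L2_cst. Qed.

Lemma centered_mean0 t : L2 P setT (f t) -> cintegral P setT (centered P f t) = 0.
Proof.
move=> ft; have L1 := L2_cst 1.
rewrite -L2ip1 centeredE (ipBl HP)//; last exact: L2_cst.
by rewrite (ipZl HP)// (ip_nrm HP)// nrm1 mulr1 L2ip1 subrr.
Qed.

(** The variance is the second moment minus the squared modulus of the mean. *)
Lemma nrm_centered_le t : L2 P setT (f t) -> nrm ipP (centered P f t) <= nrm ipP (f t).
Proof.
move=> ft; have L1 := L2_cst 1.
rewrite centeredE (nrmBE HP)//; last exact: L2_cst.
rewrite (nrmZ HP)// nrm1 mulr1 (ipZr HP)// L2ip1 -/(mean P f t) [_^*%C * _]mulrC mulJ /=.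
by have := sqn_ge0 (mean P f t); lra.
Qed.

Lemma mC_mean : Defs.measurableC D (mean P f).
Proof. by apply: (mC_param P mD measurableT (k := f)); case: fN. Qed.

Lemma mC_centered : Defs.measurableC (D `*` setT) (fun p : X * O => centered P f p.1 p.2).
Proof.
rewrite (_ : (fun p => _) = (fun p : X * O => f p.1 p.2) \- (fun p => mean P f p.1)); last exact/funext.
by apply: mC_B; [case: fN|exact: mC_fst mC_mean].
Qed.

Lemma centered_inN : inN mu D P (centered P f).
Proof.
split; first exact: mC_centered.
have fN2 := fN.2; rewrite Nnorm2_swap// in fN2.
apply: le_lt_trans fN2; rewrite /Nnorm2.
rewrite -(tonelli_dom mu P mD measurableT (k := fun x w => (sqn (centered P f x w))%:E)); last 2 first.
- exact: (emeasurable_sqn mC_centered).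
- by move=> x w _ _; rewrite lee_fin sqn_ge0.
apply: ae_ge0_le_integral => //.
- by move=> t _; apply: integral_ge0 => w _; rewrite lee_fin sqn_ge0.
- exact: (measurable_normK P mD measurableT mC_centered).
- by move=> t _; apply: integral_ge0 => w _; rewrite lee_fin sqn_ge0.
- by apply: (measurable_normK P mD measurableT (K := f)); case: fN.
apply: filterS (field_L2P mD fN) => t + Dt => /(_ Dt) ft.
rewrite -/(L2norm2 P setT (centered P f t)) -/(L2norm2 P setT (f t)).
by rewrite !L2norm2_nrm// ?lee_fin ?nrm_centered_le//; exact: L2_centered.
Qed.

End centering.

Section measurable_limn.
Context {R : realType} {d} {X : measurableType d}.
Variable D : set X.
Hypothesis mD : measurable D.

(** The limit operator, which takes a default value on divergent sequences,
    preserves measurability because the set of convergence is measurable. *)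
Lemma measurable_limn (v : nat -> X -> R) : (forall n, measurable_fun D (v n)) ->
  measurable_fun D (fun x => limn (v ^~ x)).
Proof.
move=> mv; have mev n : measurable_fun D (fun x => (v n x)%:E) by exact/measurable_EFinP.
pose s x := limn_esup (fun n => (v n x)%:E).
pose i x := limn_einf (fun n => (v n x)%:E).
have ms : measurable_fun D s by exact: measurable_fun_limn_esup.
have mi : measurable_fun D i.
  apply: (emeasurable_fun_cvg (fun n x => einfs (fun k => (v k x)%:E) n)).
    by apply: measurable_fun_einfs.
  by move=> x _; rewrite /i limn_einf_lim; exact: is_cvg_einfs.
have cvgE x : cvgn (v ^~ x) <-> s x = i x /\ s x \is a fin_num.
  split.
    move=> /cvg_ex[l hl].
    have /cvg_limn_einf_sup[e1 e2] : (fun n => (v n x)%:E) @ \oo --> l%:E.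
      by apply: cvg_EFin => //; exact: nearW.
    by rewrite /s /i e1 e2.
  move=> [si sf]; apply/cvg_ex; exists (fine (s x)).
  have sx : (fun n => (v n x)%:E) @ \oo --> (fine (s x))%:E.
    rewrite fineK//; apply: (squeeze_cvge _ (f := einfs (fun n => (v n x)%:E))
        (h := esups (fun n => (v n x)%:E))).
    - apply: nearW => n; apply/andP; split.
        by apply: ereal_inf_lbound; exists n => /=.
      by apply: ereal_sup_ubound; exists n => /=.
    - by rewrite si /i limn_einf_lim; exact: is_cvg_einfs.
    - by rewrite /s limn_esup_lim; exact: is_cvg_esups.
  exact: fine_cvg sx.
have limE x : limn (v ^~ x) = if (s x == i x) && (s x \is a fin_num) then fine (s x) else point.
  case: ifPn => [/andP[/eqP si sf]|h].
    have /cvg_ex[l hl] : cvgn (v ^~ x) by apply/cvgE.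
    have /cvg_limn_einf_sup[_ e2] : (fun n => (v n x)%:E) @ \oo --> l%:E.
      by apply: cvg_EFin => //; exact: nearW.
    by rewrite /s e2 /=; exact/cvg_lim.
  apply: dvgP => /cvgE[si sf].
  by move: h; rewrite si eqxx -si sf.
rewrite (_ : (fun x => _) = (fun x => if (s x == i x) && (s x \is a fin_num) then fine (s x) else point)); last exact/funext.
apply: measurable_fun_if => //.
- apply: measurable_and; first exact: measurable_fun_eqe.
  under eq_fun do rewrite fin_numE.
  by apply: measurable_and; apply: measurable_neg; apply: measurable_fun_eqe => //; exact: measurable_cst.
- apply: (measurable_funS mD) => //.
  exact: (measurableT_comp (@fine_measurable R setT measurableT) ms).
Qed.

End measurable_limn.

Section decomposition.
Context {R : realType} {d} {X : measurableType d}.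
Variables (mu : {sigma_finite_measure set X -> \bar R}) (D : set X).
Context {dO} {O : measurableType dO}.
Variable P : probability O R.
Variable f : X -> O -> R[i].
Local Notation C := R[i].
Hypothesis mD : measurable D.
Hypothesis fN : inN mu D P f.
Context {J : countType}.
Variables (lam : nat -> R) (phi : nat + J -> X -> C).
Local Notation h := (centered P f).
Local Notation T := (Top mu D P h).
Local Notation L := (Lop P h).
Local Notation ip := (L2ip mu D).
Local Notation ipP := (L2ip P setT).
Local Notation ev := (eigval lam).
Local Notation S := (Ssum mu D h lam phi).
Hypothesis KL : KL_basis mu D lam phi T.

Let HH := hilbert_L2 mu mD.
Let HP : hilbert_space P setT (L2 P setT) ipP := hilbert_L2 P measurableT.
Let hN : inN mu D P h := centered_inN mD fN.
Let phi_onb : orthonormal_basis mu D phi. Proof. by case: KL. Qed.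
Let lam_ge0 k : 0 <= lam k. Proof. by case: KL. Qed.
Let lam_dec k : lam k.+1 <= lam k. Proof. by case: KL. Qed.
Let Lphi i : L2 mu D (phi i). Proof. by case: phi_onb. Qed.
Let adj := field_has_adjoint mD hN.

Local Notation coef F k := (ip F (phi (inl (k : nat)))).
Local Notation eta i := (Ladj mu D h (phi i)).
Local Notation etal := (fun k : nat => eta (inl k)).

Let Leta i : L2 P setT (eta i). Proof. exact: (Ladj_L2 mD hN). Qed.

Lemma ip_T_phi i j : ip (T (phi i)) (phi j) = (ev i *+ (i == j))%:C%C.
Proof.
rewrite (T_coef mD adj KL j (Lphi i) (Top_L2 mD hN (Lphi i))); last exact: aeW.
by case: phi_onb => _ -> _; case: eqP => [->|_]; rewrite ?mulr1 ?mulr1n// mulr0 mulr0n.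
Qed.

Lemma ip_eta i j : ipP (eta i) (eta j) = (ev i *+ (i == j))%:C%C.
Proof.
rewrite -(Lop_adj mD hN (Lphi j) (Leta i)) -ip_T_phi; symmetry.
apply: (L2ip_ae mD).
- exact: (mC_Top mD hN).
- exact: (Lop_L2 mD hN (Leta i)).1.
- exact: (Lphi j).1.
- by apply: filterS (field_L2P mD hN) => t ht Dt; apply: (Top_Ladj mD hN) => //; exact: ht.
Qed.

Lemma nrm_eta i : nrm ipP (eta i) = ev i.
Proof. by rewrite /nrm ip_eta eqxx mulr1n. Qed.

Lemma eta_orth i j : i != j -> ipP (etal i) (etal j) = 0.
Proof. by move=> ij; rewrite ip_eta (_ : (inl i == inl j :> nat + J) = false) ?mulr0n//; apply/negbTE. Qed.

Lemma eta_mean0 i : cintegral P setT (eta i) = 0.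
Proof.
have L1 : L2 P setT (fun=> 1 : C) by exact: L2_cst.
rewrite -L2ip1 (ipJ HP L1 (Leta i)) -(Lop_adj mD hN (Lphi i) L1).
rewrite (@L2ip_ae _ _ _ _ _ mD _ (fun=> 0)).
- by rewrite (ip0l HH)// conjc0.
- exact: (Lop_L2 mD hN L1).1.
- exact: mC_cst.
- exact: (Lphi i).1.
apply: filterS (field_L2P mD fN) => t ft Dt.
rewrite /Lop -(centered_mean0 (ft Dt)); congr cintegral.
by apply/funext => w; rewrite mulr1.
Qed.

(** The partial sum S_n(t, .) is the conjugate of a combination of the eta_k. *)
Let cS t k : C := (alpha lam k)%:C%C * (phi (inl k) t)^*%C.

Lemma SsumE n t w : S n t w = (comb (cS t) etal n w)^*%C.
Proof.
rewrite /Ssum /comb conj_sum; apply: eq_bigr => k _.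
rewrite LadjE /cS !conjM !conjcK conjc_real /xi.
have e : (Num.sqrt (lam k))%:C%C * ((Num.sqrt (lam k))^-1)%:C%C = (alpha lam k)%:C%C :> C.
  rewrite -RCM /alpha; case: ifPn => k0; first by rewrite divff// sqrtr_eq0 -ltNge.
  by rewrite ler0_sqrtr ?mul0r// leNgt.
by rewrite -e; ring.
Qed.

Lemma SsumE' n t w : S n t w =
  \sum_(k < n) (alpha lam k)%:C%C * coef (h ^~ w) k * phi (inl (k : nat)) t.
Proof.
rewrite SsumE /comb conj_sum; apply: eq_bigr => k _.
by rewrite LadjE /cS !conjM !conjcK conjc_real; ring.
Qed.

Lemma mC_Ssum n : Defs.measurableC (D `*` setT) (fun p : X * O => S n p.1 p.2).
Proof.
elim: n => [|n ih].
  rewrite (_ : (fun p => _) = fun=> 0); first exact: mC_cst.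
  by apply/funext => p; rewrite /Ssum big_ord0.
rewrite (_ : (fun p => _) = (fun p : X * O => (alpha lam n)%:C%C *
   ((eta (inl n) p.2)^*%C * phi (inl n) p.1) + S n p.1 p.2)); last first.
  by apply/funext => p; rewrite !SsumE' LadjE conjcK big_ord_recr /= addrC mulrA.
apply: mC_lin => //; apply: mC_M.
  by apply: mC_J; exact: mC_snd (Leta _).1.
exact: mC_fst (Lphi _).1.
Qed.

(** The points of D at which every almost everywhere defined object behaves. *)
Definition regular t := [/\ L2 P setT (f t), L2 P setT (h t) &
  forall i, T (phi i) t = (ev i)%:C%C * phi i t].

Lemma ae_regular : {ae mu, forall t, D t -> regular t}.
Proof.
have [_ _ _ Tphi] := KL.
have aT : {ae mu, forall t, forall i, D t -> T (phi i) t = (ev i)%:C%C * phi i t}.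
  by apply: ae_countable => i; exact: Tphi.
by apply: filterS3 (field_L2P mD fN) (field_L2P mD hN) aT => t h1 h2 h3 Dt;
  split; [exact: h1|exact: h2|move=> i; exact: h3].
Qed.

Lemma ip_conj_eta t i : regular t -> ipP (fun w => (h t w)^*%C) (eta i) = (ev i)%:C%C * (phi i t)^*%C.
Proof.
move=> [_ ht Tt].
rewrite -[LHS]conjcK -(ipJ HP (L2J ht) (Leta i)).
rewrite (_ : ipP _ _ = L (eta i) t).
  by rewrite -(Top_Ladj mD hN (Lphi i) ht) Tt conjM conjc_real.
by rewrite /L2ip /Lop; congr cintegral; apply/funext => w; rewrite conjcK mulrC.
Qed.

(** Expansion of the square, with the inner products of the field with the eta_k
    given by the eigenvalue equation T phi_k = lam_k phi_k at the point t. *)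
Lemma nrm_field_sub t n : regular t ->
  nrm ipP ((fun w => (h t w)^*%C) \- comb (cS t) etal n) =
  nrm ipP (h t) - \sum_(k < n) lam k * sqn (phi (inl (k : nat)) t).
Proof.
move=> rt; have [_ ht _] := rt.
rewrite (nrm_sub_comb HP (fun k => Leta (inl k)) eta_orth); last exact: L2J.
rewrite -sumrN; congr (_ + _).
  by rewrite /nrm !Re_L2ip /L2norm2; under eq_integral do rewrite sqnJ.
apply: eq_bigr => k _; rewrite nrm_eta ip_conj_eta// /cS sqnM sqnR sqnJ.
rewrite conjM conjcK conjc_real /=.
rewrite (_ : _ * _ = (alpha lam k * lam k)%:C%C * (phi (inl (k : nat)) t * (phi (inl (k : nat)) t)^*%C)).
  rewrite mulJ -RCM /=; rewrite /alpha; case: ifPn => k0; first by ring.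
  by rewrite (_ : lam k = 0); [ring|apply/eqP; rewrite eq_le lam_ge0 leNgt k0].
by rewrite RCM; ring.
Qed.

Lemma sum_phi_le t n : regular t ->
  \sum_(k < n) lam k * sqn (phi (inl (k : nat)) t) <= nrm ipP (h t).
Proof.
move=> rt; have [_ ht _] := rt; rewrite -subr_ge0 -nrm_field_sub//.
apply: (nrm_ge0 HP); apply: (hilbB HP); first exact: L2J.
exact: (hilb_comb HP _ _ (fun k => Leta (inl k))).
Qed.

Lemma cov_diag t : Re (cov P h t t) = nrm ipP (h t).
Proof. by []. Qed.

(** The residual has the mean of f, since the eta_k are centered, and its variance
    is the squared norm computed in nrm_field_sub. *)
Lemma cvar_residual n t : regular t ->
  cvar P (fun w => f t w - S n t w) =
  (Re (cov P h t t) - \sum_(k < n) lam k * sqn (phi (inl (k : nat)) t))%:E.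
Proof.
move=> rt; have [ft ht _] := rt.
have Lc : L2 P setT (comb (cS t) etal n) by exact: (hilb_comb HP _ _ (fun k => Leta (inl k))).
have L1 : L2 P setT (fun=> 1 : C) by exact: L2_cst.
have m : cintegral P setT (fun w => f t w - S n t w) = mean P f t.
  rewrite -L2ip1 (_ : (fun w => _) = f t \- (fun w => (comb (cS t) etal n w)^*%C)); last first.
    by apply/funext => w; rewrite SsumE.
  rewrite (ipBl HP)//; last exact: L2J.
  rewrite !L2ip1 cintegralJ -[X in _ - X^*%C]L2ip1.
  rewrite (ip_comb_l HP _ _ (fun k => Leta (inl k)) L1) big1 ?conjc0 ?subr0// => k _.
  by rewrite L2ip1 eta_mean0 mulr0.
rewrite cov_diag -nrm_field_sub// -L2norm2_nrm; last by apply: (hilbB HP) => //; exact: L2J.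
rewrite /cvar m; apply: eq_integral => w _; congr EFin.
rewrite -[RHS]sqnJ; congr sqn; rewrite SsumE /= rmorphB /= conjcK /centered.
by ring.
Qed.

(** For almost every sample, h_w is orthogonal to the eigenfunctions of
    eigenvalue zero, since the second moments of its coefficients are the
    eigenvalues. *)
Definition regular_sample w := L2 mu D (h ^~ w) /\ null_orth mu D lam phi (h ^~ w).

Lemma ae_regular_sample : {ae P, forall w, regular_sample w}.
Proof.
have a0 : {ae P, forall w, forall i, ev i = 0 -> eta i w = 0}.
  apply: ae_countable => i; have [i0|i0] := eqVneq (ev i) 0; last first.
    by apply: aeW => w /eqP; rewrite (negbTE i0).
  have := (nrm_eq0 HP (Leta i)).1; rewrite nrm_eta => /(_ i0).
  by apply: filterS => w h1 _; exact: h1.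
apply: filterS2 (field_L2D mD hN) a0 => w h1 h2; split => // i i0.
by have := h2 i i0; rewrite LadjE => /eqP; rewrite conjc_eq0 => /eqP.
Qed.

Lemma coef_alpha w k : regular_sample w ->
  (alpha lam k)%:C%C * coef (h ^~ w) k = coef (h ^~ w) k.
Proof. by move=> [_ oh]; exact: (alphaM lam_ge0). Qed.

Lemma Ssum_sample n w : regular_sample w ->
  S n ^~ w = comb (fun k => coef (h ^~ w) k) (fun k => phi (inl k)) n.
Proof.
move=> rw; apply/funext => t; rewrite SsumE'; apply: eq_bigr => k _.
by rewrite coef_alpha.
Qed.

Lemma norm_residual_sample n w : regular_sample w ->
  (L2norm2 mu D (fun t => (h t w - S n t w)%R) =
   \sum_(n <= k <oo) (sqn (coef (h ^~ w) k))%:E)%E.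
Proof.
move=> rw; have [Lh oh] := rw.
have oe (i j : nat) : i != j -> ip (phi (inl i)) (phi (inl j)) = 0.
  by move=> ij; apply: (phi_orth phi_onb).
rewrite (_ : (fun t => _) = (h ^~ w) \- comb (fun k => coef (h ^~ w) k) (fun k => phi (inl k)) n); last first.
  by rewrite -Ssum_sample.
have Lc := hilb_comb HH (fun k => coef (h ^~ w) k) n (fun k => Lphi (inl k)).
rewrite L2norm2_nrm; last exact: (hilbB HH).
rewrite (nrm_sub_comb HH (fun k => Lphi (inl k)) oe)//.
have s0 k : (0 <= (sqn (coef (h ^~ w) k))%:E)%E by rewrite lee_fin sqn_ge0.
have := @nneseries_split R (fun k => (sqn (coef (h ^~ w) k))%:E) 0 n (fun k _ => s0 k).
rewrite (nneseries_cvg (parseval mD phi_onb Lh (null_orthJ oh))) add0n sumEFin_ord.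
move=> E; rewrite EFinD E.
move: (\big[+%E/0%R]_(n <= k <oo) _)%E => A.
have -> : \sum_(k < n) (sqn (coef (h ^~ w) k) * nrm ip (phi (inl (k : nat))) -
    2 * Re ((coef (h ^~ w) k)^*%C * coef (h ^~ w) k)) = - \sum_(k < n) sqn (coef (h ^~ w) k).
  rewrite -sumrN; apply: eq_bigr => k _.
  by rewrite (nrm_phi phi_onb) mulr1 [_^*%C * _]mulrC mulJ /=; ring.
by rewrite EFinN addeAC subee// add0e.
Qed.

Lemma second_moment k : (\int[P]_w (sqn (coef (h ^~ w) k))%:E = (lam k)%:E)%E.
Proof.
transitivity (L2norm2 P setT (eta (inl k))); last by rewrite L2norm2_nrm// nrm_eta.
by apply: eq_integral => w _; rewrite LadjE sqnJ.
Qed.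

Lemma measurable_sqn_coef k : measurable_fun setT (fun w => (sqn (coef (h ^~ w) k))%:E).
Proof.
have := emeasurable_sqn (Leta (inl k)).1.
by apply: eq_measurable_fun => w _; rewrite LadjE sqnJ.
Qed.

(** Parseval's identity for each sample, integrated term by term. *)
Lemma norm_residual n :
  Nnorm2 mu D P (fun t w => f t w - mean P f t - S n t w) = (\sum_(n <= k <oo) (lam k)%:E)%E.
Proof.
pose u n k w : \bar R := if (n <= k)%N then (sqn (coef (h ^~ w) k))%:E else 0%E.
have mu_ k : measurable_fun setT (u n k).
  by rewrite /u; case: (n <= k)%N; [exact: measurable_sqn_coef|exact: measurable_cst].
have u0 k w : (0 <= u n k w)%E by rewrite /u; case: ifP => _; rewrite ?lee_fin ?sqn_ge0.
rewrite /Nnorm2; transitivity (\int[P]_w (\sum_(0 <= k <oo) u n k w))%E.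
  apply: ae_eq_integral => //.
  - apply: (measurable_normK mu measurableT mD (K := fun w t => f t w - mean P f t - S n t w)).
    exact: (mC_swap mD measurableT (k := fun t w => f t w - mean P f t - S n t w)
      (mC_B (mC_centered mD fN) (mC_Ssum n))).
  - by apply: ge0_emeasurable_sum => // k w _ _.
  - apply: filterS ae_regular_sample => w rw _.
    have := norm_residual_sample n rw; rewrite /L2norm2 /centered => ->.
    by rewrite eseries_cond eseries_mkcond.
rewrite integral_nneseries// [RHS]eseries_cond [RHS]eseries_mkcond.
apply: eq_eseriesr => k _ /=; rewrite /u; case: ifP => _; first exact: second_moment.
by rewrite integral0.
Qed.

Lemma norm_field : (\int[mu]_(t in D) \int[P]_w (sqn (h t w))%:E = \sum_(0 <= k <oo) (lam k)%:E)%E.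
Proof.
rewrite -Nnorm2_swap// -norm_residual; apply: eq_integral => w _.
by apply: eq_integral => t _; rewrite /Ssum big_ord0 subr0.
Qed.

(** By Tonelli's theorem this is the squared norm of h in the space N, that is the
    case n = 0 of norm_residual. *)
Lemma norm_var : (\int[mu]_(t in D) `|cvar P (f t)| = \sum_(0 <= k <oo) (lam k)%:E)%E.
Proof.
rewrite -norm_field; apply: eq_integral => t _.
by rewrite gee0_abs//; apply: integral_ge0 => w _; rewrite lee_fin sqn_ge0.
Qed.

Lemma lam_summable : exists M, forall n, \sum_(k < n) lam k <= M.
Proof.
by apply: nneseries_lty => //; rewrite -norm_field -Nnorm2_swap//; case: hN.
Qed.

Lemma sum_moments n : (\int[P]_w (\sum_(k < n) sqn (coef (h ^~ w) k))%:E =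
  (\sum_(k < n) lam k)%:E)%E.
Proof.
under eq_integral do rewrite -sumEFin.
rewrite ge0_integral_sum//; first last.
- by move=> k w _; rewrite lee_fin sqn_ge0.
- by move=> k; exact: measurable_sqn_coef.
by rewrite -sumEFin; apply: eq_bigr => k _; exact: second_moment.
Qed.

Lemma norm_Ssum n : Nnorm2 mu D P (S n) =
  (\int[P]_w (\sum_(k < n) sqn (coef (h ^~ w) k))%:E)%E.
Proof.
apply: ae_eq_integral => //.
- apply: (measurable_normK mu measurableT mD (K := fun w t => S n t w)).
  exact: (mC_swap mD measurableT (mC_Ssum n)).
- under eq_fun do rewrite -sumEFin.
  by apply: emeasurable_sum => k; exact: measurable_sqn_coef.
apply: filterS ae_regular_sample => w rw _.
have oe (i j : nat) : i != j -> ip (phi (inl i)) (phi (inl j)) = 0.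
  by move=> ij; apply: (phi_orth phi_onb).
have Lc := hilb_comb HH (fun k => coef (h ^~ w) k) n (fun k => Lphi (inl k)).
have := L2norm2_nrm Lc; rewrite -Ssum_sample// /L2norm2 => ->.
rewrite Ssum_sample// (nrm_comb HH (fun k => Lphi (inl k)) oe); congr EFin.
by apply: eq_bigr => k _; rewrite (nrm_phi phi_onb) mulr1.
Qed.

Lemma sum_T_phi n : \sum_(k < n) ip (T (phi (inl (k : nat)))) (phi (inl (k : nat))) =
  (\sum_(k < n) lam k)%:C%C.
Proof.
rewrite (_ : (\sum_(k < n) lam k)%:C%C = \sum_(k < n) (lam k)%:C%C :> C); last exact: rmorph_sum.
by apply: eq_bigr => k _; rewrite ip_T_phi eqxx mulr1n.
Qed.

(** The variance of the field is the sum of the series of eigenfunctions, almost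
    everywhere: the partial sums are below it, and the integrals agree. *)
Lemma ae_variance : {ae mu, forall t, D t ->
  (\int[P]_w (sqn (h t w))%:E = \sum_(0 <= k <oo) (lam k * sqn (phi (inl k) t))%:E)%E}.
Proof.
have s0 k t : (0 <= (lam k * sqn (phi (inl k) t))%:E)%E by rewrite lee_fin mulr_ge0 ?sqn_ge0.
have ms k : measurable_fun D (fun t => (lam k * sqn (phi (inl k) t))%:E).
  apply/measurable_EFinP; apply: measurable_funM; first exact: measurable_cst.
  exact: measurable_sqn (Lphi _).1.
have mB : measurable_fun D (fun t => \sum_(0 <= k <oo) (lam k * sqn (phi (inl k) t))%:E)%E.
  by apply: ge0_emeasurable_sum => // k t _ _; exact: s0.
have mA : measurable_fun D (fun t => \int[P]_w (sqn (h t w))%:E)%E.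
  exact: (measurable_normK P mD measurableT (mC_centered mD fN)).
have iB : (\int[mu]_(t in D) \sum_(0 <= k <oo) (lam k * sqn (phi (inl k) t))%:E =
    \sum_(0 <= k <oo) (lam k)%:E)%E.
  rewrite (integral_nneseries mu mD ms (fun k t _ => s0 k t)).
  apply: eq_eseriesr => k _; under eq_integral do rewrite EFinM.
  rewrite ge0_integralZl_EFin//.
  + by rewrite -/(L2norm2 mu D (phi (inl k))) L2norm2_nrm// (nrm_phi phi_onb) mule1.
  + by move=> t _; rewrite lee_fin sqn_ge0.
  + exact: emeasurable_sqn (Lphi _).1.
have fin : (\sum_(0 <= k <oo) (lam k)%:E < +oo)%E.
  by rewrite -norm_field -Nnorm2_swap//; case: hN.
apply: ae_eq_of_integral_eq => //.
- apply/integrableP; split => //.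
  rewrite (eq_integral (fun t => \int[P]_w (sqn (h t w))%:E)%E) ?norm_field// => t _.
  by rewrite gee0_abs//; apply: integral_ge0 => w _; rewrite lee_fin sqn_ge0.
- apply/integrableP; split => //.
  rewrite (eq_integral (fun t => \sum_(0 <= k <oo) (lam k * sqn (phi (inl k) t))%:E)%E) ?iB// => t _.
  by rewrite gee0_abs//; apply: nneseries_ge0 => k _ _; exact: s0.
- apply: filterS ae_regular => t rt Dt; have [_ ht _] := rt Dt.
  rewrite -/(L2norm2 P setT (h t)) L2norm2_nrm//.
  apply: nneseries_bound => [n|k]; first exact: sum_phi_le (rt Dt).
  by rewrite mulr_ge0 ?sqn_ge0.
- by rewrite norm_field iB.
Qed.

(** One conull set on which all the almost everywhere statements hold; the kernels
    are reproducing pointwise on it. *)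
Lemma regular_set : exists2 E, conull mu D E & forall t, E t ->
  regular t /\ (fun n => \sum_(k < n) lam k * sqn (phi (inl (k : nat)) t)) @ \oo --> nrm ipP (h t).
Proof.
apply: (ae_conull mD); apply: filterS2 ae_regular ae_variance => t rt vt Dt.
split; first exact: rt.
apply: (cvg_nneseries (u := fun k => lam k * sqn (phi (inl k) t))) => [k|]; first by rewrite mulr_ge0 ?sqn_ge0.
rewrite -vt// -L2norm2_nrm//; by have [_ ht _] := rt Dt.
Qed.

Section pointwise.
Variable E : set X.
Hypothesis nE : conull mu D E.
Hypothesis rE : forall t, E t -> regular t /\
  (fun n => \sum_(k < n) lam k * sqn (phi (inl (k : nat)) t)) @ \oo --> nrm ipP (h t).

Lemma KL_hcvg t : E t -> hcvg ipP (comb (cS t) etal) (fun w => (h t w)^*%C).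
Proof.
move=> Et; have [rt c] := rE Et.
have c2 : (fun n => nrm ipP (h t) - \sum_(k < n) lam k * sqn (phi (inl (k : nat)) t)) @ \oo --> (0 : R).
  by have := cvgB (cvg_cst (nrm ipP (h t))) c; rewrite subrr; exact.
by apply: cvg_ext c2 => n; rewrite nrm_field_sub.
Qed.

Lemma cov_series s t : E s -> E t ->
  ccvg (fun n => \sum_(k < n) (lam k)%:C%C * (phi (inl (k : nat)) t * (phi (inl (k : nat)) s)^*%C))
       (cov P h t s).
Proof.
move=> Es Et; have [rs _] := rE Es; have [rt _] := rE Et.
have [_ hs _] := rs; have [_ ht _] := rt.
have -> : cov P h t s = ipP (fun w => (h s w)^*%C) (fun w => (h t w)^*%C).
  by rewrite /cov /L2ip; congr cintegral; apply/funext => w; rewrite conjcK mulrC.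
apply: ccvg_ext (ip_hcvg HP (fun k => Leta (inl k)) (L2J hs) (L2J ht) (KL_hcvg Es)) => n.
apply: eq_bigr => k _; rewrite (ipJ HP (L2J ht) (Leta _)) ip_conj_eta//.
rewrite conjM conjcK conjc_real /cS /=.
rewrite (_ : _ * _ = (alpha lam k * lam k)%:C%C * (phi (inl (k : nat)) t * (phi (inl (k : nat)) s)^*%C)).
  rewrite /alpha; case: ifPn => k0; first by rewrite mul1r.
  by rewrite (_ : lam k = 0) ?mulr0//; apply/eqP; rewrite eq_le lam_ge0 leNgt k0.
by rewrite RCM; ring.
Qed.

Lemma coef_cov s i : E s -> ip (cov P h ^~ s) (phi i) = (ev i)%:C%C * (phi i s)^*%C.
Proof.
move=> Es; have [rs _] := rE Es; have [_ hs _] := rs.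
by rewrite -ip_conj_eta// -(Lop_adj mD hN (Lphi i) (L2J hs)).
Qed.

Lemma weighted_sum_le s j : E s ->
  forall n, \sum_(k < n) lam k ^+ j.+1 * sqn (phi (inl (k : nat)) s) <= lam 0%N ^+ j * nrm ipP (h s).
Proof.
move=> Es n; have [rs _] := rE Es.
have l0 : 0 <= lam 0%N ^+ j by rewrite exprn_ge0.
apply: le_trans (ler_wpM2l l0 (sum_phi_le n rs)).
rewrite mulr_sumr; apply: ler_sum => k _; rewrite exprSr.
move: (sqn_ge0 (phi (inl (k : nat)) s)); move: (sqn _) => q q0.
rewrite -mulrA; apply: ler_wpM2r; first by rewrite mulr_ge0.
by rewrite lerXn2r ?nnegrE// (lam_le0 lam_dec).
Qed.

Lemma rkhs_cov : rkhs_on mu D E (HC mu D lam phi 0) (HCip mu D lam phi 0) (cov P h).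
Proof.
apply: (rkhs_kernel mD phi_onb lam_ge0 lam_dec nE).
- by move=> s Es; have [[_ hs _] _] := rE Es; exact: (Lop_L2 mD hN (L2J hs)).
- by move=> s Es i i0; rewrite coef_cov// i0 mul0r.
- by move=> s k Es; rewrite coef_cov// expr1.
- by move=> s Es; exists (lam 0%N ^+ 0 * nrm ipP (h s)); exact: weighted_sum_le.
- by move=> s t Es Et; apply: ccvg_ext (cov_series Es Et) => n; apply: eq_bigr => k _; rewrite expr1.
Qed.

Lemma Cker_cvg j s t : E s -> E t ->
  ccvg (fun n => \sum_(k < n) (lam k ^+ j.+1)%:C%C * (phi (inl (k : nat)) t * (phi (inl (k : nat)) s)^*%C))
    (Cker lam phi j t s).
Proof.
move=> Es Et.
have [] := @ccvg_summable R (fun k => (lam k ^+ j.+1)%:C%C * (phi (inl k) t * (phi (inl k) s)^*%C))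
  (fun k => lam k ^+ j.+1 * sqn (phi (inl k) t) + lam k ^+ j.+1 * sqn (phi (inl k) s))
  (lam 0%N ^+ j * nrm ipP (h t) + lam 0%N ^+ j * nrm ipP (h s)).
- move=> k; rewrite ReZ normrM ger0_norm ?exprn_ge0// -mulrDr.
  by apply: ler_wpM2l; [exact: exprn_ge0|rewrite -[sqn (phi (inl k) s)]sqnJ norm_Re_le].
- move=> k; rewrite ImZ normrM ger0_norm ?exprn_ge0// -mulrDr.
  by apply: ler_wpM2l; [exact: exprn_ge0|rewrite -[sqn (phi (inl k) s)]sqnJ norm_Im_le].
- by move=> n; rewrite big_split /=; apply: lerD; exact: weighted_sum_le.
by move=> l hl; rewrite /Cker (cseriesE hl).
Qed.

Lemma mC_Cker j s : Defs.measurableC D (Cker lam phi j ^~ s).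
Proof.
have mu_ n : Defs.measurableC D (fun t => \sum_(k < n) (lam k ^+ j.+1)%:C%C *
    (phi (inl (k : nat)) t * (phi (inl (k : nat)) s)^*%C)).
  have := mC_comb (fun k => (lam k ^+ j.+1)%:C%C * (phi (inl k) s)^*%C) n (fun k => (Lphi (inl k)).1).
  congr (Defs.measurableC D); apply/funext => t; apply: eq_bigr => k _.
  by rewrite -mulrA [_^*%C * _]mulrC.
split; rewrite /Cker /cseries /=; apply: measurable_limn => // n.
- have := (mu_ n).1; congr (measurable_fun D); apply/funext => t.
  by rewrite /series /= big_mkord Re_sum.
- have := (mu_ n).2; congr (measurable_fun D); apply/funext => t.
  by rewrite /series /= big_mkord Im_sum.
Qed.

(** The section is the pointwise sum on E of an orthogonal series that converges in
    L^2. Its measurability outside E, where the series may diverge, is mC_Cker. *)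
Lemma Cker_section j s : E s -> [/\ L2 mu D (Cker lam phi j ^~ s),
  null_orth mu D lam phi (Cker lam phi j ^~ s) &
  forall k, coef (Cker lam phi j ^~ s) k = (lam k ^+ j.+1)%:C%C * (phi (inl k) s)^*%C].
Proof.
move=> Es; pose c k := (lam k ^+ j.+1)%:C%C * (phi (inl k) s)^*%C.
have l0 : 0 <= lam 0%N ^+ j.+1 by rewrite exprn_ge0.
have [n|F [LF cF Fk Fj]] := synthesis mD phi_onb (c := c)
    (M := lam 0%N ^+ j.+1 * (lam 0%N ^+ j * nrm ipP (h s))).
  apply: le_trans (ler_wpM2l l0 (weighted_sum_le j Es n)).
  rewrite mulr_sumr; apply: ler_sum => k _; rewrite /c sqnM sqnR sqnJ expr2.
  move: (sqn_ge0 (phi (inl (k : nat)) s)); move: (sqn _) => q q0.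
  rewrite mulrA; apply: ler_wpM2r => //; apply: ler_wpM2r; first by rewrite exprn_ge0.
  by rewrite lerXn2r ?nnegrE// (lam_le0 lam_dec).
have FC : aeq mu D F (Cker lam phi j ^~ s).
  apply: (hcvg_pointwise mD nE _ LF cF).
    by move=> n; exact: (hilb_comb HH _ _ (fun k => Lphi (inl k))).
  move=> t Et; apply: ccvg_ext (Cker_cvg j Es Et) => n; apply: eq_bigr => k _.
  by rewrite /c -mulrA [_^*%C * _]mulrC.
have ipE i : ip (Cker lam phi j ^~ s) (phi i) = ip F (phi i).
  symmetry; apply: (L2ip_ae mD) => //; [exact: LF.1|exact: mC_Cker|exact: (Lphi i).1].
split; first exact: (L2_ae mD (mC_Cker j s) FC LF).
  by move=> [k|q] i0; rewrite ipE ?Fj// Fk /c (_ : lam k = 0)// exprS !mul0r.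
by move=> k; rewrite ipE Fk.
Qed.

Lemma rkhs_Cker j : rkhs_on mu D E (HC mu D lam phi j) (HCip mu D lam phi j) (Cker lam phi j).
Proof.
apply: (rkhs_kernel mD phi_onb lam_ge0 lam_dec nE).
- by move=> s /(Cker_section j)[].
- by move=> s /(Cker_section j)[].
- by move=> s k /(Cker_section j)[].
- by move=> s Es; exists (lam 0%N ^+ j * nrm ipP (h s)); exact: weighted_sum_le.
- by move=> s t Es Et; exact: Cker_cvg.
Qed.

Lemma cov_dense : closure_in (HC mu D lam phi 0) (HCnorm2 mu D lam phi 0)
  (lin_span [set cov P h ^~ s | s in E]) = HC mu D lam phi 0.
Proof.
apply/seteqP; split => F; first by case.
move=> HF; split => // eps e0.
have [G SG [HG FG]] := rkhs_dense mD nE rkhs_cov HF e0.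
exists G => //; rewrite (HCnorm2_nrm lam_ge0) ?lte_fin//.
exact: (HC_B mD phi_onb lam_ge0).
Qed.

End pointwise.

End decomposition.

(** * Optimality of the Karhunen-Loeve basis, and the finite case *)

(** Once lam n is subtracted from lam, the terms of index below n are nonnegative
    and the others nonpositive, so that the sum increases when the weights of
    the former are replaced by 1 and those of the latter by 0. *)
Lemma rearrangement (R : realType) (lam w : nat -> R) n m :
  (forall k, 0 <= lam k) -> (forall k, lam k.+1 <= lam k) ->
  (forall k, 0 <= w k <= 1) -> \sum_(k < m) w k <= n%:R ->
  \sum_(k < m) lam k * w k <= \sum_(k < n) lam k.
Proof.
move=> lam0 lamd w01 sw.
pose b k := if (k < n)%N then lam k - lam n else 0.
have b0 k : 0 <= b k.
  rewrite /b; case: ifP => // kn; rewrite subr_ge0.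
  by apply: lam_le => //; exact: ltnW.
have bw k : (lam k - lam n) * w k <= b k.
  have /andP[w0 w1] := w01 k; rewrite /b; case: ltnP => kn.
    rewrite -[leRHS]mulr1; apply: ler_wpM2l => //; rewrite subr_ge0.
    by apply: lam_le => //; exact: ltnW.
  by apply: mulr_le0_ge0 => //; rewrite subr_le0; exact: lam_le.
have sb : \sum_(k < m) b k <= \sum_(k < n) (lam k - lam n).
  have -> : \sum_(k < n) (lam k - lam n) = \sum_(k < n + m) b k.
    rewrite big_split_ord /= [X in _ = _ + X]big1 ?addr0 => [|k _]; last first.
      by rewrite /b ltnNge leq_addr.
    by apply: eq_bigr => k _; rewrite /b ltn_ord.
  rewrite addnC big_split_ord /= lerDl; apply: sumr_ge0 => k _; exact: b0.
have -> : \sum_(k < m) lam k * w k = \sum_(k < m) (lam k - lam n) * w k + lam n * \sum_(k < m) w k.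
  rewrite mulr_sumr -big_split; apply: eq_bigr => k _ /=; ring.
have -> : \sum_(k < n) lam k = \sum_(k < n) (lam k - lam n) + lam n * n%:R.
  by rewrite sumrB sumr_const card_ord mulr_natr subrK.
apply: lerD; last exact: ler_wpM2l.
by apply: le_trans sb; apply: ler_sum => k _; exact: bw.
Qed.

Section consequences.
Context {R : realType} {d} {X : measurableType d}.
Variables (mu : {sigma_finite_measure set X -> \bar R}) (D : set X).
Context {dO} {O : measurableType dO}.
Variable P : probability O R.
Variable f : X -> O -> R[i].
Local Notation C := R[i].
Hypothesis mD : measurable D.
Hypothesis fN : inN mu D P f.
Context {J : countType}.
Variables (lam : nat -> R) (phi : nat + J -> X -> C).
Local Notation h := (centered P f).
Local Notation T := (Top mu D P h).
Local Notation ip := (L2ip mu D).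
Hypothesis KL : KL_basis mu D lam phi T.

Let HH := hilbert_L2 mu mD.
Let hN : inN mu D P h := centered_inN mD fN.
Let phi_onb : orthonormal_basis mu D phi. Proof. by case: KL. Qed.
Let lam_ge0 k : 0 <= lam k. Proof. by case: KL. Qed.
Let lam_dec k : lam k.+1 <= lam k. Proof. by case: KL. Qed.
Let Lphi i : L2 mu D (phi i). Proof. by case: phi_onb. Qed.
Let adj := field_has_adjoint mD hN.

Local Notation coef F k := (ip F (phi (inl (k : nat)))).

Lemma ip_T_cvg F : L2 mu D F ->
  ccvg (fun n => (\sum_(k < n) lam k * sqn (coef F k))%:C%C) (ip (T F) F).
Proof.
move=> LF; have LT := Top_L2 mD hN LF.
have TT : aeq mu D (T F) (T F) by apply: aeW.
have oT := T_null mD adj KL LF LT TT.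
apply: ccvg_ext (ip_hcvg HH (fun k => Lphi (inl k)) LT LF (expansion mD phi_onb LT (null_orthJ oT))) => n.
rewrite rmorph_sum; apply: eq_bigr => k _.
rewrite (T_coef mD adj KL (inl (k : nat)) LF LT TT) (ipJ HH LF (Lphi _)) -mulrA mulJ.
by rewrite -RCM.
Qed.

(** The left-hand side is the sum of the lam_k with weights w_k, the squared norms
    of the projections of phi_k on the span of psi_0, ..., psi_(n-1): each is at
    most 1, and their sum is at most n, by Bessel's inequality. *)
Lemma KL_optimal (psi : nat -> X -> C) n : orthonormal_basis mu D psi ->
  \sum_(k < n) ip (T (psi k)) (psi k) <=
  \sum_(k < n) ip (T (phi (inl (k : nat)))) (phi (inl (k : nat))).
Proof.
move=> psi_onb; rewrite (sum_T_phi mD fN KL).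
have [Lpsi opsi _] := psi_onb.
have oe (i j : nat) : i != j -> ip (psi i) (psi j) = 0 by move=> ij; rewrite opsi (negbTE ij).
have npsi i : nrm ip (psi i) = 1 by rewrite /nrm opsi eqxx.
pose u m := \sum_(i < n) \sum_(k < m) lam k * sqn (coef (psi i) k).
have cu : ccvg (fun m => (u m)%:C%C) (\sum_(i < n) ip (T (psi i)) (psi i)).
  have cu_ N : ccvg (fun m => (\sum_(i < N) \sum_(k < m) lam k * sqn (coef (psi i) k))%:C%C)
      (\sum_(i < N) ip (T (psi i)) (psi i)).
    elim: N => [|N ih].
      rewrite big_ord0 (_ : (fun m => _) = fun=> 0); first by split; exact: cvg_cst.
      by apply/funext => m; rewrite big_ord0.
    rewrite big_ord_recr /=; apply: ccvg_ext (ccvgD ih (ip_T_cvg (Lpsi N))) => m.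
    by rewrite big_ord_recr /= -rmorphD.
  exact: cu_.
have uM m : u m <= \sum_(k < n) lam k.
  pose w k := \sum_(i < n) sqn (coef (psi i) k).
  have -> : u m = \sum_(k < m) lam k * w k.
    rewrite /u exchange_big; apply: eq_bigr => k _.
    by rewrite /w mulr_sumr.
  apply: rearrangement => // [k|].
    rewrite sumr_ge0 => [|i _]; last exact: sqn_ge0.
    have := bessel HH Lpsi oe (fun=> 1) n (Lphi (inl k)).
    rewrite (nrm_phi phi_onb); apply: le_trans; apply: ler_sum => i _.
    rewrite npsi (ipJ HH (Lphi _) (Lpsi _)) sqnJ (_ : 2 * 1 - 1 ^+ 2 * 1 = 1 :> R) ?mulr1//.
    by ring.
  rewrite exchange_big /= (_ : n%:R = \sum_(i < n) 1); last by rewrite sumr_const card_ord.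
  apply: ler_sum => i _; rewrite -(npsi i); exact: (bessel_phi mD phi_onb).
case: cu => cRe cIm; rewrite lecE; apply/andP; split.
  by apply/eqP/esym; apply: (cvg_unique _ cIm) => //=; exact: cvg_cst.
exact: lim_le_bound uM cRe.
Qed.

Lemma finite_eigenvaluesP : finite_set [set k | lam k != 0] <-> exists N, lam N = 0.
Proof.
split => [fs|[N N0]].
  apply: contrapT => h; apply: infinite_nat; apply: sub_finite_set fs => k _ /=.
  by apply/eqP => k0; apply: h; exists k.
apply: (@sub_finite_set _ _ `I_N); last exact: finite_II.
move=> k /= k0; rewrite ltnNge; apply/negP => Nk; case/negP: k0.
by rewrite eq_le lam_ge0 -N0 (lam_le lam_dec Nk).
Qed.

Lemma finite_HC N j F : lam N = 0 -> L2 mu D F -> null_orth mu D lam phi F ->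
  HC mu D lam phi j F.
Proof.
move=> N0 LF oF; apply/(HCP mu D phi lam_ge0); split => //.
have w0 k : 0 <= wt lam j k by exact: (wt_ge0 lam_ge0).
pose W := \sum_(k < N) wt lam j k.
have W0 : 0 <= W by apply: sumr_ge0.
have wW k : wt lam j k <= W.
  have [kN|Nk] := ltnP k N.
    by rewrite /W (bigD1 (Ordinal kN))//= lerDl sumr_ge0.
  rewrite (_ : wt lam j k = 0)// /wt /alpha ifF ?mul0r//.
  by apply/negbTE; rewrite -leNgt -N0 (lam_le lam_dec Nk).
exists (W * nrm ip F) => n.
apply: le_trans (ler_wpM2l W0 (bessel_phi mD phi_onb n LF)).
by rewrite mulr_sumr; apply: ler_sum => k _; rewrite ler_wpM2r ?sqn_ge0.
Qed.

Lemma sample_HC : finite_set [set k | lam k != 0] ->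
  {ae P, forall w, HC mu D lam phi 0 (h ^~ w)}.
Proof.
move=> /finite_eigenvaluesP[N N0].
apply: filterS (ae_regular_sample mD fN KL) => w [Lh oh].
exact: finite_HC N0 Lh oh.
Qed.

Lemma RT_bound F : RT mu D P h F ->
  (HCnorm2 mu D lam phi 0 F <= (lam 0%N)%:E * HCnorm2 mu D lam phi 1 F)%E.
Proof.
rewrite (RT_eq_HC mD adj KL); exact: (HCnorm2_0_le1 lam_ge0 lam_dec).
Qed.

Lemma HC_bound F : HC mu D lam phi 0 F ->
  (L2norm2 mu D F <= (lam 0%N)%:E * HCnorm2 mu D lam phi 0 F)%E.
Proof.
move=> HF; rewrite L2norm2_nrm; last exact: HC_L2 HF.
rewrite (HCnorm2_nrm lam_ge0 HF) -EFinM lee_fin -{1}(expr1 (lam 0%N)).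
exact: (nrm_le_HC mD phi_onb lam_ge0 lam_dec).
Qed.

(** If all the eigenvalues are positive, the function with coefficients sqrt(lam_k) is in L^2 but not in H_C. *)
Lemma RT_full : (RT mu D P h = HC mu D lam phi 0 /\
    HC mu D lam phi 0 = mod_null mu D lam phi (L2 mu D)) <->
  finite_set [set k | lam k != 0].
Proof.
rewrite finite_eigenvaluesP (RT_eq_HC mD adj KL); split; last first.
  move=> [N N0]; have full j : HC mu D lam phi j = mod_null mu D lam phi (L2 mu D).
    apply/seteqP; split => F.
      by move=> HF; split; [exact: HC_L2 HF|exact: HC_null HF].
    by move=> [LF oF]; exact: finite_HC N0 LF oF.
  by rewrite !full.
move=> [_ HL]; apply: contrapT => nz.
have lp k : 0 < lam k.
  by rewrite lt_def lam_ge0 andbT; apply/eqP => k0; apply: nz; exists k.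
have [M hM] := lam_summable mD fN KL.
have [n|F [LF _ Fk Fj]] := synthesis mD phi_onb (c := fun k => (Num.sqrt (lam k))%:C%C) (M := M).
  by apply: le_trans (hM n); apply: ler_sum => k _; rewrite sqnR sqr_sqrtr.
have : mod_null mu D lam phi (L2 mu D) F.
  by split => // -[k|q] /=; [move=> k0; have := lp k; rewrite k0 ltxx|rewrite Fj].
rewrite -HL => /(HCP mu D phi lam_ge0)[_ _ [N hN']].
have term k : wt lam 0 k * sqn (coef F k) = 1.
  by rewrite Fk sqnR sqr_sqrtr// -[X in _ * X]expr1 (wtM lam 0) /alpha lp.
have := hN' (Num.truncn `|N|).+1.
under eq_bigr do rewrite term.
rewrite sumr_const card_ord => h1.
have := truncnS_gt `|N|; rewrite ltNge => /negP; apply.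
by apply: le_trans h1 _; exact: ler_norm.
Qed.

End consequences.

(** * Compact subsets of a Euclidean space are measurable *)

Section compact_measurable.
Context {R : realType} {n : nat}.
Variable D : set (Rn R n).

Local Notation row x := (\row_i tnth x i : 'rV[R]_n).

Lemma rV_hausdorff : hausdorff_space 'rV[R]_n.
Proof.
rewrite ball_hausdorff => a b ab.
have [j abj] : exists j, a ord0 j != b ord0 j.
  apply: contrapT => h; case/eqP: ab; apply/matrixP => i j.
  by rewrite (ord1 i); apply/eqP; apply: contrapT => /negP abj; apply: h; exists j.
have e0 : 0 < `|a ord0 j - b ord0 j| / 2 by rewrite divr_gt0// normr_gt0 subr_eq0.
exists (PosNum e0, PosNum e0) => /=; apply/eqP/seteqP; split => // c [[_ /(_ ord0 j) ac] [_ /(_ ord0 j) bc]].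
move: ac bc; rewrite -ball_normE /= => ac bc.
have := ler_normB (a ord0 j - c ord0 j) (b ord0 j - c ord0 j).
by rewrite opprB addrA subrK; lra.
Qed.

Lemma measurable_ball_tuple (a : 'rV[R]_n) (e : R) : 0 < e ->
  measurable [set t : Rn R n | ball a e (row t)].
Proof.
move=> e0.
rewrite (_ : [set t | _] = \bigcap_(j in [set: 'I_n]) ((fun t : Rn R n => tnth t j) @^-1` ball (a ord0 j) e)).
  apply: fin_bigcap_measurable => // j _; rewrite -[X in measurable X]setTI.
  by apply: (measurable_tnth j) => //; exact: measurable_ball.
apply/seteqP; split => t /=.
  by move=> [_ h] j _ /=; have := h ord0 j; rewrite mxE.
by move=> h; split => // i j; rewrite (ord1 i) mxE; exact: h.
Qed.

(** A compact set is closed, so it is the intersection over k of finite unions of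
    balls of radius 1 / (k + 1) centered in it. The balls are products of
    intervals, hence measurable. *)
Lemma compact_measurable_tuple : compact [set \row_i tnth x i | x in D] -> measurable D.
Proof.
set K := (X in compact X) => cK.
have clK : closed K by apply: compact_closed => //; exact: rV_hausdorff.
have e0 k : 0 < (k.+1%:R^-1 : R) by rewrite invr_gt0.
have /choice[F hF] k : exists G : {fset 'rV[R]_n}, {subset G <= K} /\
    K `<=` \bigcup_(a in [set` G]) ball a (k.+1%:R^-1).
  move: cK; rewrite compact_cover => /(_ _ K (fun a => (ball a (k.+1%:R^-1))^°)) [].
  - by move=> a _; exact: open_interior.
  - by move=> a Ka; exists a => //; apply: nbhsx_ballx.
  - by move=> G GK KG; exists G; split => // x /KG[a Ga /interior_subset xa]; exists a.
have -> : D = \bigcap_k \bigcup_(a in [set` F k]) [set t : Rn R n | ball a (k.+1%:R^-1) (row t)].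
  apply/seteqP; split => t.
    move=> Dt k _; have Kt : K (row t) by exists t.
    by have [a Fa h] := (hF k).2 _ Kt; exists a.
  move=> ht; suff : K (row t).
    move=> [t' Dt' tt']; suff -> : t = t' by [].
    by apply: eq_from_tnth => i; move/matrixP: tt' => /(_ ord0 i); rewrite !mxE.
  apply: clK => B /nbhs_ballP[e /= eg0 eB].
  have /cvgrPdist_lt/(_ _ eg0)[k _ hk] := @cvg_harmonic R.
  have [a Fa at_] := ht k I; exists a; split; first by have := (hF k).1 a Fa; rewrite inE.
  apply: eB; apply: ball_sym; apply: le_ball at_.
  have := hk k (leqnn k); rewrite /= /harmonic sub0r normrN ger0_norm ?invr_ge0// => /ltW; exact.
apply: bigcapT_measurable => k; apply: fin_bigcup_measurable => // a _.
exact: measurable_ball_tuple.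
Qed.

End compact_measurable.

(** * Fields with an orthogonal expansion *)

Section pointwise_sums.
Context {R : realType} {d} {X : measurableType d}.
Local Notation C := R[i].
Variables (mu : {measure set X -> \bar R}) (D : set X).
Hypothesis mD : measurable D.
Let HD := hilbert_L2 mu mD.

(** G is the Riesz-Fischer limit, because limits in L^2 and pointwise agree. *)
Lemma comb_pointwise (e : nat -> X -> C) (c : nat -> C) (M : R) (G : X -> C) : (forall k, L2 mu D (e k)) ->
  (forall i j : nat, i != j -> L2ip mu D (e i) (e j) = 0) ->
  (forall n, \sum_(k < n) sqn (c k) * nrm (L2ip mu D) (e k) <= M) ->
  (forall x, D x -> ccvg (comb c e ^~ x) (G x)) ->
  L2 mu D G /\ hcvg (L2ip mu D) (comb c e) G.
Proof.
move=> Le oe cM cG; have [F LF cF] := riesz_fischer HD Le oe cM.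
have Lcomb n : L2 mu D (comb c e n) by exact: (hilb_comb HD).
have nDD : conull mu D D by split => //; rewrite setDv measure0.
have FG : aeq mu D F G by exact: (hcvg_pointwise mD nDD Lcomb LF cF cG).
have mG : Defs.measurableC D G by exact: mC_cvg (fun n => (Lcomb n).1) cG.
have LG := L2_ae mD mG FG LF; split => //.
rewrite /hcvg; apply: cvg_ext cF => n; rewrite /nrm !Re_L2ip; congr fine.
apply: L2norm2_ae => //; first exact: (hilbB HD LF (Lcomb n)).1.
  exact: (hilbB HD LG (Lcomb n)).1.
by apply: filterS FG => x FGx Dx /=; rewrite FGx.
Qed.

End pointwise_sums.

(** The conjugates of the samples of h expand over an orthonormal sequence e of
    random variables, with orthogonal coefficient functions b.  The series need
    not converge in the space of square integrable fields: only the norms of the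
    functions b k are bounded, which makes L bounded with adjoint
    F |-> sum <F, b k> e k. *)
Section orthogonal_field.
Context {R : realType} {d} {X : measurableType d}.
Local Notation C := R[i].
Variables (mu : {measure set X -> \bar R}) (D : set X).
Context {dO} {O : measurableType dO}.
Variable P : probability O R.
Variables (h : X -> O -> C) (b : nat -> X -> C) (e : nat -> O -> C) (W : R).
Hypothesis mD : measurable D.
Local Notation ipD := (L2ip mu D).
Local Notation ipP := (L2ip P setT).
Hypothesis Le : forall k, L2 P setT (e k).
Hypothesis one : forall i j, ipP (e i) (e j) = (i == j)%:R.
Hypothesis Lb : forall k, L2 mu D (b k).
Hypothesis ob : forall i j : nat, i != j -> ipD (b i) (b j) = 0.
Hypothesis b_gt0 : forall k, 0 < nrm ipD (b k).
Hypothesis b_le : forall k, nrm ipD (b k) <= W.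
Hypothesis Lh : forall t, D t -> L2 P setT (h t).
Hypothesis h_expand : forall t, D t ->
  hcvg ipP (comb (fun k => (b k t)^*%C) e) (fun w => (h t w)^*%C).

Let HP := hilbert_L2 P measurableT.
Let HD := hilbert_L2 mu mD.
Let oe (i j : nat) : i != j -> ipP (e i) (e j) = 0.
Proof. by move=> /negbTE ij; rewrite one ij. Qed.
Let nrm1 k : nrm ipP (e k) = 1.
Proof. by rewrite /nrm one eqxx. Qed.
Let W0 : 0 < W. Proof. exact: lt_le_trans (b_gt0 0%N) (b_le 0%N). Qed.
Let LhJ t : D t -> L2 P setT (fun w => (h t w)^*%C).
Proof. by move=> Dt; apply: L2J; exact: Lh. Qed.

Lemma bessel_noise g n : L2 P setT g -> \sum_(k < n) sqn (ipP g (e k)) <= nrm ipP g.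
Proof.
move=> Lg; apply: le_trans (bessel HP Le oe (fun=> 1) n Lg).
by apply: ler_sum => k _; rewrite nrm1 expr1n !mulr1 (_ : 2 - 1 = 1) ?mulr1//; lra.
Qed.

Lemma ip_noise c g : L2 P setT g -> hcvg ipP (comb c e) g -> forall k, ipP g (e k) = c k.
Proof. by move=> Lg cg k; rewrite (ip_hcvg_comb HP Le oe Lg cg) nrm1 mulr1. Qed.

Lemma Lop_ip g t : Lop P h g t = ipP g (fun w => (h t w)^*%C).
Proof.
rewrite /Lop /L2ip; congr cintegral; apply/funext => w.
by rewrite conjcK mulrC.
Qed.

Lemma ip_sample t k : D t -> ipP (fun w => (h t w)^*%C) (e k) = (b k t)^*%C.
Proof. by move=> Dt; rewrite (ip_noise (LhJ Dt) (h_expand Dt)). Qed.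

Lemma Lop_cvg g t : D t -> L2 P setT g ->
  ccvg (fun n => \sum_(k < n) ipP g (e k) * b k t) (Lop P h g t).
Proof.
move=> Dt Lg; rewrite Lop_ip -(conjcK (ipP g _)) -(ipJ HP Lg (LhJ Dt)).
have := ccvgJ (ip_hcvg HP Le (LhJ Dt) Lg (h_expand Dt)).
apply: ccvg_ext => n; rewrite conj_sum; apply: eq_bigr => k _.
by rewrite conjM conjcK -(ipJ HP (Le k) Lg) mulrC.
Qed.

Lemma cov_cvg s t : D s -> D t ->
  ccvg (fun n => \sum_(k < n) (b k t)^*%C * b k s) (cov P h s t).
Proof.
move=> Ds Dt; have := Lop_cvg Ds (LhJ Dt).
by apply: ccvg_ext => n; apply: eq_bigr => k _; rewrite ip_sample.
Qed.

Lemma sum_field (c : nat -> C) (M : R) (G : X -> C) : (forall n, \sum_(k < n) sqn (c k) <= M) ->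
  (forall t, D t -> ccvg (fun n => \sum_(k < n) c k * b k t) (G t)) ->
  [/\ L2 mu D G, forall k, ipD G (b k) = c k * (nrm ipD (b k))%:C%C &
      forall F, L2 mu D F -> ccvg (fun n => \sum_(k < n) c k * ipD (b k) F) (ipD G F)].
Proof.
move=> cM cG.
have [n|LG cvG] := @comb_pointwise _ _ _ mu D mD b c (W * M) G Lb ob _ cG.
  apply: (@le_trans _ _ (\sum_(k < n) W * sqn (c k))).
    by apply: ler_sum => k _; rewrite [leRHS]mulrC ler_wpM2l// sqn_ge0.
  by rewrite -mulr_sumr ler_wpM2l// ltW.
split => // [k|F LF]; first exact: (ip_hcvg_comb HD Lb ob LG cvG).
exact: (ip_hcvg HD Lb LG LF cvG).
Qed.

Lemma Lop_field g : L2 P setT g ->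
  [/\ L2 mu D (Lop P h g),
      forall k, ipD (Lop P h g) (b k) = ipP g (e k) * (nrm ipD (b k))%:C%C &
      forall F, L2 mu D F ->
        ccvg (fun n => \sum_(k < n) ipP g (e k) * ipD (b k) F) (ipD (Lop P h g) F)].
Proof.
move=> Lg; apply: (sum_field (M := nrm ipP g)) => [n|t Dt]; first exact: bessel_noise.
exact: Lop_cvg.
Qed.

Lemma noise_sum (c : nat -> C) (M : R) : (forall n, \sum_(k < n) sqn (c k) <= M) ->
  exists2 g, L2 P setT g & hcvg ipP (comb c e) g.
Proof.
move=> cM; apply: (riesz_fischer HP Le oe (M := M)) => n.
by under eq_bigr do rewrite nrm1 mulr1; exact: cM.
Qed.

(** Bessel's inequality with the weight 1 / W, available since nrm (b k) <= W. *)
Lemma bessel_coef F n : L2 mu D F -> \sum_(k < n) sqn (ipD F (b k)) <= W * nrm ipD F.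
Proof.
move=> LF; have := bessel HD Lb ob (fun=> W^-1) n LF.
rewrite -(ler_pM2l W0); apply: le_trans; rewrite mulr_sumr; apply: ler_sum => k _.
rewrite mulrCA ler_peMr ?sqn_ge0// mulrBr mulrCA mulfV ?gt_eqF// mulr1.
rewrite expr2 !mulrA mulfV ?gt_eqF// mul1r.
have : W^-1 * nrm ipD (b k) <= 1 by rewrite mulrC ler_pdivrMr// mul1r.
lra.
Qed.

(** The adjoint is F |-> sum <F, b k> e k, a convergent sum by bessel_coef. Both
    requirements on it follow by expanding over e and b. *)
Lemma orthogonal_has_adjoint : has_adjoint mu D P h.
Proof.
split.
- exact: aeW.
- by move=> g Lg; have [] := Lop_field Lg.
move=> F LF; pose c k := ipD F (b k).
have [eta Leta ceta] := noise_sum (c := c) (fun n => bessel_coef n LF).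
exists eta => //; split.
  move=> g Lg; have [_ _ /(_ F LF) cg] := Lop_field Lg.
  apply: (ccvg_unique cg).
  rewrite (ipJ HP Leta Lg).
  have := ccvgJ (ip_hcvg HP Le Leta Lg ceta).
  apply: ccvg_ext => n; rewrite conj_sum; apply: eq_bigr => k _.
  by rewrite conjM -(ipJ HD LF (Lb k)) -(ipJ HP (Le k) Lg) mulrC.
apply: aeW => s Ds.
have [] := @sum_field (fun k => (b k s)^*%C) (nrm ipP (fun w => (h s w)^*%C))
    (fun t => (cov P h s t)^*%C) => [n|t Dt|_ _ /(_ F LF) cs].
- have := bessel_noise n (LhJ Ds); apply: le_trans.
  by apply: ler_sum => k _; rewrite ip_sample.
- have := ccvgJ (cov_cvg Ds Dt); apply: ccvg_ext => n; rewrite conj_sum.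
  by apply: eq_bigr => k _; rewrite conjM conjcK mulrC.
have TE : Top mu D P h F s = (ipD (fun t => (cov P h s t)^*%C) F)^*%C.
  rewrite /Top /L2ip -cintegralJ; congr cintegral; apply/funext => t.
  by rewrite conjM !conjcK.
rewrite TE; apply: (ccvg_unique (ccvgJ cs)).
have := Lop_cvg Ds Leta; apply: ccvg_ext => n; rewrite conj_sum; apply: eq_bigr => k _.
by rewrite conjM conjcK (ip_noise Leta ceta) -(ipJ HD (Lb k) LF) mulrC.
Qed.

(** The element of R(L) with coefficients c over the functions b. *)
Definition synth (c : nat -> C) (t : X) : C := cseries (fun k => c k * b k t).

Definition sq_summable (c : nat -> C) := (\sum_(0 <= k <oo) (sqn (c k))%:E < +oo)%E.

(** The preimage of synth c is sum c k e k; it is orthogonal to the kernel of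
    L since a random variable in the kernel is orthogonal to every e k. *)
Lemma synth_lift c : sq_summable c -> exists g,
  [/\ L2 P setT g, forall t, D t -> Lop P h g t = synth c t,
      forall k, ipP g (e k) = c k & forall g', L2 P setT g' ->
        ccvg (fun n => \sum_(k < n) c k * (ipP g' (e k))^*%C) (ipP g g')].
Proof.
move=> /(nneseries_lty (fun k => sqn_ge0 (c k)))[M cM].
have [g Lg cg] := noise_sum cM; exists g; split => //.
- move=> t Dt; rewrite /synth; apply/esym/cseriesE; have := Lop_cvg Dt Lg.
  by apply: ccvg_ext => n; apply: eq_bigr => k _; rewrite (ip_noise Lg cg).
- exact: (ip_noise Lg cg).
- move=> g' Lg'; have := ip_hcvg HP Le Lg Lg' cg.
  by apply: ccvg_ext => n; apply: eq_bigr => k _; rewrite -(ipJ HP Lg' (Le k)).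
Qed.

Lemma kerL_noise g k : kerL mu D P h g -> ipP g (e k) = 0.
Proof.
move=> [Lg g0]; have [LLg /(_ k) gk _] := Lop_field Lg.
move: gk; rewrite (L2ip_ae mD LLg.1 (mC_cst _ _) (Lb k).1 g0).
rewrite (ip0l HD (Lb k)) => /esym/eqP; rewrite mulf_eq0 => /orP[/eqP//|].
by move=> /eqP/(congr1 (@Re _)) bk; move: (b_gt0 k); rewrite [nrm _ _]bk ltxx.
Qed.

Lemma HKip_synth c c' F F' : sq_summable c -> sq_summable c' ->
  (forall t, D t -> F t = synth c t) -> (forall t, D t -> F' t = synth c' t) ->
  HKip mu D P h F F' = cseries (fun k => c k * (c' k)^*%C).
Proof.
move=> sc sc' FE FE'.
have [g [Lg gE gc gip]] := synth_lift sc; have [g' [Lg' gE' gc' gip']] := synth_lift sc'.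
rewrite (HKip_lift orthogonal_has_adjoint (gF := g) (gG := g')).
- rewrite [RHS](@cseriesE _ _ (ipP g g'))//; have := gip _ Lg'.
  by apply: ccvg_ext => n; apply: eq_bigr => k _; rewrite gc'.
- split => //; first by apply: aeW => t Dt; rewrite gE// FE.
  move=> g0 kg0; apply: ccvg_unique (gip _ kg0.1) _.
  apply: (@ccvg_ext _ (fun=> 0)) => [n|]; last by split; exact: cvg_cst.
  by rewrite big1// => k _; rewrite (kerL_noise _ kg0) conjc0 mulr0.
- split => //; first by apply: aeW => t Dt; rewrite gE'// FE'.
  move=> g0 kg0; apply: ccvg_unique (gip' _ kg0.1) _.
  apply: (@ccvg_ext _ (fun=> 0)) => [n|]; last by split; exact: cvg_cst.
  by rewrite big1// => k _; rewrite (kerL_noise _ kg0) conjc0 mulr0.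
Qed.

Lemma RL_synth G : RL mu D P h G <->
  L2 mu D G /\ exists2 c, sq_summable c & aeq mu D G (synth c).
Proof.
split=> [[LG [g Lg Gg]]|[LG [c sc Gc]]]; split => //.
  exists (fun k => ipP g (e k)).
    apply: (@le_lt_trans _ _ (nrm ipP g)%:E); last exact: ltry.
    by apply: nneseries_bound => [n|k]; [exact: bessel_noise|exact: sqn_ge0].
  apply: filterS Gg => t Gt Dt; rewrite Gt//; apply/esym/cseriesE.
  exact: Lop_cvg.
have [g [Lg gE _ _]] := synth_lift sc; exists g => //.
by apply: filterS Gc => t Gt Dt; rewrite Gt// gE.
Qed.

End orthogonal_field.

(** * Rotation invariance of planar Lebesgue measure *)

Section planar_measure.
Context {R : realType}.
Local Notation C := R[i].
Local Notation L := (@lebesgue_measure R).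
Local Notation RR := (measurableTypeR R * measurableTypeR R)%type.

Definition point (p : RR) : Rn R 2 := [tuple p.1; p.2].

Lemma measurable_point : measurable_fun setT point.
Proof.
have -> : point = (fun p : RR => cons_Rn (p.1, cons_Rn (p.2, [tuple]))).
  by apply/funext => p; exact: val_inj.
apply: (measurableT_comp (@measurable_cons_Rn R 1)).
apply/measurable_fun_pairP; split; first exact: measurable_fst.
apply: (measurableT_comp (@measurable_cons_Rn R 0)).
by apply/measurable_fun_pairP; split; [exact: measurable_snd|exact: measurable_cst].
Qed.

Lemma measurable_pointI (A : set (Rn R 2)) : measurable A -> measurable (point @^-1` A).
Proof. by move=> mA; rewrite -[X in measurable X]setTI; exact: measurable_point. Qed.

Lemma leb1E (B : set (Rn R 1)) : measurable B ->
  leb 1 B = L ((fun y => [tuple y]) @^-1` B).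
Proof.
move=> mB.
have mt : measurable_fun setT (fun y : measurableTypeR R => [tuple y] : Rn R 1).
  have -> : (fun y : measurableTypeR R => [tuple y]) = (fun y => cons_Rn (y, [tuple])).
    by apply/funext => p; exact: val_inj.
  apply: (measurableT_comp (@measurable_cons_Rn R 0)).
  by apply/measurable_fun_pairP; split; [exact: measurable_id|exact: measurable_cst].
have mB' : measurable ((fun y : measurableTypeR R => [tuple y] : Rn R 1) @^-1` B).
  by rewrite -[X in measurable X]setTI; exact: mt.
transitivity (\int[L]_y (\1_((fun y : measurableTypeR R => [tuple y] : Rn R 1) @^-1` B) y)%:E)%E; last first.
  by rewrite integral_indic// setIT.
rewrite /= /leb_step /pushforward /product_measure1; apply: eq_integral => y _.
rewrite /= diracE indicE; congr ((_%:R)%:E); congr nat_of_bool.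
have ct : cons_Rn (y, [tuple]) = [tuple y] :> Rn R 1 by exact: val_inj.
by apply/idP/idP; rewrite /xsection !inE /= ?inE /= ct.
Qed.

Lemma leb2E (A : set (Rn R 2)) : measurable A -> leb 2 A = (L \x L)%E (point @^-1` A).
Proof.
move=> mA; rewrite [LHS]/=/leb_step /pushforward /product_measure1.
apply: eq_integral => x _.
have mS : measurable (xsection (@cons_Rn R 1 @^-1` A) x).
  apply: measurable_xsection; rewrite -[X in measurable X]setTI.
  exact: (@measurable_cons_Rn R 1).
transitivity (leb 1 (xsection (@cons_Rn R 1 @^-1` A) x)) => //.
rewrite leb1E//; congr (L _); apply/seteqP; split => y;
  rewrite /xsection /= !inE /=;
  by rewrite (_ : cons_Rn _ = point (x, y))//; exact: val_inj.
Qed.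

Lemma lebesgue_translate (c : R) (A : set (measurableTypeR R)) : measurable A ->
  L ((fun x => x + c) @^-1` A) = L A.
Proof.
move=> mA.
have mt : measurable_fun setT (fun x : measurableTypeR R => x + c : measurableTypeR R).
  by apply: measurable_funD; [exact: measurable_id|exact: measurable_cst].
pose m := measure_function_pushforward__canonical__measure_function_Measure L mt.
rewrite -[LHS]/(m A); apply/esym; apply: lebesgue_measure_unique mA => _ [[a b]] _ <-.
rewrite /m /= /pushforward (_ : _ @^-1` _ = [set` `]a - c, b - c]%R]).
  by rewrite !lebesgue_measure_itv/= !lte_fin ltrD2r; case: ifP => // _; congr (_%:E); ring.
by apply/seteqP; split => x /=; rewrite !in_itv/= ltrBlDr lerBrDr.
Qed.

Definition shear1 (c : R) (p : RR) : RR := (p.1 + c * p.2, p.2).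
Definition shear2 (c : R) (p : RR) : RR := (p.1, p.2 + c * p.1).

Lemma measurable_shear1 c : measurable_fun setT (shear1 c).
Proof.
apply/measurable_fun_pairP; split; last exact: measurable_snd.
apply: measurable_funD; first exact: measurable_fst.
by apply: measurable_funM; [exact: measurable_cst|exact: measurable_snd].
Qed.

Lemma measurable_shear2 c : measurable_fun setT (shear2 c).
Proof.
apply/measurable_fun_pairP; split; first exact: measurable_fst.
apply: measurable_funD; first exact: measurable_snd.
by apply: measurable_funM; [exact: measurable_cst|exact: measurable_fst].
Qed.

(** On each vertical line a vertical shear is a translation. *)
Lemma leb_shear2 c (A : set RR) : measurable A -> (L \x L)%E (shear2 c @^-1` A) = (L \x L)%E A.
Proof.
move=> mA; rewrite /product_measure1; apply: eq_integral => x _.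
transitivity (L ((fun y => y + c * x) @^-1` xsection A x)).
  by congr (L _); apply/seteqP; split => y; rewrite /xsection /= !inE.
by apply: lebesgue_translate; exact: measurable_xsection.
Qed.

Lemma leb_prod_swap (A : set RR) : measurable A -> (L \x L)%E A = (L \x^ L)%E A.
Proof. by apply: product_measure_unique => B B' mB mB' /=; rewrite product_measure2E. Qed.

Lemma leb_shear1 c (A : set RR) : measurable A -> (L \x L)%E (shear1 c @^-1` A) = (L \x L)%E A.
Proof.
move=> mA; have mS : measurable (shear1 c @^-1` A).
  by rewrite -[X in measurable X]setTI; exact: measurable_shear1.
rewrite !leb_prod_swap// /product_measure2; apply: eq_integral => y _.
transitivity (L ((fun x => x + c * y) @^-1` ysection A y)).
  by congr (L _); apply/seteqP; split => x; rewrite /ysection /= !inE.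
by apply: lebesgue_translate; exact: measurable_ysection.
Qed.

Definition rot (u : C) (a : Rn R 2) : Rn R 2 :=
  point (Re u * tnth a ord0 - Im u * tnth a ord_max,
         Im u * tnth a ord0 + Re u * tnth a ord_max).

Lemma measurable_rot u : measurable_fun setT (rot u).
Proof.
have m0 := @measurable_tnth _ (measurableTypeR R) 2 ord0.
have m1 := @measurable_tnth _ (measurableTypeR R) 2 ord_max.
apply: (measurableT_comp measurable_point); apply/measurable_fun_pairP; split => /=.
  by apply: measurable_funB; apply: measurable_funM => //; exact: measurable_cst.
by apply: measurable_funD; apply: measurable_funM => //; exact: measurable_cst.
Qed.

Lemma toC_rot u a : toC (rot u a) = u * toC a.
Proof. by apply: C_eq; rewrite ?ReM ?ImM /toC /rot /=; move: (tnth a _) (tnth a _)  => x y /=; rewrite !(tnth_nth 0) /=; ring. Qed.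

(** A rotation is a product of three shears:
    with s = (p - 1) / q, the matrix with rows (p, -q), (q, p) is
    [1 s; 0 1] [1 0; q 1] [1 s; 0 1]. *)
Lemma leb_rot u (A : set (Rn R 2)) : sqn u = 1 -> Im u != 0 -> measurable A ->
  leb 2 (rot u @^-1` A) = leb 2 A.
Proof.
move=> u1 q0 mA; set p := Re u; set q := Im u; pose s := (p - 1) / q.
have mrA : measurable (rot u @^-1` A).
  by rewrite -[X in measurable X]setTI; exact: measurable_rot.
rewrite !leb2E//; have mpA := measurable_pointI mA.
have m1 := measurable_shear1 s (measurableT) mpA; rewrite setTI in m1.
have m2 := measurable_shear2 q (measurableT) m1; rewrite setTI in m2.
rewrite -(leb_shear1 s mpA) -(leb_shear2 q m1) -(leb_shear1 s m2).
have E : s * q = p - 1 by rewrite /s divfK.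
have pq : p ^+ 2 + q ^+ 2 = 1 by rewrite -sqnE.
have E1 : s * (p + 1) = - q by apply: (mulIf q0); rewrite mulrAC -/q E; lra.
have shears x y : (x + s * y + s * (y + q * (x + s * y)), y + q * (x + s * y)) =
    (p * x - q * y, q * x + p * y).
  congr pair; last by transitivity (q * x + (s * q + 1) * y); [ring|rewrite E; ring].
  transitivity (x + s * q * x + (s * q + 1 + 1) * s * y); first by ring.
  by rewrite E; transitivity (p * x + s * (p + 1) * y); [ring|rewrite E1; ring].
congr (_ _); apply/seteqP; split => -[x y];
  by rewrite /= /rot /shear1 /shear2 /= -!/p -!/q !(tnth_nth 0) /= shears.
Qed.

End planar_measure.

(** * The Szego kernel on the disc *)

Section bounded_functions.
Context {R : realType} {d} {X : measurableType d}.
Variables (mu : {measure set X -> \bar R}) (D : set X).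
Hypothesis mD : measurable D.

Lemma L2_bounded (F : X -> R[i]) (M : R) : Defs.measurableC D F -> (mu D <= M%:E)%E ->
  (forall x, D x -> sqn (F x) <= 1) -> L2 mu D F /\ nrm (L2ip mu D) F <= M.
Proof.
move=> mF muD F1.
have FM : (L2norm2 mu D F <= M%:E)%E.
  apply: le_trans muD; rewrite -[leRHS]mul1e -(integral_cst _ mD).
  apply: ge0_le_integral => //.
  - by move=> x _; rewrite lee_fin sqn_ge0.
  - exact: emeasurable_sqn.
have LF : L2 mu D F by split => //; apply: le_lt_trans FM _; exact: ltry.
by split => //; rewrite -lee_fin -(L2norm2_nrm LF).
Qed.

End bounded_functions.

Section geometric.
Context {R : realType}.
Local Notation C := R[i].

Lemma geometric_cvg (z : C) : sqn z < 1 ->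
  ccvg (fun n => \sum_(k < n) z ^+ k) (1 - z)^-1.
Proof.
move=> z1; have z1' : 1 - z != 0.
  by apply/eqP => /subr0_eq e; move: z1; rewrite -e sqn1 ltxx.
apply: ccvg_sqn; have E n : sqn (\sum_(k < n) z ^+ k - (1 - z)^-1) =
    sqn z ^+ n * sqn (1 - z)^-1.
  rewrite -sqnX -sqnM -sqnN; congr sqn; apply: (mulIf z1').
  rewrite divfK// mulNr mulrBl mulVf// mulrC -[1 - z]opprB mulNr -subrX1.
  ring.
apply: (@cvg_ext _ (fun n => sqn z ^+ n * sqn (1 - z)^-1)) => //.
rewrite -(mul0r (sqn (1 - z)^-1)); apply: cvgMl.
by apply: cvg_expr; rewrite ger0_norm// sqn_ge0.
Qed.

End geometric.

Section circle_noise.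
Context {R : realType}.
Local Notation C := R[i].
Local Notation P := (@circle R).
Local Notation ipP := (L2ip P setT).

Lemma cisX (theta : measurableTypeR R) n :
  cis theta ^+ n = (cos (n%:R * theta) +i* sin (n%:R * theta))%C.
Proof.
elim: n => [|n IHn]; first by rewrite mul0r cos0 sin0.
rewrite exprS IHn -[n.+1]add1n natrD mulrDl mul1r cosD sinD.
by apply: C_eq; rewrite ?ReM ?ImM /=; ring.
Qed.

Lemma sqn_cis (theta : measurableTypeR R) : sqn (cis theta) = 1.
Proof. by rewrite sqnE /= cos2Dsin2. Qed.

Lemma measurable_cisX n : Defs.measurableC setT (fun theta : measurableTypeR R => cis theta ^+ n).
Proof.
have mn : measurable_fun setT (fun theta : measurableTypeR R => n%:R * theta : R).
  by apply: measurable_funM; [exact: measurable_cst|exact: measurable_id].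
have -> : (fun theta : measurableTypeR R => cis theta ^+ n) =
    fun theta => (cos (n%:R * theta) +i* sin (n%:R * theta))%C.
  by apply/funext => theta; rewrite cisX.
split => /=; (apply: measurableT_comp => //; apply: continuous_measurable_fun).
  exact: continuous_cos.
exact: continuous_sin.
Qed.

Lemma L2_cisX n : L2 P setT (fun theta => cis theta ^+ n).
Proof.
have [] // := @L2_bounded _ _ _ P setT measurableT _ 1 (measurable_cisX n).
  exact: (@probability_le1 _ _ _ P).
by move=> x _; rewrite sqnX sqn_cis expr1n.
Qed.

(** The fundamental theorem of calculus. The constant 1 is added to f because the
    formula for integrals against the uniform law is for nonnegative functions. *)
Lemma circle_mean0 (f F : R -> R) : continuous f -> (forall x, `|f x| <= 1) ->
  (forall x : R, is_derive x 1 F (f x)) -> F (pi *+ 2) = F 0 ->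
  (\int[P]_x f x)%R = 0.
Proof.
move=> cf f1 dF FF.
have mf : measurable_fun setT (f : measurableTypeR R -> R) by exact: continuous_measurable_fun.
have If : P.-integrable setT (EFin \o f).
  apply: (@le_integrable _ _ _ _ _ measurableT _ (cst 1%E)) => //.
  - exact/measurable_EFinP.
  - by move=> x _; rewrite /= normr1 lee_fin f1.
  - by apply: finite_measure_integrable_cst.
have c1 : continuous (fun x => 1 + f x).
  by move=> x; apply: cvgD; [exact: cvg_cst|exact: cf].
have dG (x : R) : is_derive x 1 (fun x => x + F x) (1 + f x).
  by have := dF x => ?; apply: is_deriveD.
have cG (x : R) : {for x, continuous (fun x => x + F x)}.
  apply: differentiable_continuous; apply/derivable1_diffP; exact: ex_derive.
have H : (\int[P]_x (1 + f x)%:E = 1%:E)%E.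
  rewrite /circle integral_uniform/=; last 2 first.
  - by apply/measurable_EFinP; exact: continuous_measurable_fun.
  - by move=> x; rewrite lee_fin; have := f1 x; rewrite ler_norml; lra.
  rewrite (@continuous_FTC2 _ _ (fun x => x + F x)).
  - by rewrite FF -EFinB -EFinM subr0 add0r addrK mulVf// gt_eqF// pi2_gt0.
  - exact: pi2_gt0.
  - by apply: continuous_in_subspaceT => x _; exact: c1.
  - split; first by move=> x _; exact: ex_derive.
      by apply: cvg_at_right_filter; exact: cG.
    by apply: cvg_at_left_filter; exact: cG.
  - by move=> x _; rewrite derive1E; exact: derive_val.
move: H; under eq_integral do rewrite EFinD.
rewrite integralD//; last exact: finite_measure_integrable_cst.
rewrite integral_cst// [X in (_ * X)%E]probability_setT mule1.
rewrite /Rintegral; have /fineK <- : (\int[P]_x (f x)%:E)%E \is a fin_num.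
  exact: integrable_fin_num.
by rewrite -EFinD => -[]; lra.
Qed.

Lemma cintegral_cisX n : (0 < n)%N -> cintegral P setT (fun theta => cis theta ^+ n) = 0.
Proof.
move=> n0; have n0' : n%:R != 0 :> R by rewrite pnatr_eq0 -lt0n.
have dl (x : R) : is_derive x 1 ( *%R n%:R) (n%:R : R).
  by apply: is_derive_eq; rewrite /GRing.scale /= mulr1 //.
have cl : continuous ( *%R (n%:R : R)) by move=> x; exact: mulrl_continuous.
have per : n%:R * (pi *+ 2) = pi *+ 2 *+ n :> R by rewrite mulr_natl.
have cos2 : cos (pi *+ 2 *+ n : R) = 1.
  by elim: n {n0 n0' dl cl per} => [|n IH]; rewrite ?mulr0n ?cos0// mulrSr cosD2pi.
have sin2 : sin (pi *+ 2 *+ n : R) = 0.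
  by elim: n {n0 n0' dl cl per cos2} => [|n IH]; rewrite ?mulr0n ?sin0// mulrSr sinD2pi.
have -> : (fun theta : measurableTypeR R => cis theta ^+ n) =
    fun theta => (cos (n%:R * theta) +i* sin (n%:R * theta))%C.
  by apply/funext => theta; rewrite cisX.
rewrite /cintegral /=; apply: C_eq => /=.
- apply: (@circle_mean0 _ (fun x => n%:R^-1 * sin (n%:R * x))).
  + by move=> x; apply: continuous_comp; [exact: cl|exact: continuous_cos].
  + by move=> x; rewrite ler_norml cos_geN1 cos_le1.
  + by move=> x; apply: is_derive_eq; rewrite /GRing.scale /=; field.
  + by rewrite per sin2 !mulr0 sin0 mulr0.
- apply: (@circle_mean0 _ (fun x => - n%:R^-1 * cos (n%:R * x))).
  + by move=> x; apply: continuous_comp; [exact: cl|exact: continuous_sin].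
  + by move=> x; rewrite ler_norml sin_geN1 sin_le1.
  + by move=> x; apply: is_derive_eq; rewrite /GRing.scale /=; field.
  + by rewrite per cos2 mulr0 cos0.
Qed.

Lemma ip_cisX m n :
  ipP (fun theta => cis theta ^+ m) (fun theta => cis theta ^+ n) = (m == n)%:R.
Proof.
have H i j : (j <= i)%N ->
    ipP (fun theta => cis theta ^+ i) (fun theta => cis theta ^+ j) = (i == j)%:R.
  move=> ji; rewrite /L2ip (_ : (fun x => _) = fun theta => cis theta ^+ (i - j)); last first.
    apply/funext => theta; rewrite -{1}(subnK ji) exprD -mulrA mulJ sqnX sqn_cis.
    by rewrite expr1n mulr1.
  have [->|ij] := eqVneq i j.
    have -> : (fun theta : measurableTypeR R => cis theta ^+ (j - j)) = fun=> 1.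
      by apply/funext => theta; rewrite subnn.
    by rewrite /cintegral /Rintegral /= !integral_prob_cst.
  by rewrite cintegral_cisX// subn_gt0 ltn_neqAle eq_sym ij.
have [nm|/ltnW mn] := leqP n m; first exact: H.
rewrite (ipJ (hilbert_L2 P measurableT) (L2_cisX n) (L2_cisX m)) H// eq_sym.
by case: eqP => _; rewrite ?conjc1 ?conjc0.
Qed.

End circle_noise.

Section disc_powers.
Context {R : realType}.
Local Notation C := R[i].
Local Notation L := (@lebesgue_measure R).
Local Notation ipD := (L2ip (leb 2) (@disc R)).
Local Notation z k := (fun a : Rn R 2 => toC a ^+ k).

Lemma measurable_toC : Defs.measurableC setT (@toC R).
Proof.
by split; [exact: (@measurable_tnth _ (measurableTypeR R) 2 ord0)|
           exact: (@measurable_tnth _ (measurableTypeR R) 2 ord_max)].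
Qed.

Lemma measurable_toCX k : Defs.measurableC setT (z k).
Proof.
elim: k => [|k IHk]; first exact: mC_cst.
rewrite (_ : (fun _ => _) = fun a => toC a * toC a ^+ k); last by apply/funext => a; rewrite exprS.
by apply: mC_M IHk; exact: measurable_toC.
Qed.

Lemma measurable_disc : measurable (@disc R).
Proof.
rewrite -[X in measurable X]setTI.
have := measurable_sqn measurable_toC measurableT (measurable_itv `]-oo, (1 : R)[).
by congr (measurable (_ `&` _)); apply/seteqP; split => a; rewrite /disc /= in_itv.
Qed.

Lemma leb_square (a b : R) (A : set (Rn R 2)) : a < b ->
  (forall x, A x <-> (a < tnth x ord0 < b) /\ (a < tnth x ord_max < b)) ->
  measurable A /\ leb 2 A = ((b - a) ^+ 2)%:E.
Proof.
move=> ab hA.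
have m0 := @measurable_tnth _ (measurableTypeR R) 2 ord0.
have m1 := @measurable_tnth _ (measurableTypeR R) 2 ord_max.
have mI : measurable (`]a, b[%classic : set (measurableTypeR R)) by exact: measurable_itv.
have mA : measurable A.
  have := measurableI _ _ (m0 measurableT _ mI) (m1 measurableT _ mI); rewrite !setTI.
  congr measurable; apply/seteqP; split => x; first by rewrite /= !in_itv => h; exact/hA.
  by move/hA; rewrite /= !in_itv.
split => //; rewrite leb2E// (_ : _ @^-1` A = `]a, b[%classic `*` `]a, b[%classic).
  have Lab : L `]a, b[%classic = (b - a)%:E by rewrite lebesgue_measure_itv/= lte_fin ab.
  by rewrite product_measure1E// expr2 EFinM -Lab.
by apply/seteqP; split => -[x y]; [move/hA|move=> h; apply/hA; move: h];
  rewrite /= !(tnth_nth 0) /= !in_itv.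
Qed.

Lemma leb_disc : (leb 2 (@disc R) <= 4%:E)%E.
Proof.
pose A : set (Rn R 2) := [set x | (-1 < tnth x ord0 < 1) /\ (-1 < tnth x ord_max < 1)].
have [mA A4] := @leb_square (-1) 1 A (gtrN ltr01) (fun=> iff_refl _).
have -> : 4%:E = leb 2 A by rewrite A4; congr EFin; ring.
apply: le_measure; rewrite ?inE//; first exact: measurable_disc.
move=> x; rewrite /disc /= sqnE /= => x1.
by split; rewrite -ltr_norml; apply: norm_lt_sqr => //; rewrite expr1n;
  apply: le_lt_trans x1; rewrite ?lerDl ?lerDr sqr_ge0.
Qed.

Lemma sqn_disc_le a k : disc a -> sqn (toC a ^+ k) <= 1 :> R.
Proof. by move=> /ltW a1; rewrite sqnX exprn_ile1// sqn_ge0. Qed.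

Lemma measurable_toCX_disc k : Defs.measurableC (@disc R) (z k).
Proof.
have [mr mi] := measurable_toCX k; have md := measurable_disc.
by split; [apply: measurable_funS mr|apply: measurable_funS mi].
Qed.

Lemma L2_toCX k : L2 (leb 2) disc (z k) /\ nrm ipD (z k) <= 4.
Proof.
apply: (L2_bounded measurable_disc (measurable_toCX_disc k) leb_disc) => a.
exact: sqn_disc_le.
Qed.

(** A power of the variable has no zero on a square inside the disc. *)
Lemma nrm_toCX_gt0 k : 0 < nrm ipD (z k).
Proof.
have [Lk _] := L2_toCX k; have HD := hilbert_L2 (leb 2) measurable_disc.
rewrite lt_neqAle (nrm_ge0 HD Lk) andbT eq_sym; apply/eqP => /(nrm_eq0 HD Lk) => -[N [mN N0 sN]].
pose A : set (Rn R 2) := [set x | (4^-1 < tnth x ord0 < 2^-1) /\ (4^-1 < tnth x ord_max < 2^-1)].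
have h42 : 4^-1 < 2^-1 :> R by lra.
have [mA A4] := leb_square h42 (fun x => iff_refl (A x)).
have : (leb 2 A <= leb 2 N)%E.
  apply: le_measure; rewrite ?inE// => x [/andP[x1 x2] /andP[x3 x4]]; apply: sN => /= h.
  have /h/eqP : disc x by rewrite /disc /= sqnE /=; nra.
  rewrite expf_eq0 => /andP[_ /eqP/(congr1 (@Re _))] /= x0.
  by move: x1; rewrite x0; lra.
by rewrite N0 A4 lee_fin; apply/negP; rewrite -ltNge; lra.
Qed.

Lemma disc_rot (u : C) : sqn u = 1 -> rot u @^-1` disc = @disc R.
Proof.
by move=> u1; apply/seteqP; split => a; rewrite /disc /= toC_rot sqnM u1 mul1r.
Qed.

Lemma Rintegral_rot (u : C) (g : Rn R 2 -> R) : sqn u = 1 -> Im u != 0 ->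
  measurable_fun setT g -> (forall a, disc a -> `|g a| <= 1) ->
  (\int[leb 2]_(a in disc) g (rot u a))%R = (\int[leb 2]_(a in disc) g a)%R.
Proof.
move=> u1 q0 mg g1; have md := measurable_disc.
have mr := measurable_rot u.
have mgr : measurable_fun setT (g \o rot u) by exact: measurableT_comp.
have mgE : measurable_fun setT (EFin \o g) by exact/measurable_EFinP.
have Ig : (leb 2).-integrable (rot u @^-1` disc) ((EFin \o g) \o rot u).
  rewrite disc_rot//; apply: (@le_integrable _ _ _ _ _ md _ (cst 1%E)).
  - by apply/measurable_EFinP; exact: measurable_funS mgr.
  - move=> a da; rewrite /= normr1 lee_fin g1// -[disc _]/((rot u @^-1` disc) a).
    by rewrite disc_rot.
  - apply/integrableP; split; first exact: measurable_cst.
    under eq_integral do rewrite /= normr1.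
    by rewrite integral_cst// mul1e; apply: le_lt_trans leb_disc _; exact: ltry.
have H := integral_pushforward mr mgE Ig md.
rewrite /Rintegral; congr fine; rewrite -{1}(disc_rot u1).
transitivity (\int[pushforward (leb 2) (rot u)]_(y in disc) (EFin \o g) y)%E; first exact: esym H.
by apply: eq_measure_integral => A mA _; exact: leb_rot.
Qed.

Lemma cintegral_rot (u : C) (G : Rn R 2 -> C) : sqn u = 1 -> Im u != 0 ->
  Defs.measurableC setT G -> (forall a, disc a -> sqn (G a) <= 1) ->
  cintegral (leb 2) disc (fun a => G (rot u a)) = cintegral (leb 2) disc G.
Proof.
move=> u1 q0 [mr mi] G1.
have abs1 (x : R) : x ^+ 2 <= 1 -> `|x| <= 1 by rewrite -real_normK ?num_real// expr_le1.
rewrite /cintegral; congr (_ +i* _)%C.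
- rewrite (Rintegral_rot (g := fun a => Re (G a)))// => a /G1; move=> h; apply: abs1.
  exact: le_trans (Re_sqr_le _) h.
- rewrite (Rintegral_rot (g := fun a => Im (G a)))// => a /G1; move=> h; apply: abs1.
  exact: le_trans (Im_sqr_le _) h.
Qed.

(** Rotation by u multiplies the inner product of two powers by the difference
    of the powers of u; taking u with u^(m - n) = i forces it to vanish. *)
Lemma ip_toCX (m n : nat) : m != n -> ipD (z m) (z n) = 0.
Proof.
have HD := hilbert_L2 (leb 2) measurable_disc.
have H i k : (0 < k)%N -> ipD (z (k + i)%N) (z i) = 0.
  move=> k0; pose th : R := pi / 2 / k%:R; pose u : C := cis th.
  have k0' : 0 < k%:R :> R by rewrite ltr0n.
  have th0 : 0 < th by rewrite !divr_gt0// pi_gt0.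
  have thk : th <= pi / 2.
    by rewrite ler_pdivrMr// ler_peMr ?divr_ge0 ?pi_ge0// ler1n.
  have u1 : sqn u = 1 by exact: sqn_cis.
  have q0 : Im u != 0.
    by rewrite gt_eqF// /u /= sin_gt0_pi// th0 (le_lt_trans thk)//; have := pi_gt0 R; lra.
  have uk : u ^+ k = 'i%C.
    by rewrite /u cisX mulrC /th divfK ?gt_eqF// cos_pihalf sin_pihalf.
  pose G (a : Rn R 2) := toC a ^+ (k + i) * (toC a ^+ i)^*%C.
  have G1 a : disc a -> sqn (G a) <= 1.
    by move=> da; rewrite sqnM sqnJ mulr_ile1 ?sqn_ge0// sqn_disc_le.
  have mG : Defs.measurableC setT G by apply: mC_M; [|apply: mC_J]; exact: measurable_toCX.
  have GE : (fun a => G (rot u a)) = fun a => 'i%C * G a.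
    apply/funext => a; rewrite /G toC_rot !exprMn conjM mulrACA; congr (_ * _).
    by rewrite exprD uk -mulrA mulJ sqnX u1 expr1n mulr1.
  have := cintegral_rot u1 q0 mG G1; rewrite GE cintegralZ; last 2 first.
    - exact: measurable_disc.
    - by apply: (integrableC_ip measurable_disc); exact: (L2_toCX _).1.
  have i1 : ('i%C - 1 : C) != 0.
    by apply/eqP => /(congr1 (@Im _)) /=; apply/eqP; rewrite subr0 oner_eq0.
  move=> /eqP; rewrite -subr_eq0 -{2}(mul1r (cintegral _ _ _)) -mulrBl mulf_eq0.
  by rewrite (negbTE i1) => /eqP.
move=> mn; have [nm|] := ltnP n m.
  by rewrite -(subnK (ltnW nm)) H// subn_gt0.
rewrite leq_eqVlt (negbTE mn) /= => lt_mn.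
rewrite (ipJ HD (L2_toCX n).1 (L2_toCX m).1) -(subnK (ltnW lt_mn)) H ?subn_gt0//.
exact: conjc0.
Qed.

End disc_powers.

Section szego_isometry.
Context {R : realType}.
Local Notation C := R[i].
Local Notation P := (@circle R).
Local Notation ipP := (L2ip P setT).
Local Notation ipD := (L2ip (leb 2) (@disc R)).
Let HP := hilbert_L2 P measurableT.

Lemma orthogonal_hardy_isometry (h : Rn R 2 -> measurableTypeR R -> C)
    (U : (C -> C) -> Rn R 2 -> C) (b : nat -> Rn R 2 -> C)
    (e : nat -> measurableTypeR R -> C) (W : R) :
  (forall k, L2 P setT (e k)) -> (forall i j, ipP (e i) (e j) = (i == j)%:R) ->
  (forall k, L2 (leb 2) disc (b k)) -> (forall i j : nat, i != j -> ipD (b i) (b j) = 0) ->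
  (forall k, 0 < nrm ipD (b k)) -> (forall k, nrm ipD (b k) <= W) ->
  (forall a, disc a -> L2 P setT (h a)) ->
  (forall a, disc a -> hcvg ipP (comb (fun k => (b k a)^*%C) e) (fun w => (h a w)^*%C)) ->
  (forall F c, hardy_coef F c -> forall a, disc a -> U F a = synth b c a) ->
  hardy_isometry h U.
Proof.
move=> Le one Lb ob b_gt0 b_le Lh hx UE.
have md := @measurable_disc R.
have adj := orthogonal_has_adjoint md Le one Lb ob b_gt0 b_le Lh hx.
have sum_hardy c : sq_summable c -> hardy_coef (fun z => cseries (fun k => c k * z ^+ k)) c.
  by [].
split.
- apply/seteqP; split => G.
    move/(RL_synth (leb 2) Le one Lh hx) => [LG [c sc Gc]].
    split => //; exists (fun z => cseries (fun k => c k * z ^+ k)); first by exists c.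
    by apply: filterS Gc => a Ga da; rewrite Ga// (UE _ c).
  move=> [LG [F [c hc] GF]]; apply/(RL_synth (leb 2) Le one Lh hx); split => //.
  exists c; first exact: hc.1.
  by apply: filterS GF => a Ga da; rewrite Ga// (UE _ c).
- move=> F G c c' hF hG.
  by apply: (HKip_synth md Le one Lb ob b_gt0 b_le Lh hx hF.1 hG.1); exact: UE.
- move=> J lam phi KL; split; first exact: (RL_eq_HC md adj KL).
  by move=> F G HF HG; exact: (HKip_HCip md adj KL HF HG).
Qed.

Lemma szego_ratio_lt1 (a : Rn R 2) (theta : measurableTypeR R) : disc a ->
  sqn ((toC a)^*%C * cis theta) < 1.
Proof. by move=> da; rewrite sqnM sqnJ sqn_cis mulr1. Qed.

Lemma cisX_geometric (a : Rn R 2) k (theta : measurableTypeR R) :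
  (toC a ^+ k)^*%C * cis theta ^+ k = ((toC a)^*%C * cis theta) ^+ k.
Proof. by rewrite exprMn rmorphXn. Qed.

Lemma szego_expand (a : Rn R 2) : disc a ->
  L2 P setT (szego_field a) /\
  hcvg ipP (comb (fun k => (toC a ^+ k)^*%C) (fun k theta => cis theta ^+ k)) (szego_field a).
Proof.
move=> da; apply: (@comb_pointwise _ _ _ P setT measurableT _ _ (1 - sqn (toC a))^-1).
- exact: L2_cisX.
- by move=> i j /negbTE ij; rewrite ip_cisX ij.
- move=> n; apply: le_trans (geometric_le n (sqn_ge0 _) da); apply: ler_sum => k _.
  by rewrite /nrm ip_cisX eqxx /= mulr1 sqnJ sqnX.
move=> theta _; have := geometric_cvg (szego_ratio_lt1 theta da).
by apply: ccvg_ext => n; apply: eq_bigr => k _; rewrite cisX_geometric.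
Qed.

Lemma szego_hardy :
  hardy_isometry (fun (a : Rn R 2) theta => (szego_field a theta)^*%C)
    (fun (F : C -> C) a => F (toC a)).
Proof.
apply: (@orthogonal_hardy_isometry _ _ (fun k a => toC a ^+ k) (fun k theta => cis theta ^+ k) 4).
- exact: L2_cisX.
- exact: ip_cisX.
- by move=> k; have [] := L2_toCX (R := R) k.
- exact: ip_toCX.
- exact: nrm_toCX_gt0.
- by move=> k; have [] := L2_toCX (R := R) k.
- by move=> a /szego_expand[La _]; apply: L2J.
- move=> a /szego_expand[_ ha].
  by have -> : (fun w => (szego_field a w)^*%C^*%C) = szego_field a by apply/funext => w; rewrite conjcK.
- by move=> F c [_ FE] a da; rewrite FE.
Qed.

(** Only the constant term of the expansion has a nonzero mean. *)
Lemma mean_szego (a : Rn R 2) : disc a -> mean P szego_field a = 1.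
Proof.
move=> da; have [La ha] := szego_expand da.
have oe (i j : nat) : i != j -> ipP (fun theta => cis theta ^+ i) (fun theta => cis theta ^+ j) = 0.
  by move=> /negbTE ij; rewrite ip_cisX ij.
have := ip_hcvg_comb HP (@L2_cisX R) oe La ha 0%N.
rewrite /nrm ip_cisX eqxx (_ : (toC a ^+ 0)^*%C = 1) ?mul1r; last exact: conjc1.
by move=> E; rewrite -[LHS]L2ip1 -[RHS]E.
Qed.

Lemma centered_szegoE (a : Rn R 2) theta : disc a ->
  centered P szego_field a theta =
  (toC a)^*%C * cis theta * (1 - (toC a)^*%C * cis theta)^-1.
Proof.
move=> da; rewrite /centered mean_szego// /szego_field /szego.
set w := _ * cis theta; have w1 : 1 - w != 0.
  apply/eqP => /subr0_eq e; have := szego_ratio_lt1 theta da.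
  by rewrite -/w -e sqn1 ltxx.
by apply: (mulIf w1); rewrite mulrBl mulVf// mul1r divfK// opprB addrC subrK.
Qed.

Lemma power_series_cvg (c : nat -> C) (z : C) : sq_summable c -> sqn z < 1 ->
  exists l, ccvg (fun n => \sum_(k < n) c k * z ^+ k) l.
Proof.
move=> /(nneseries_lty (fun k => sqn_ge0 (c k)))[M cM] z1.
apply: (@ccvg_summable R (fun k => c k * z ^+ k) (fun k => sqn (c k) + sqn z ^+ k)
  (M + (1 - sqn z)^-1)) => [k|k|n].
- by rewrite -sqnX norm_Re_le.
- by rewrite -sqnX norm_Im_le.
- by rewrite big_split lerD// geometric_le// sqn_ge0.
Qed.

Lemma ip_conj {d} {X : measurableType d} (mu : {measure set X -> \bar R}) D (F G : X -> C) :
  L2ip mu D (fun x => (F x)^*%C) (fun x => (G x)^*%C) = (L2ip mu D F G)^*%C.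
Proof.
by rewrite /L2ip -cintegralJ; congr cintegral; apply/funext => x; rewrite conjM.
Qed.

(** Centering removes the constant term of the geometric series, so that the
    conjugate of h is the sum of conj(e^(i theta))^(k+1) a^(k+1). The functions
    synthesized are then conj(a) F(conj a) for F in the Hardy space. *)
Lemma centered_szego_hardy :
  hardy_isometry (centered P szego_field)
    (fun (F : C -> C) a => (toC a)^*%C * F (toC a)^*%C).
Proof.
pose b k (a : Rn R 2) := (toC a ^+ k.+1)^*%C.
pose e k (theta : measurableTypeR R) := (cis theta ^+ k.+1)^*%C.
have Le k : L2 P setT (e k) by apply: L2J; exact: L2_cisX.
have one i j : ipP (e i) (e j) = (i == j)%:R.
  by rewrite ip_conj ip_cisX eqSS; case: eqP => _; rewrite ?conjc0 ?conjc1.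
have h_expand a : disc a -> L2 P setT (fun w => (centered P szego_field a w)^*%C) /\
    hcvg ipP (comb (fun k => (b k a)^*%C) e) (fun w => (centered P szego_field a w)^*%C).
  move=> da; apply: (@comb_pointwise _ _ _ P setT measurableT _ _ (1 - sqn (toC a))^-1) => //.
  - by move=> i j /negbTE ij; rewrite one ij.
  - move=> n; apply: le_trans (geometric_le n (sqn_ge0 _) da); apply: ler_sum => k _.
    rewrite /nrm one eqxx /= mulr1 !sqnJ sqnX exprS.
    exact: ler_piMl (exprn_ge0 _ (sqn_ge0 _)) (ltW da).
  move=> theta _; rewrite centered_szegoE//.
  have := ccvgJ (ccvgMl ((toC a)^*%C * cis theta) (geometric_cvg (szego_ratio_lt1 theta da))).
  apply: ccvg_ext => n; rewrite mulr_sumr conj_sum; apply: eq_bigr => k _.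
  by rewrite /b /e -exprS -cisX_geometric conjM.
apply: (@orthogonal_hardy_isometry _ _ b e 4) => //.
- by move=> k; apply: L2J; have [] := L2_toCX (R := R) k.+1.
- by move=> i j ij; rewrite ip_conj ip_toCX ?eqSS// conjc0.
- by move=> k; rewrite /nrm ip_conj ReJ; exact: nrm_toCX_gt0.
- by move=> k; rewrite /nrm ip_conj ReJ; have [] := L2_toCX (R := R) k.+1.
- move=> a da; have [La _] := h_expand a da.
  have -> : centered P szego_field a = fun w => ((centered P szego_field a w)^*%C)^*%C.
    by apply/funext => w; rewrite conjcK.
  exact: L2J.
- by move=> a da; have [] := h_expand a da.
- move=> F c [sc FE] a da; rewrite /synth FE ?sqnJ//.
  have a1 : sqn (toC a)^*%C < 1 by rewrite sqnJ.
  have [l cl] := power_series_cvg sc a1.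
  rewrite (cseriesE cl); apply/esym/cseriesE.
  apply: ccvg_ext (ccvgMl (toC a)^*%C cl) => n; rewrite mulr_sumr; apply: eq_bigr => k _.
  by rewrite /b rmorphXn /= exprS mulrCA.
Qed.

End szego_isometry.

(** * Random fields on compact sets, and the Szego kernel *)

Theorem theorem1 (R : realType) :
  (forall (d : nat) (D : set (Rn R d))
     (dO : measure_display) (O : measurableType dO) (P : probability O R)
     (f : Rn R d -> O -> R[i])
     (J : countType) (lam : nat -> R) (phi : nat + J -> Rn R d -> R[i]),
   compact [set \row_i tnth x i | x in D] ->
   inN (leb d) D P f ->
   let mu := leb d in
   let h := centered P f in
   let T := Top mu D P h in
   KL_basis mu D lam phi T ->
   let HC := HC mu D lam phi in
   let HCip := HCip mu D lam phi in
   let HCnorm2 := HCnorm2 mu D lam phi in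
   let S := Ssum mu D h lam phi in
   (* (i) *)
   (HCfull mu D lam phi 0%N `<=` L2 mu D /\ HC 0%N `<=` L2 mu D) /\
   (* (ii) *)
   (forall n : nat,
      [/\ {ae mu, forall t, D t ->
             cvar P (fun w => f t w - S n t w) =
             (complex.Re (cov P h t t) -
               \sum_(k < n) lam k * sqn (phi (inl (k : nat)) t))%:E},
          Nnorm2 mu D P (fun t w => f t w - mean P f t - S n t w) =
            (\sum_(n <= k <oo) (lam k)%:E)%E,
          (\int[mu]_(t in D) `|cvar P (f t)|)%E =
            (\sum_(0 <= k <oo) (lam k)%:E)%E &
          [/\ Nnorm2 mu D P (S n) =
                (\int[P]_w (\sum_(k < n)
                   sqn (L2ip mu D (h ^~ w) (phi (inl (k : nat)))))%:E)%E,
              (\int[P]_w (\sum_(k < n)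
                 sqn (L2ip mu D (h ^~ w) (phi (inl (k : nat)))))%:E)%E =
                (complex.Re (\sum_(k < n)
                   L2ip mu D (T (phi (inl (k : nat)))) (phi (inl (k : nat)))))%:E &
              \sum_(k < n)
                L2ip mu D (T (phi (inl (k : nat)))) (phi (inl (k : nat))) =
                (\sum_(k < n) lam k)%:C%C]]) /\
   (* (iii) *)
   (exists E, [/\ conull mu D E,
      rkhs_on mu D E (HC 0%N) (HCip 0%N) (cov P h) &
      closure_in (HC 0%N) (HCnorm2 0%N) (lin_span [set cov P h ^~ s | s in E]) = HC 0%N]) /\
   (* (iv) *)
   (forall psi : nat -> Rn R d -> R[i], orthonormal_basis mu D psi ->
      forall n : nat,
      \sum_(k < n) L2ip mu D (T (psi k)) (psi k) <=
      \sum_(k < n) L2ip mu D (T (phi (inl (k : nat)))) (phi (inl (k : nat)))) /\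
   (* (v) *)
   (finite_set [set k | lam k != 0] -> {ae P, forall w, HC 0%N (h ^~ w)}) /\
   (* (vi) *)
   (RL mu D P h = HC 0%N /\
    forall F G, HC 0%N F -> HC 0%N G -> HKip mu D P h F G = HCip 0%N F G) /\
   (* (vii) *)
   [/\ RT mu D P h `<=` HC 1%N,
       RT mu D P h `<=` HC 0%N /\ exists M : R, forall F, RT mu D P h F ->
         (HCnorm2 0%N F <= M%:E * HCnorm2 1%N F)%E,
       HC 0%N `<=` L2 mu D /\ exists M : R, forall F, HC 0%N F ->
         (L2norm2 mu D F <= M%:E * HCnorm2 0%N F)%E &
       (RT mu D P h = HC 0%N /\ HC 0%N = mod_null mu D lam phi (L2 mu D)) <->
       finite_set [set k | lam k != 0]] /\
   (* (viii) *)
   (forall j : nat,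
      (exists E, conull mu D E /\
         rkhs_on mu D E (HC j) (HCip j) (Cker lam phi j)) /\
      image_of mu D T (HC j) = HC (j + 2)%N)) /\
  (* (vi), the Szego kernel and the Hardy space *)
  hardy_isometry (fun (a : Rn R 2) theta => (szego_field a theta)^*%C)
    (fun (F : R[i] -> R[i]) a => F (toC a)) /\
  hardy_isometry (centered circle szego_field)
    (fun (F : R[i] -> R[i]) a => (toC a)^*%C * F (toC a)^*%C).
Proof.
split; last by split; [exact: szego_hardy|exact: centered_szego_hardy].
move=> d D dO O P f J lam phi cD fN mu h T KL HC' HCip' HCnorm2' S'.
have mD := compact_measurable_tuple cD.
have adj := field_has_adjoint mD (centered_inN mD fN).
have [_ lam_ge0 lam_dec _] := KL.
have [E nE rE] := regular_set mD fN KL.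
split; first by split=> F; [case|case=> -[]].
split.
  move=> n; split.
  - by apply: filterS (ae_regular mD fN KL) => t rt Dt; apply: (cvar_residual mD fN KL); exact: rt.
  - exact: (norm_residual mD fN KL).
  - exact: (norm_var mD fN KL).
  - split; last exact: (sum_T_phi mD fN KL); first exact: (norm_Ssum mD fN KL).
    by rewrite (sum_moments mD fN KL) (sum_T_phi mD fN KL).
split.
  by exists E; split => //; [exact: (rkhs_cov mD fN KL nE rE)|exact: (cov_dense mD fN KL nE rE)].
split; first by move=> psi psi_onb n; exact: (KL_optimal mD fN KL).
split; first exact: (sample_HC mD fN KL).
split.
  split; first exact: (RL_eq_HC mD adj KL).
  by move=> F G HF HG; exact: (HKip_HCip mD adj KL HF HG).
split.
  split; last exact: (RT_full mD fN KL).
  - by rewrite (RT_eq_HC mD adj KL).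
  - split; last by exists (lam 0%N) => F; exact: (RT_bound mD fN KL).
    by rewrite (RT_eq_HC mD adj KL) => F; exact: (HC_mono lam_ge0 lam_dec (leq0n 1)).
  - split; first by move=> F; exact: HC_L2.
    by exists (lam 0%N) => F; exact: (HC_bound mD KL).
move=> j; split; last exact: (T_HC mD adj KL).
by exists E; split => //; exact: (rkhs_Cker mD fN KL nE rE).
Qed.
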